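(* Let $k$ be a field with $\operatorname{char}k=0$ or $\operatorname{char}k>13$, let $J$ be an Albert algebra over $k$, let $G=\operatorname{Aut}(J)$ (a group of type $F_4$) with Lie algebra $\mathfrak f_4=\operatorname{Der}(J)$, and let $W=e^\perp$ be the $26$-dimensional space of traceless elements of $J$. Let $\star:\mathrm{S}^2W\times\mathrm{S}^2W\to\mathrm{S}^2W$ be the bilinear multiplication given, for $a,b,c,d\in W$, by $$\begin{aligned}ab\star cd=\;&\tfrac1{24}\big(\langle a,c\rangle(bd*\mathrm{id}_W+bd)+\langle a,d\rangle(bc*\mathrm{id}_W+bc)+\langle b,c\rangle(ad*\mathrm{id}_W+ad)+\langle b,d\rangle(ac*\mathrm{id}_W+ac)\big)\\&+\tfrac1{36}\big(\langle a,c\rangle bd+\langle a,d\rangle bc+\langle b,c\rangle ad+\langle b,d\rangle ac+\langle a,b\rangle cd+\langle c,d\rangle ab\big)\\&-\tfrac16\,ab*cd-\tfrac1{72}\big(\langle a,c\rangle\langle b,d\rangle+\langle a,d\rangle\langle b,c\rangle\big)\mathrm{id}_W,\end{aligned}$$ and let $A=\{\sum_iX_iY_i\in\mathrm{S}^2W\mid\sum_iX_i*Y_i=0\}$. Then $u\star u'\in A$ for all $u,u'\in A$, and the algebra $A(\mathfrak f_4)$ (with product $\diamond$) is isomorphic to $A$ with multiplication $\star$.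
   Context: The split Albert algebra is $\mathcal H_3(\mathbb O)$, the $3\times3$ hermitian matrices over the split octonions $\mathbb O$, with Jordan product $x\cdot y=\tfrac12(xy+yx)$ and trace form $\langle x,y\rangle=\operatorname{Tr}(x\cdot y)$. An Albert algebra over $k$ is a $k$-algebra $J$ with a bilinear form $\langle\cdot,\cdot\rangle$ becoming isomorphic to $\mathcal H_3(\mathbb O)$ with its trace form over $\bar k$. $e$ is the identity of $J$, $W=e^\perp$, $\pi:J\to W$, $\pi(x)=x-\tfrac13\langle x,e\rangle e$, and $x*y:=\pi(x\cdot y)$. In $\mathrm{S}^2W$, $ab$ denotes the symmetric product of $a,b\in W$; $\mathrm{S}^2W$ is identified with the space of operators on $W$ that are symmetric for $\langle\cdot,\cdot\rangle$ via $ab\mapsto\tfrac12(a\langle b,\cdot\rangle+b\langle a,\cdot\rangle)$, so $\mathrm{id}_W\in\mathrm{S}^2W$. The product $*$ on $\mathrm{S}^2W$ is the bilinear product with $ab*cd=(a*c)(b*d)+(a*d)(b*c)$. The algebra $A(\mathfrak g)$ (Chayet–Garibaldi), for $\mathfrak g=\mathfrak f_4$, with Killing form $K$ and dual Coxeter number $h^\vee=9$: write $x\bullet y=\tfrac12(xy+yx)$ for endomorphisms $x,y$. Define the linear map $S:\mathrm{S}^2\mathfrak g\to\operatorname{End}(\mathfrak g)$ by $$S(XY)=h^\vee\,\operatorname{ad}X\bullet\operatorname{ad}Y+\tfrac12\big(X\,K(Y,\cdot)+Y\,K(X,\cdot)\big),$$ and let $A(\mathfrak g)=\operatorname{Im}(S)$,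 with the (well-defined) commutative bilinear product determined by $$\begin{aligned}S(AB)\diamond S(CD)=\;&\tfrac{h^\vee}{2}\Big(S\big(A\cdot(\operatorname{ad}C\bullet\operatorname{ad}D)B\big)+S\big((\operatorname{ad}C\bullet\operatorname{ad}D)A\cdot B\big)+S\big(C\cdot(\operatorname{ad}A\bullet\operatorname{ad}B)D\big)\\&+S\big((\operatorname{ad}A\bullet\operatorname{ad}B)C\cdot D\big)+S([A,C]\cdot[B,D])+S([A,D]\cdot[B,C])\Big)\\&+\tfrac14\big(K(A,C)S(BD)+K(A,D)S(BC)+K(B,C)S(AD)+K(B,D)S(AC)\big)\end{aligned}$$ for $A,B,C,D\in\mathfrak g$, where $X\cdot Y$ inside $S$ denotes the product in $\mathrm{S}^2\mathfrak g$. *)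

(* Defs.v *)
From HB Require Import structures.
From mathcomp Require Import all_boot all_order all_algebra.

Set Implicit Arguments.
Unset Strict Implicit.
Unset Printing Implicit Defensive.

Import GRing.Theory.
Local Open Scope ring_scope.

Section SplitAlbert.
Variable L : fieldType.

(** Cayley-Dickson double of the quaternion algebra 'M_2, with parameter 1:
    (a, b)(c, d) = (ac + d^* b, da + bc^* ) and (a, b)^* = (a^*, -b), where the
    conjugation of 'M_2 is the adjugate. *)
Definition oct := ('M[L]_2 * 'M[L]_2)%type.

Definition oct_mul (x y : oct) : oct :=
  (x.1 *m y.1 + \adj y.2 *m x.2, y.2 *m x.1 + x.2 *m \adj y.1).

Definition oct_conj (x : oct) : oct := (\adj x.1, - x.2).

Definition oct_one : oct := (1%:M, 0).

(** 3 x 3 octonion matrices; the library's matrix product and scaling are not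
    available because the entries do not form a ring. *)
Definition oct_mx3 := {ffun 'I_3 * 'I_3 -> oct}.

Definition mx3_mul (x y : oct_mx3) : oct_mx3 :=
  [ffun p => \sum_l oct_mul (x (p.1, l)) (y (l, p.2))].

Definition mx3_tr (x : oct_mx3) : oct := \sum_i x (i, i).

Definition mx3_herm (x : oct_mx3) : Prop :=
  forall i j, x (i, j) = oct_conj (x (j, i)).

Definition mx3_jordan (x y : oct_mx3) : oct_mx3 :=
  2%:R^-1 *: (mx3_mul x y + mx3_mul y x).

End SplitAlbert.

Section Basis.
Variables (k : fieldType) (V : vectType k).

Definition bvec (i : 'I_(\dim {:V})) : V := tnth (vbasis {:V}) i.
Definition bcoord (i : 'I_(\dim {:V})) (v : V) : k := coord (vbasis {:V}) i v.

Lemma bvec_sum v : v = \sum_i bcoord i v *: bvec i.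
Proof.
rewrite [LHS](coord_vbasis (memvf v)); apply: eq_bigr => i _.
by rewrite /bcoord /bvec (tnth_nth 0).
Qed.

Lemma bcoord_bvec i j : bcoord i (bvec j) = (j == i)%:R.
Proof.
rewrite /bcoord /bvec (tnth_nth 0) coord_free //.
exact: basis_free (vbasisP _).
Qed.

End Basis.

Lemma linfunP (k : fieldType) (U V : vectType k) (f : U -> V) :
  linear f -> linfun f =1 f.
Proof.
move=> fl x; pose fL : {linear U -> V} :=
  HB.pack f (GRing.isLinear.Build k U V _ f fl).
exact: (lfunE fL x).
Qed.

Lemma lfun_linE (k : fieldType) (U V : vectType k) c (f f' : 'Hom(U, V)) x :
  (c *: f + f') x = c *: f x + f' x.
Proof. by rewrite !lfunE /= lfunE. Qed.

Section Albert.
Variables (k : fieldType) (J : vectType k).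
Variables (mul : {bilinear J -> J -> J}) (form : {biscalar J}).

(** J (x)_k L, written in the coordinates given by a basis of J. *)
Definition ext_mul (L : fieldType) (iota : {rmorphism k -> L})
    (u v : 'rV[L]_(\dim {:J})) : 'rV[L]_(\dim {:J}) :=
  \row_l \sum_i \sum_j
    u 0 i * v 0 j * iota (bcoord l (mul (bvec i) (bvec j))).

Definition ext_form (L : fieldType) (iota : {rmorphism k -> L})
    (u v : 'rV[L]_(\dim {:J})) : L :=
  \sum_i \sum_j u 0 i * v 0 j * iota (form (bvec i) (bvec j)).

(** The trace of a hermitian matrix is a scalar multiple of the unit octonion. *)
Definition is_split_albert (L : fieldType) (iota : {rmorphism k -> L}) : Prop :=
  exists f : {linear 'rV[L]_(\dim {:J}) -> oct_mx3 L},
    [/\ injective f,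
        forall x, mx3_herm x <-> exists u, x = f u,
        forall u v, f (ext_mul iota u v) = mx3_jordan (f u) (f v)
      & forall u v, mx3_tr (mx3_jordan (f u) (f v))
                    = ext_form iota u v *: oct_one L].

(** L is an algebraic closure of k. *)
Definition is_albert : Prop :=
  exists (L : closedFieldType) (iota : {rmorphism k -> L}),
    (forall x : L, algebraicOver iota x) /\ is_split_albert iota.

End Albert.

Section LinearCombinators.
Variables (k : fieldType) (U V : lmodType k).

Lemma linear_fun_add (f g : U -> V) :
  linear f -> linear g -> linear (fun x => f x + g x).
Proof. by move=> fl gl a x y; rewrite fl gl scalerDr addrACA. Qed.

Lemma linear_fun_scale c (f : U -> V) : linear f -> linear (fun x => c *: f x).
Proof.
by move=> fl a x y; rewrite fl scalerDr !scalerA [c * a]mulrC.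
Qed.

Lemma linear_fun_opp (f : U -> V) : linear f -> linear (fun x => - f x).
Proof. by move=> fl a x y; rewrite fl opprD scalerN. Qed.

Lemma linear_fun_scaler (f : U -> k) (v : V) :
  scalar f -> linear (fun x => f x *: v).
Proof. by move=> fl a x y; rewrite fl scalerDl scalerA. Qed.

Lemma scalar_fun_mul c (f : U -> k) : scalar f -> scalar (fun x => c * f x).
Proof. by move=> fl a x y; rewrite fl mulrDr mulrCA. Qed.

Lemma scalar_fun_mulr c (f : U -> k) : scalar f -> scalar (fun x => f x * c).
Proof. by move=> fl a x y; rewrite fl mulrDl mulrA. Qed.

Lemma scalar_fun_add (f g : U -> k) :
  scalar f -> scalar g -> scalar (fun x => f x + g x).
Proof. by move=> fl gl a x y; rewrite fl gl mulrDr addrACA. Qed.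

End LinearCombinators.

Section Sym2.
Variables (k : fieldType) (V : vectType k).

Let n : nat := \dim {:V}.

(** Coordinates on the monomials b_i b_j, i <= j, in a basis of V. *)
Definition sym2 : vectType k :=
  {ffun {p : 'I_n * 'I_n | (p.1 <= p.2)%N} -> k^o}.

Definition sprod (a b : V) : sym2 :=
  [ffun p => let: (i, j) := val p in
    if i == j then bcoord i a * bcoord i b
    else bcoord i a * bcoord j b + bcoord j a * bcoord i b].

(** The linear map sending ab to f a b, for a symmetric bilinear f. *)
Definition sym2_lift (U : lmodType k) (f : V -> V -> U) (u : sym2) : U :=
  \sum_p (u p : k) *: f (bvec (val p).1) (bvec (val p).2).

Lemma sym2_lift_is_linear (U : lmodType k) (f : V -> V -> U) :
  linear (sym2_lift f).
Proof.
move=> a u v; rewrite /sym2_lift scaler_sumr -big_split /=.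
by apply: eq_bigr => p _; rewrite !ffunE scalerDl scalerA.
Qed.

HB.instance Definition _ (U : lmodType k) (f : V -> V -> U) :=
  GRing.isLinear.Build k sym2 U _ (sym2_lift f) (sym2_lift_is_linear f).

Lemma eq_sym2_lift (U : lmodType k) (f f' : V -> V -> U) u :
  f =2 f' -> sym2_lift f u = sym2_lift f' u.
Proof. by move=> ff'; apply: eq_bigr => p _; rewrite ff'. Qed.

Lemma sym2_lift_funP (U : lmodType k) (f f' : V -> V -> U) c u :
  sym2_lift (fun a b => c *: f a b + f' a b) u
  = c *: sym2_lift f u + sym2_lift f' u.
Proof.
rewrite /sym2_lift scaler_sumr -big_split; apply: eq_bigr => p _ /=.
by rewrite scalerDr !scalerA mulrC.
Qed.

Lemma sprodC a b : sprod a b = sprod b a.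
Proof.
apply/ffunP=> -[[i j] ij]; rewrite !ffunE /=.
by case: eqP => _; rewrite 1?addrC ![_ * bcoord _ b]mulrC.
Qed.

Lemma sprod_linear b : linear (sprod^~ b).
Proof.
move=> c u v; apply/ffunP=> -[[i j] ij]; rewrite !ffunE /=.
rewrite /bcoord !linearP /=.
case: eqP => _; first by rewrite mulrDl -mulrA.
by rewrite !mulrDl addrACA /GRing.scale /= mulrDr !mulrA.
Qed.

Lemma sym2_lift_sprod (U : lmodType k) (f : V -> V -> U) :
  (forall a b, f a b = f b a) -> (forall b, linear (f^~ b)) ->
  forall a b, sym2_lift f (sprod a b) = f a b.
Proof.
move=> fC fl a b.
pose L b := GRing.isLinear.Build k V U _ (f^~ b) (fl b).
have fs1 (r : 'I_n -> k) (F : 'I_n -> V) c :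
    f (\sum_i r i *: F i) c = \sum_i r i *: f (F i) c.
  pose g : {linear V -> U} := HB.pack (f^~ c) (L c).
  rewrite -[LHS]/(g _) linear_sum; apply: eq_bigr => i _.
  by rewrite linearZ.
have fs2 (r : 'I_n -> k) (F : 'I_n -> V) c :
    f c (\sum_i r i *: F i) = \sum_i r i *: f c (F i).
  by rewrite fC fs1; apply: eq_bigr => i _; rewrite fC.
rewrite [in RHS](bvec_sum a) [in RHS](bvec_sum b) fs1.
under [RHS]eq_bigr => i _ do rewrite fs2 scaler_sumr.
pose T (p : 'I_n * 'I_n) : U :=
  (bcoord p.1 a * bcoord p.2 b) *: f (bvec p.1) (bvec p.2).
have -> : \sum_i \sum_j bcoord i a *: (bcoord j b *: f (bvec i) (bvec j))
        = \sum_p T p.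
  by rewrite pair_bigA; apply: eq_bigr => p _; rewrite scalerA.
pose F (p : 'I_n * 'I_n) : U := T p + (if p.1 == p.2 then 0 else T (p.2, p.1)).
have -> : sym2_lift f (sprod a b) = \sum_(p : 'I_n * 'I_n | (p.1 <= p.2)%N) F p.
  rewrite (big_sub (fun p : 'I_n * 'I_n => (p.1 <= p.2)%N)) /sym2_lift.
  apply: eq_bigr => -[[i j] ij] _; rewrite ffunE /F /T /=.
  case: eqP => [<-|_]; first by rewrite addr0.
  by rewrite scalerDl [f (bvec j) _]fC.
rewrite big_split /= [RHS](bigID (fun p : 'I_n * 'I_n => (p.1 <= p.2)%N)) /=.
congr (_ + _).
rewrite [RHS](reindex_inj (h := fun p : 'I_n * 'I_n => (p.2, p.1))) /=; last first.
  by case=> i j [i' j'] [-> ->].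
rewrite [LHS]big_mkcond [RHS]big_mkcond; apply: eq_bigr => -[i j] _ /=.
by rewrite -ltnNge; case: eqP => [->|/eqP ij]; rewrite ?ltnn ?if_same // ltn_neqAle ij.
Qed.

Lemma sym2_sum (u : sym2) :
  u = \sum_p (u p : k) *: sprod (bvec (val p).1) (bvec (val p).2).
Proof.
apply/ffunP=> q; rewrite sum_ffunE (bigD1 q) //= big1 ?addr0 => [|p pq].
  case: q => -[i j] ij; rewrite !ffunE /= !bcoord_bvec !eqxx.
  rewrite [j == i]eq_sym; case: (i == j).
    by rewrite /GRing.scale /= !mulr1.
  by rewrite /GRing.scale /= mulr0 addr0 !mulr1.
case: p q pq => -[i j] /= ij [[i' j'] ij']; rewrite !ffunE -val_eqE /= => pq.
rewrite !bcoord_bvec xpair_eqE in pq *.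
have [e|ni'j'] := eqVneq i' j'.
  by move: pq; rewrite -{}e -natrM mulnb => /negPf->; rewrite scaler0.
have h : ~~ ((i == j') && (j == i')).
  apply/negP => /andP[/eqP ? /eqP ?]; subst; case/negP: ni'j'.
  by rewrite -val_eqE eqn_leq /= ij ij'.
by rewrite -!natrM !mulnb (negPf pq) (negPf h) addr0 scaler0.
Qed.

Lemma sprod_linearr a : linear (sprod a).
Proof. by move=> c u v; rewrite ![sprod a _]sprodC sprod_linear. Qed.

Lemma sym2_lift2_sprod (U : lmodType k) (F : V -> V -> V -> V -> U) :
  (forall a b c d, F a b c d = F b a c d) ->
  (forall a b c d, F a b c d = F a b d c) ->
  (forall b c d, linear (fun a => F a b c d)) ->
  (forall a b d, linear (fun c => F a b c d)) ->
  forall a b c d,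
  sym2_lift (fun a b => sym2_lift (F a b) (sprod c d)) (sprod a b) = F a b c d.
Proof.
move=> Fab Fcd Fl1 Fl2 a b c d.
have Fi a' b' : sym2_lift (F a' b') (sprod c d) = F a' b' c d.
  by apply: sym2_lift_sprod => [? ?|?]; [apply: Fcd | apply: Fl2].
rewrite -[RHS](@sym2_lift_sprod _ (fun a b => F a b c d)).
- by apply: eq_sym2_lift => ? ?; rewrite Fi.
- by move=> ? ?; apply: Fab.
- by move=> ?; apply: Fl1.
Qed.

End Sym2.

Section TracelessSym2.
Variables (k : fieldType) (J : vectType k).
Variables (mul : {bilinear J -> J -> J}) (form : {biscalar J}) (e : J).

Definition traceless : {vspace J} :=
  lker (linfun (fun x => form x e : k^o)).

Lemma mem_traceless x : (x \in traceless) = (form x e == 0).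
Proof. by rewrite memv_ker linfunP // => a u v; rewrite linearPl. Qed.

Local Notation W := (subvs_of traceless).

Definition wform (a b : W) : k := form (vsval a) (vsval b).

Definition wproj (x : J) : W :=
  vsproj traceless (x - (3%:R^-1 * form x e) *: e).

Definition wmul (a b : W) : W := wproj (mul (vsval a) (vsval b)).

Definition sym2_op : 'Hom(sym2 W, 'End(W)) :=
  linfun (sym2_lift (fun a b : W => linfun (fun x : W =>
    2%:R^-1 *: (wform b x *: a + wform a x *: b)))).

(** The preimage of the identity; [sym2_op] is injective, with image the
    symmetric operators, when [wform] is symmetric and nondegenerate and 2 <> 0. *)
Definition sym2_id : sym2 W := (sym2_op^-1)%VF \1%VF.

Definition sym2_mul (u v : sym2 W) : sym2 W :=
  sym2_lift (fun a b => sym2_lift (fun c d =>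
    sprod (wmul a c) (wmul b d) + sprod (wmul a d) (wmul b c)) v) u.

Definition star_gen (a b c d : W) : sym2 W :=
  24%:R^-1 *:
    (wform a c *: (sym2_mul (sprod b d) sym2_id + sprod b d)
     + wform a d *: (sym2_mul (sprod b c) sym2_id + sprod b c)
     + wform b c *: (sym2_mul (sprod a d) sym2_id + sprod a d)
     + wform b d *: (sym2_mul (sprod a c) sym2_id + sprod a c))
  + 36%:R^-1 *:
    (wform a c *: sprod b d + wform a d *: sprod b c
     + wform b c *: sprod a d + wform b d *: sprod a c
     + wform a b *: sprod c d + wform c d *: sprod a b)
  - 6%:R^-1 *: sym2_mul (sprod a b) (sprod c d)
  - (72%:R^-1 * (wform a c * wform b d + wform a d * wform b c)) *: sym2_id.

(** See [star_sprod], and [sym2_mulE] for [sym2_mul]. *)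
Definition star (u v : sym2 W) : sym2 W :=
  sym2_lift (fun a b => sym2_lift (fun c d => star_gen a b c d) v) u.

(** See [mem_sym2_alg]. *)
Definition sym2_alg : {vspace sym2 W} := lker (linfun (sym2_lift wmul)).

Section Generators.
Hypothesis formC : forall x y, form x y = form y x.
Hypothesis mulC : forall x y, mul x y = mul y x.

Let wformC a b : wform a b = wform b a. Proof. exact: formC. Qed.

Let wmulC a b : wmul a b = wmul b a.
Proof. by rewrite /wmul mulC. Qed.

Let wform_scalar b : scalar (wform^~ b).
Proof. by move=> c u v; rewrite /wform /= linearPl. Qed.

Let wform_scalarr b : scalar (wform b).
Proof. by move=> c u v; rewrite /wform /= linearPr. Qed.

Let wmul_linear b : linear (wmul^~ b).
Proof.
move=> c u v; rewrite /wmul /wproj -linearP /= linearPl linearPl.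
rewrite mulrDr scalerDl opprD addrACA scalerBr scalerA.
by rewrite [c * (_ * _)]mulrCA.
Qed.

Let wmul_linearr b : linear (wmul b).
Proof. by move=> c u v; rewrite ![wmul b _]wmulC wmul_linear. Qed.

Lemma sym2_mulE a b c d :
  sym2_mul (sprod a b) (sprod c d) =
  sprod (wmul a c) (wmul b d) + sprod (wmul a d) (wmul b c).
Proof.
rewrite /sym2_mul (@sym2_lift2_sprod _ _ _ (fun a b c d =>
  sprod (wmul a c) (wmul b d) + sprod (wmul a d) (wmul b c))) //.
- by move=> a1 b1 c1 d1; rewrite addrC ![sprod (wmul a1 _) _]sprodC.
- by move=> a1 b1 c1 d1; rewrite addrC.
- move=> b1 c1 d1; apply: linear_fun_add => t u v.
    by rewrite wmul_linear sprod_linear.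
  by rewrite wmul_linear sprod_linear.
- move=> a1 b1 d1; apply: linear_fun_add => t u v.
    by rewrite wmul_linearr sprod_linear.
  by rewrite wmul_linearr sprod_linearr.
Qed.

Lemma sym2_mul_linear v : linear (sym2_mul^~ v).
Proof. by move=> c x y; rewrite /sym2_mul linearP. Qed.

Lemma sym2_mul_linearr u : linear (sym2_mul u).
Proof.
move=> c x y; rewrite /sym2_mul -sym2_lift_funP; apply: eq_sym2_lift => a b.
by rewrite sym2_lift_is_linear.
Qed.

Lemma star_sprod a b c d : star (sprod a b) (sprod c d) = star_gen a b c d.
Proof.
have swap1 (V : zmodType) (x y z t : V) : x + y + z + t = z + t + x + y.
  by rewrite -[LHS]addrA [LHS]addrC addrA.
have swap2 (V : zmodType) (x y z t : V) : x + y + z + t = y + x + t + z.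
  by rewrite [x + y]addrC -[LHS]addrA [z + t]addrC addrA.
have mul1 y v : linear (fun x => sym2_mul (sprod x y) v).
  by move=> t x x'; rewrite sprod_linear sym2_mul_linear.
have mul2 y v : linear (fun x => sym2_mul (sprod y x) v).
  by move=> t x x'; rewrite sprod_linearr sym2_mul_linear.
have mul3 y u : linear (fun x => sym2_mul u (sprod x y)).
  by move=> t x x'; rewrite sprod_linear sym2_mul_linearr.
apply: sym2_lift2_sprod => {a b c d} [a b c d|a b c d|b c d|a b d].
- rewrite /star_gen (wformC b a) (sprodC b a) (swap1 _ (_ *: _) (_ *: _) (_ *: _)).
  rewrite [in X in _ + 36%:R^-1 *: X](swap1 _ (wform a c *: _)).
  by rewrite [X in _ * X]addrC [wform a d * _]mulrC [wform a c * _]mulrC.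
- rewrite /star_gen (wformC d c) (sprodC d c) (swap2 _ (_ *: _) (_ *: _) (_ *: _)).
  rewrite [in X in _ + 36%:R^-1 *: X](swap2 _ (wform a c *: _)).
  by rewrite [X in _ * X]addrC.
all: rewrite /star_gen; repeat first
  [ exact: wform_scalar | exact: wform_scalarr | exact: sprod_linear
  | exact: sprod_linearr | exact: mul1 | exact: mul2 | exact: mul3
  | apply: linear_fun_scaler | apply: scalar_fun_mul | apply: scalar_fun_add
  | apply: scalar_fun_mulr | apply: linear_fun_add | apply: linear_fun_opp
  | apply: linear_fun_scale ].
Qed.

Lemma sym2_op_sprod a b x :
  sym2_op (sprod a b) x = 2%:R^-1 *: (wform b x *: a + wform a x *: b).
Proof.
have opl a1 b1 : linear (fun x : W =>
    2%:R^-1 *: (wform b1 x *: a1 + wform a1 x *: b1)).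
  by apply/linear_fun_scale/linear_fun_add; apply/linear_fun_scaler/wform_scalarr.
rewrite /sym2_op lfunE /= sym2_lift_sprod; first by rewrite linfunP.
  by move=> a1 b1; apply/lfunP=> z; rewrite !linfunP // addrC.
move=> b1 t u v; apply/lfunP=> z; rewrite !lfunE /= !lfunE /= !linfunP //.
have opr : linear (fun a1 : W =>
    2%:R^-1 *: (wform b1 z *: a1 + wform a1 z *: b1)).
  apply/linear_fun_scale/linear_fun_add; first exact: linear_fun_scale.
  exact/linear_fun_scaler/wform_scalar.
exact: opr.
Qed.

Lemma mem_sym2_alg m (X Y : 'I_m -> W) :
  (\sum_i sprod (X i) (Y i) \in sym2_alg) = (\sum_i wmul (X i) (Y i) == 0).
Proof.
rewrite memv_ker lfunE linear_sum; congr (_ == 0); apply: eq_bigr => i _ /=.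
by rewrite sym2_lift_sprod.
Qed.

End Generators.

End TracelessSym2.

Section ChayetGaribaldi.
Variables (k : fieldType) (g : vectType k) (br : {bilinear g -> g -> g}).
Variable h : k.  (* the dual Coxeter number *)

Definition ad (X : g) : 'End(g) := linfun (br X).

Definition lfun_tr (f : 'End(g)) : k := \sum_i bcoord i (f (bvec i)).

Definition killing (X Y : g) : k := lfun_tr (ad X \o ad Y)%VF.

Definition lfun_bullet (f1 f2 : 'End(g)) : 'End(g) :=
  2%:R^-1 *: ((f1 \o f2) + (f2 \o f1))%VF.

Definition cg_S : 'Hom(sym2 g, 'End(g)) :=
  linfun (sym2_lift (fun X Y : g =>
    h *: lfun_bullet (ad X) (ad Y)
    + 2%:R^-1 *: linfun (fun Z : g => killing Y Z *: X + killing X Z *: Y))).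

Definition cg_alg : {vspace 'End(g)} := limg cg_S.

Definition cg_proj (u : sym2 g) : subvs_of cg_alg := vsproj cg_alg (cg_S u).

(** The formula determines the product; see [is_diamond_uniq]. *)
Definition is_diamond
    (dia : {bilinear subvs_of cg_alg -> subvs_of cg_alg -> subvs_of cg_alg})
    : Prop :=
  forall A B C D : g,
  dia (cg_proj (sprod A B)) (cg_proj (sprod C D)) =
    (h / 2%:R) *:
      (cg_proj (sprod A (lfun_bullet (ad C) (ad D) B))
       + cg_proj (sprod (lfun_bullet (ad C) (ad D) A) B)
       + cg_proj (sprod C (lfun_bullet (ad A) (ad B) D))
       + cg_proj (sprod (lfun_bullet (ad A) (ad B) C) D)
       + cg_proj (sprod (br A C) (br B D))
       + cg_proj (sprod (br A D) (br B C)))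
    + 4%:R^-1 *:
      (killing A C *: cg_proj (sprod B D) + killing A D *: cg_proj (sprod B C)
       + killing B C *: cg_proj (sprod A D)
       + killing B D *: cg_proj (sprod A C)).

Lemma adE X Z : ad X Z = br X Z. Proof. exact: lfunE. Qed.

Lemma ad_linear : linear ad.
Proof.
by move=> c X Y; apply/lfunP=> Z; rewrite !lfunE /= !lfunE /= linearPl !adE.
Qed.

Lemma lfun_bulletC x y : lfun_bullet x y = lfun_bullet y x.
Proof. by rewrite /lfun_bullet addrC. Qed.

Lemma lfun_bulletE x y Z :
  lfun_bullet x y Z = 2%:R^-1 *: (x (y Z) + y (x Z)).
Proof. by rewrite !lfunE /= !lfunE /= !lfunE. Qed.

Lemma lfun_bullet_linear y : linear (lfun_bullet^~ y).
Proof.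
move=> c x x'; apply/lfunP=> Z; rewrite lfun_linE !lfun_bulletE !lfun_linE.
by rewrite linearP addrACA -scalerDr [LHS]scalerDr !scalerA mulrC.
Qed.

Lemma lfun_tr_scalar : scalar lfun_tr.
Proof.
move=> c x y; rewrite /lfun_tr mulr_sumr -big_split; apply: eq_bigr => i _ /=.
by rewrite lfun_linE /bcoord linearP.
Qed.

Lemma killing_scalarl Y : scalar (killing^~ Y).
Proof.
move=> c X X'; rewrite /killing -lfun_tr_scalar ad_linear; congr lfun_tr.
by rewrite comp_lfunDl comp_lfunZl.
Qed.

Lemma killing_scalarr X : scalar (killing X).
Proof.
move=> c Y Y'; rewrite /killing -lfun_tr_scalar ad_linear; congr lfun_tr.
by rewrite comp_lfunDr comp_lfunZr.
Qed.

Lemma cg_S_sprod X Y Z :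
  cg_S (sprod X Y) Z = h *: lfun_bullet (ad X) (ad Y) Z
    + 2%:R^-1 *: (killing Y Z *: X + killing X Z *: Y).
Proof.
have opl X1 Y1 : linear (fun Z => killing Y1 Z *: X1 + killing X1 Z *: Y1).
  by apply/linear_fun_add; apply/linear_fun_scaler/killing_scalarr.
rewrite /cg_S lfunE /= sym2_lift_sprod => [|X1 Y1|Y1].
- by rewrite lfun_linE; congr (_ + _); rewrite lfunE /= linfunP.
- by rewrite lfun_bulletC; congr (_ + _ *: _); apply/lfunP => T;
    rewrite !linfunP // addrC.
apply/linear_fun_add; apply/linear_fun_scale.
  by move=> t u v; rewrite ad_linear lfun_bullet_linear.
move=> t u v; apply/lfunP=> T; rewrite lfun_linE !linfunP //.
have opr : linear (fun X1 => killing Y1 T *: X1 + killing X1 T *: Y1).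
  apply/linear_fun_add; first exact: linear_fun_scale.
  exact/linear_fun_scaler/killing_scalarl.
exact: opr.
Qed.

Lemma cg_alg_span (x : subvs_of cg_alg) : exists u, x = cg_proj u.
Proof.
have /memv_imgP[u _ xE] := subvsP x.
by exists u; rewrite /cg_proj -xE vsvalK.
Qed.

Lemma is_diamond_uniq d1 d2 : is_diamond d1 -> is_diamond d2 -> d1 =2 d2.
Proof.
move=> H1 H2 x y; have [u ->] := cg_alg_span x; have [v ->] := cg_alg_span y.
have P w : cg_proj w = \sum_p (w p : k) *:
    cg_proj (sprod (bvec (val p).1) (bvec (val p).2)).
  rewrite [in LHS](sym2_sum w) /cg_proj !linear_sum.
  by apply: eq_bigr => p _; rewrite !linearZ.
rewrite (P u) (P v) !linear_sumlz; apply: eq_bigr => p _.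
rewrite !linear_sumr; apply: eq_bigr => q _.
by rewrite !linearZl_LR !linearZr_LR H1 H2.
Qed.

End ChayetGaribaldi.

Section Derivations.
Variables (k : fieldType) (J : vectType k) (mul : {bilinear J -> J -> J}).

Definition der_defect (x y : J) (D : 'End(J)) : J :=
  D (mul x y) - (mul (D x) y + mul x (D y)).

Lemma der_defect_is_linear x y : linear (der_defect x y).
Proof.
move=> a D E; rewrite /der_defect !lfunE /= !lfunE /=.
rewrite linearPl linearPr /= addrACA -scalerDr opprD addrACA -scalerN.
by rewrite -scalerDr.
Qed.

HB.instance Definition _ x y :=
  GRing.isLinear.Build k 'End(J) J _ (der_defect x y) (der_defect_is_linear x y).

(** The Leibniz rule is imposed on a basis; see [mem_der]. *)
Definition der : {vspace 'End(J)} :=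
  (\bigcap_i \bigcap_j lker (linfun (der_defect (bvec i) (bvec j))))%VS.

Lemma mem_der (D : 'End(J)) :
  reflect (forall x y, D (mul x y) = mul (D x) y + mul x (D y)) (D \in der).
Proof.
rewrite memvE; apply: (iffP subv_bigcapP) => [H x y | H i _].
  have {}H i j : D (mul (bvec i) (bvec j))
               = mul (D (bvec i)) (bvec j) + mul (bvec i) (D (bvec j)).
    have /subv_bigcapP/(_ j isT) := H i isT.
    by rewrite -memvE memv_ker lfunE /= subr_eq0 => /eqP.
  have {}H i z : D (mul (bvec i) z) = mul (D (bvec i)) z + mul (bvec i) (D z).
    rewrite (bvec_sum z) !linear_sum -big_split /=.
    by apply: eq_bigr => j _; rewrite !linearZ /= H scalerDr.
  rewrite [x]bvec_sum !(linear_sumlz, linear_sum) -big_split /=.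
  apply: eq_bigr => i _.
  by rewrite !linearZl_LR !linearZ /= linearZl_LR H scalerDr.
apply/subv_bigcapP => j _.
by rewrite -memvE memv_ker lfunE /= /der_defect H subrr.
Qed.

Definition der_br (X Y : subvs_of der) : subvs_of der :=
  vsproj der ((vsval X \o vsval Y) - (vsval Y \o vsval X))%VF.

Lemma der_brE X Y :
  vsval (der_br X Y) = ((vsval X \o vsval Y) - (vsval Y \o vsval X))%VF.
Proof.
rewrite vsprojK //; apply/mem_der => x y.
have /mem_der HX := subvsP X; have /mem_der HY := subvsP Y.
have E z : ((vsval X \o vsval Y) - (vsval Y \o vsval X))%VF z
          = vsval X (vsval Y z) - vsval Y (vsval X z).
  by rewrite !lfunE /= !lfunE /= !lfunE.
rewrite !E HY HX !linearD /= !HX !HY linearBl linearNr.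
have H (p q r t w v : J) :
    p + q + (r + t) + (- (w + r) - (q + v)) = p - w + (t - v).
  rewrite [r + t]addrC [p + q + (t + r)]addrACA !opprD [- q - v]addrC.
  rewrite [- w - r + (- v - q)]addrACA [LHS]addrACA -[- r - q]opprD.
  by rewrite [r + q]addrC subrr addr0 addrACA.
exact: H.
Qed.

Lemma der_br_apply X Y z :
  vsval (der_br X Y) z = vsval X (vsval Y z) - vsval Y (vsval X z).
Proof. by rewrite der_brE !lfunE /= !lfunE /= !lfunE. Qed.

Lemma der_br_bilinear : bilinear_for *:%R *:%R der_br.
Proof.
split=> [Y|X] a u v; apply: val_inj; rewrite /=; apply/lfunP => z;
  rewrite lfun_linE !der_br_apply /= !lfun_linE linearP.
  by rewrite scalerBr opprD addrACA.
by rewrite scalerBr opprD addrACA.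
Qed.

HB.instance Definition _ :=
  bilinear_isBilinear.Build k (subvs_of der) (subvs_of der) (subvs_of der)
    *:%R *:%R der_br der_br_bilinear.

End Derivations.

Arguments der_br {k J} mul X Y.

(* Main.v *)
From HB Require Import structures.
From Stdlib Require Import ZArith.
Require Import Defs.
From mathcomp Require Import all_boot all_order all_algebra.
From mathcomp Require Import ssrZ ring.

Set Implicit Arguments.
Unset Strict Implicit.
Unset Printing Implicit Defensive.

Import GRing.Theory.
Local Open Scope ring_scope.
Delimit Scope Z_scope with bZ.

(** On the traceless space W, with product * and form f, the Cayley-Hamilton identity of the Albert
    algebra becomes x*(x*x) = f(x,x)x/6, linearised in [cubic]. Write L_a for multiplication by a.
    Traces of this identity control all derivations. The restrictions of the commutators of
    multiplications of J, [dop a b], are derivations ([dfun_deriv]), derivations are skew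
    ([deriv_skew]), and a contraction over dual bases shows that all are inner ([deriv_dop_sum]).
    The same contractions give the Killing form as K(X,Y) = 3 tr_W(XY) ([killing_trf]).

    Regard S^2 W as the symmetric operators on W. By [f_mu], A consists of the operators u with tr(u
    L_z) = 0 for all z, and by [star_form] the product star is a combination of compositions and
    traces of operators. Let [phi0] map S^2 g to S^2 W by XY |-> 27 T - (3/4) tr(T) id, where T = XY
    + YX on W. Three facts about [phi0] prove the theorem. (1) Its image is A. It lies in A because
    tr(X Y L_z) = 0 for derivations X, Y. It is all of A because contracting products of inner
    derivations gives a preimage of each element, up to invertible scalars and the identity
    ([phi0_onto]). (2) Its kernel is that of S ([ker_phi0]): K(S(u)Z,Z') is a trace pairing of
    [phi0 u] with [phi0] of ZZ' ([killing_S]), by the quartic identity tr X^4 = (tr X^2)^2/12, and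
    both K and the trace form on A are nondegenerate. (3) Star of two images obeys the very formula
    that defines diamond ([star_phi0]). Hence A is closed under star, [phi0] induces a linear
    bijection [psi] from A(g) = Im S onto A, and diamond is star transported through [psi].

    What remains are three multilinear identities for derivations: [derZ], [derQ] and [derP]. They
    may be checked over the algebraic closure, where J is split and W is given by explicit 26 x 26
    integer matrices ([jordan_herm_fun], [albert_split]). Since they are multilinear and invariant
    under automorphisms, the first two arguments may be taken to be two opposite root vectors [sE],
    [sF], whose tensor generates the tensor square of the Lie algebra ([reduce2]). Automorphisms
    fixing both then cut the third argument down to six vectors ([reduce_levi]), and the fourth runs
    over a basis of 52 elements. These finitely many integer identities are evaluated by the virtual
    machine. The results return to k through the injection of k into its closure (section
    [Transfer]), and Der(J) is identified with the derivations of W in section [Restriction]. *)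

Section Smooth.
Variable k : fieldType.
Hypothesis hk : [pchar k] =i pred0 \/
  exists2 p : nat, p \in [pchar k] & (13 < p)%N.

(** Every constant inverted below, such as 7, 26, 189 or 270, has only prime factors at most 13.
    This is where the characteristic assumption enters. *)
Lemma smooth_neq0 n : (0 < n)%N -> all (fun p => p <= 13)%N (primes n) ->
  n%:R != 0 :> k.
Proof.
move=> n0 /allP sm; case: hk => [h0|[p hp p13]].
  by have /pcharf0P -> := h0; rewrite -lt0n.
rewrite -(dvdn_pcharf hp); apply/negP => pn.
have := sm p; rewrite mem_primes (pcharf_prime hp) n0 pn => /(_ isT).
by rewrite leqNgt p13.
Qed.
End Smooth.

Ltac nzs := repeat (apply/andP; split);
  first [by rewrite -?natrM; auto | by rewrite -?(natrM, natrD, natrX)].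
Ltac fieldnz := field; nzs.

Lemma eq_sym2_linear (k : fieldType) (V : vectType k) (U : lmodType k)
    (F G : sym2 V -> U) : linear F -> linear G ->
  (forall a b, F (sprod a b) = G (sprod a b)) -> F =1 G.
Proof.
move=> lF lG h u.
pose FL := GRing.isLinear.Build k _ _ _ F lF.
pose GL := GRing.isLinear.Build k _ _ _ G lG.
pose F' : {linear sym2 V -> U} := HB.pack F FL.
pose G' : {linear sym2 V -> U} := HB.pack G GL.
rewrite -[LHS]/(F' u) -[RHS]/(G' u) (sym2_sum u) !linear_sum.
by apply: eq_bigr => p _; rewrite !linearZ /= h.
Qed.

(** * Traces and derivations of an algebra W satisfying the cubic identity *)

Section Springer.
Variables (k : fieldType) (W : vectType k).
Variables (m : W -> W -> W) (f : W -> W -> k).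
Hypothesis nz : forall n, (0 < n)%N -> all (fun p => p <= 13)%N (primes n) ->
  n%:R != 0 :> k.
Hypothesis mC : forall a b, m a b = m b a.
Hypothesis m_lin : forall b, linear (m b).
Hypothesis fC : forall a b, f a b = f b a.
Hypothesis f_lin : forall b, scalar (f b).
Hypothesis f_nondeg : forall x, (forall y, f x y = 0) -> x = 0.
Hypothesis fA : forall a b c, f (m a b) c = f a (m b c).
(** Linearisation of x*(x*x) = f(x,x)x/6, which is the Cayley-Hamilton identity of J on traceless x
    after projection to W. *)
Hypothesis cubic : forall a b c, m a (m b c) + m b (m c a) + m c (m a b) =
  6%:R^-1 *: (f a b *: c + f b c *: a + f c a *: b).

Lemma mDr a b c : m a (b + c) = m a b + m a c.
Proof. by have := m_lin a 1 b c; rewrite !scale1r. Qed.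
Lemma m0r a : m a 0 = 0.
Proof. by apply: (addIr (m a 0)); rewrite -mDr !add0r. Qed.
Lemma mZr c a b : m a (c *: b) = c *: m a b.
Proof. by have := m_lin a c b 0; rewrite !addr0 m0r addr0. Qed.
Lemma mNr a b : m a (- b) = - m a b.
Proof. by rewrite -scaleN1r mZr scaleN1r. Qed.
Lemma mDl a b c : m (a + b) c = m a c + m b c.
Proof. by rewrite ![m _ c]mC mDr. Qed.
Lemma mZl c a b : m (c *: a) b = c *: m a b.
Proof. by rewrite ![m _ b]mC mZr. Qed.
Lemma mNl a b : m (- a) b = - m a b.
Proof. by rewrite ![m _ b]mC mNr. Qed.
Lemma m_sumr (I : finType) a (F : I -> W) :
  m a (\sum_i F i) = \sum_i m a (F i).
Proof. exact: (big_morph (m a) (mDr a) (m0r a)). Qed.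

Lemma fDr a b c : f a (b + c) = f a b + f a c.
Proof. by have := f_lin a 1 b c; rewrite scale1r mul1r. Qed.
Lemma f0r a : f a 0 = 0.
Proof. by apply: (addIr (f a 0)); rewrite -fDr !add0r. Qed.
Lemma fZr c a b : f a (c *: b) = c * f a b.
Proof. by have := f_lin a c b 0; rewrite !addr0 f0r addr0. Qed.
Lemma fNr a b : f a (- b) = - f a b.
Proof. by rewrite -scaleN1r fZr mulN1r. Qed.
Lemma fDl a b c : f (a + b) c = f a c + f b c.
Proof. by rewrite ![f _ c]fC fDr. Qed.
Lemma f0l a : f 0 a = 0.
Proof. by rewrite fC f0r. Qed.
Lemma fZl c a b : f (c *: a) b = c * f a b.
Proof. by rewrite ![f _ b]fC fZr. Qed.
Lemma fNl a b : f (- a) b = - f a b.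
Proof. by rewrite ![f _ b]fC fNr. Qed.
Lemma f_sumr (I : finType) a (F : I -> W) :
  f a (\sum_i F i) = \sum_i f a (F i).
Proof. exact: (big_morph (f a) (fDr a) (f0r a)). Qed.
Lemma f_suml (I : finType) a (F : I -> W) :
  f (\sum_i F i) a = \sum_i f (F i) a.
Proof. by rewrite fC f_sumr; apply: eq_bigr => i _; rewrite fC. Qed.

Definition fE := (fDl, fDr, fZl, fZr, fNl, fNr, f0l, f0r).
Definition mE := (mDl, mDr, mZl, mZr, mNl, mNr).

Lemma f_inj x y : (forall z, f x z = f y z) -> x = y.
Proof.
move=> h; apply/eqP; rewrite -subr_eq0; apply/eqP/f_nondeg => z.
by rewrite fDl fNl h subrr.
Qed.

Definition gram : 'M[k]_(\dim {:W}) := \matrix_(i, j) f (bvec i) (bvec j).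

Lemma gram_unit : gram \in unitmx.
Proof.
rewrite -row_free_unit; apply/row_freeP; apply/row_freeP.
rewrite -kermx_eq0; apply/rowV0P => v /sub_kermxP vG.
have h0 : \sum_i v 0 i *: bvec i = 0 :> W.
  apply: f_nondeg => y; rewrite (bvec_sum y) f_sumr big1 // => j _.
  rewrite fZr f_suml; have /matrixP/(_ 0 j) := vG; rewrite !mxE => E.
  rewrite (_ : \sum_i _ = 0) ?mulr0 // -[RHS]E.
  by apply: eq_bigr => i _; rewrite fZl mxE.
apply/rowP => j; rewrite mxE.
have := congr1 (bcoord j) h0; rewrite /bcoord !linear_sum linear0 => <-.
rewrite (bigD1 j) //= big1 ?addr0 => [|i ij].
  by rewrite linearZ /= -/(bcoord j _) bcoord_bvec eqxx mulr1.
by rewrite linearZ /= -/(bcoord j _) bcoord_bvec (negPf ij) mulr0.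
Qed.

Definition dvec i : W := \sum_j invmx gram i j *: bvec j.

Lemma f_dvec i x : f (dvec i) x = bcoord i x.
Proof.
rewrite [in LHS](bvec_sum x) f_sumr.
have E j : f (dvec i) (bvec j) = (i == j)%:R.
  rewrite /dvec f_suml -[RHS]/((i == j)%:R).
  have /matrixP/(_ i j) := mulVmx gram_unit; rewrite !mxE => <-.
  by apply: eq_bigr => l _; rewrite fZl mxE.
rewrite (bigD1 i) //= big1 ?addr0 => [|j ji]; first by rewrite fZr E eqxx mulr1.
by rewrite fZr E eq_sym (negPf ji) mulr0.
Qed.

Lemma dvec_sum x : x = \sum_i f x (dvec i) *: bvec i.
Proof. by rewrite [LHS]bvec_sum; apply: eq_bigr => i _; rewrite fC f_dvec. Qed.

(** The Casimir tensor of a symmetric form is symmetric: expand [dvec] in the basis and use that its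
    Gram matrix is symmetric. *)
Lemma dual_swap (U : lmodType k) (H : W -> W -> U) :
  (forall x, linear (H x)) -> (forall x, linear (H^~ x)) ->
  \sum_i H (bvec i) (dvec i) = \sum_i H (dvec i) (bvec i).
Proof.
move=> Hr Hl.
pose fr x := GRing.isLinear.Build k W U _ (H x) (Hr x).
pose fl x := GRing.isLinear.Build k W U _ (H^~ x) (Hl x).
have hr (r : 'I_(\dim {:W}) -> k) (F : 'I_(\dim {:W}) -> W) c :
    H c (\sum_i r i *: F i) = \sum_i r i *: H c (F i).
  pose g : {linear W -> U} := HB.pack (H c) (fr c).
  rewrite -[LHS]/(g _) linear_sum; apply: eq_bigr => i _.
  by rewrite linearZ.
have hl (r : 'I_(\dim {:W}) -> k) (F : 'I_(\dim {:W}) -> W) c :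
    H (\sum_i r i *: F i) c = \sum_i r i *: H (F i) c.
  pose g : {linear W -> U} := HB.pack (H^~ c) (fl c).
  rewrite -[LHS]/(g _) linear_sum; apply: eq_bigr => i _.
  by rewrite linearZ.
transitivity (\sum_i \sum_j f (dvec i) (dvec j) *: H (bvec i) (bvec j)).
  by apply: eq_bigr => i _; rewrite [in LHS](dvec_sum (dvec i)) hr.
rewrite exchange_big /=; apply: eq_bigr => i _.
rewrite [in RHS](dvec_sum (dvec i)) hl.
by apply: eq_bigr => j _; rewrite fC.
Qed.

Lemma dvec_sumr x : x = \sum_i f x (bvec i) *: dvec i.
Proof.
rewrite [LHS]dvec_sum (@dual_swap _ (fun u v => f x v *: u)) //.
  by move=> u c v w; rewrite fDr fZr scalerDl scalerA.
by move=> u c v w; rewrite scalerDr !scalerA mulrC.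
Qed.

Lemma dual_contract x y : \sum_i f x (bvec i) * f y (dvec i) = f x y.
Proof.
rewrite [in RHS](dvec_sum y) f_sumr; apply: eq_bigr => i _.
by rewrite fZr mulrC.
Qed.

Definition trf (F : W -> W) : k := \sum_i f (F (bvec i)) (dvec i).

Lemma lfun_trE (T : 'End(W)) : lfun_tr T = trf T.
Proof. by apply: eq_bigr => i _; rewrite fC f_dvec. Qed.

Lemma eq_trf F G : F =1 G -> trf F = trf G.
Proof. by move=> FG; apply: eq_bigr => i _; rewrite FG. Qed.
Lemma trfD F G : trf (fun w => F w + G w) = trf F + trf G.
Proof. by rewrite -big_split; apply: eq_bigr => i _; rewrite fDl. Qed.
Lemma trfZ c F : trf (fun w => c *: F w) = c * trf F.
Proof. by rewrite mulr_sumr; apply: eq_bigr => i _; rewrite fZl. Qed.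
Lemma trfN F : trf (fun w => - F w) = - trf F.
Proof. by rewrite -mulN1r -trfZ; apply: eq_trf => w; rewrite scaleN1r. Qed.
Lemma trf_rk u v : trf (fun w => f u w *: v) = f u v.
Proof.
rewrite -[RHS]dual_contract; apply: eq_bigr => i _; by rewrite fZl.
Qed.
Lemma trf_rkr u v : trf (fun w => f w u *: v) = f u v.
Proof. by rewrite -[RHS]trf_rk; apply: eq_trf => w; rewrite fC. Qed.
Lemma trfC F G : linear F -> linear G ->
  trf (fun w => F (G w)) = trf (fun w => G (F w)).
Proof.
move=> lF lG.
pose FL := linfun F; pose GL := linfun G.
have FE := linfunP lF; have GE := linfunP lG.
have h (A B : 'End(W)) : trf (fun w => A (B w)) =
    \sum_i \sum_j f (B (bvec i)) (dvec j) * f (A (bvec j)) (dvec i).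
  apply: eq_bigr => i _.
  rewrite [in LHS](dvec_sum (B (bvec i))) linear_sum f_suml.
  by apply: eq_bigr => j _; rewrite linearZ /= fZl.
transitivity (trf (fun w => FL (GL w))).
  by apply: eq_trf => w; rewrite FE GE.
rewrite h exchange_big /=.
transitivity (trf (fun w => GL (FL w))); last first.
  by apply: eq_trf => w; rewrite FE GE.
by rewrite h; apply: eq_bigr => i _; apply: eq_bigr => j _; rewrite mulrC.
Qed.
Lemma trf_adj F G : linear G -> (forall x y, f (F x) y = f x (G y)) ->
  trf F = trf G.
Proof.
move=> lG h; rewrite /trf.
rewrite [RHS](@dual_swap k^o (fun u v => f (G u) v)).
- by apply: eq_bigr => i _; rewrite h fC.
- by move=> x; apply: f_lin.
by move=> x c u v; rewrite lG fDl fZl.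
Qed.

Hypothesis trL : forall a, trf (m a) = 0.
Hypothesis tr1 : trf id = 26%:R.

(** Trace of [cubic] as an operator in its third argument: 2 tr(L_a L_c) = (26 + 1 + 1)/6 f(a,c), as
    tr L_(a*c) = 0. *)
Lemma trLL a c : trf (fun w => m a (m c w)) = 7%:R / 3%:R * f a c.
Proof.
have E : trf (fun w => m a (m c w) + m c (m a w)) =
         trf (fun w => - m (m a c) w + 6%:R^-1 *: (f a c *: w + f c w *: a + f a w *: c)).
  apply: eq_trf => w; have := cubic a c w.
  rewrite [m w a]mC [m w (m a c)]mC [f w a]fC => <-.
  by rewrite [RHS]addrC addrK.
move: E; rewrite !trfD trfN trL trfZ !trfD trfZ !trf_rk.
rewrite -[trf (fun w => w)]/(trf id) tr1.
rewrite [X in _ + X](@trfC (m c) (m a)) // [f c a]fC => E.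
have n2 : 2%:R != 0 :> k by exact: nz.
have n3 : 3%:R != 0 :> k by exact: nz.
have n6 : 6%:R != 0 :> k by exact: nz.
apply: (mulfI n2).
transitivity (trf (fun w => m a (m c w)) + trf (fun w => m a (m c w))).
  by ring.
rewrite E; fieldnz.
Qed.


Lemma fM x u v : f (m x u) v = f u (m x v).
Proof. by rewrite mC fA. Qed.

Lemma cubic2 a b c : m a (m b c) + m b (m a c) =
  - m (m a b) c + 6%:R^-1 *: (f a b *: c + f b c *: a + f a c *: b).
Proof.
have := cubic a b c; rewrite [m c a]mC [m c (m a b)]mC [f c a]fC => <-.
by rewrite [RHS]addrC addrK.
Qed.

(** The trace is symmetric in its arguments, so it is half the trace of L_a(L_b L_c + L_c L_b),
    which [cubic] reduces to [trLL] and rank-one terms: -7/3 + 1/3 = -2. *)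
Lemma trLLL a b c : trf (fun w => m a (m b (m c w))) = - f (m a b) c.
Proof.
(* Each L is self-adjoint, so transposition reverses the product; cyclicity restores the first
   factor. *)
have sym x y z : trf (fun w => m x (m y (m z w))) =
                 trf (fun w => m x (m z (m y w))).
  rewrite [RHS](@trfC (m x) (fun w => m z (m y w))) //; last first.
    by move=> t u v; rewrite !mE.
  apply: trf_adj => [|u v]; first by move=> t u v; rewrite !mE.
  by rewrite !fM.
have E : trf (fun w => m a (m b (m c w))) + trf (fun w => m a (m c (m b w))) =
   trf (fun w => - m a (m (m b c) w) +
     6%:R^-1 *: (f b c *: m a w + f c w *: m a b + f b w *: m a c)).
  by rewrite -trfD; apply: eq_trf => w; rewrite -mDr cubic2 !mE.
rewrite -(sym a b c) in E; move: E; rewrite !trfD trfN trLL trfZ !trfD !trfZ !trf_rk trL.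
rewrite [f c (m a b)]fC !fA => E.
apply: (mulfI (nz (n := 2) isT isT)).
transitivity (trf (fun w => m a (m b (m c w))) + trf (fun w => m a (m b (m c w)))).
  by ring.
by rewrite E -[f b (m a c)]fM fA; fieldnz.
Qed.

(** * Inner derivations *)

(** The commutator [L_a, L_b] taken in J, restricted to W. The terms with 1/3 come from the
    e-components of the inner products b.c and a.c. *)
Definition dfun a b c :=
  m a (m b c) - m b (m a c) + 3%:R^-1 *: (f b c *: a - f a c *: b).

Lemma dfun_linear a b : linear (dfun a b).
Proof.
move=> t u v; apply: f_inj => z.
by rewrite /dfun !mE !fE; ring.
Qed.

Definition dop a b : 'End(W) := linfun (dfun a b).
Lemma dopE a b c : dop a b c = dfun a b c.
Proof. exact/linfunP/dfun_linear. Qed.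

Lemma dfunDl a a' b c : dfun (a + a') b c = dfun a b c + dfun a' b c.
Proof. by apply: f_inj => z; rewrite /dfun !mE !fE; ring. Qed.
Lemma dfunDr a b b' c : dfun a (b + b') c = dfun a b c + dfun a b' c.
Proof. by apply: f_inj => z; rewrite /dfun !mE !fE; ring. Qed.
Lemma dfunZl t a b c : dfun (t *: a) b c = t *: dfun a b c.
Proof. by apply: f_inj => z; rewrite /dfun !mE !fE; ring. Qed.
Lemma dfunZr t a b c : dfun a (t *: b) c = t *: dfun a b c.
Proof. by apply: f_inj => z; rewrite /dfun !mE !fE; ring. Qed.
Lemma dfunC a b c : dfun b a c = - dfun a b c.
Proof. by apply: f_inj => z; rewrite /dfun !fE; ring. Qed.

Lemma fdfun a b c d : f (dfun a b c) d =
  f (m b c) (m a d) - f (m a c) (m b d)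
  + 3%:R^-1 * (f b c * f a d - f a c * f b d).
Proof. by rewrite /dfun !fE !fM; ring. Qed.

Lemma dfun_skew a b c d : f (dfun a b c) d = - f c (dfun a b d).
Proof.
rewrite [f c _]fC !fdfun [f (m b d) _]fC [f (m a d) _]fC; ring.
Qed.

Definition deriv (X : 'End(W)) := forall a b, X (m a b) = m (X a) b + m a (X b).

(** The trace of [X, L_a L_b] = L_(Xa) L_b + L_a L_(Xb) vanishes, and [trLL] evaluates it as 7/3
    (f(Xa,b) + f(a,Xb)). *)
Lemma deriv_skew X : deriv X -> forall a b, f (X a) b = - f a (X b).
Proof.
move=> dX a b; apply/eqP; rewrite -subr_eq0 opprK; apply/eqP.
have lX : linear X by move=> t u v; rewrite linearP.
have E : trf (fun w => X (m a (m b w))) - trf (fun w => m a (m b (X w))) = 0.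
  rewrite (@trfC X (fun w => m a (m b w))) ?subrr // => t u v.
  by rewrite !mE.
move: E; rewrite -trfN -trfD.
rewrite (@eq_trf _ (fun w => m (X a) (m b w) + m a (m (X b) w))); last first.
  by move=> w; rewrite !dX !mE -!addrA addrN addr0.
rewrite trfD !trLL -mulrDr => /eqP; rewrite mulf_eq0 => /orP[|/eqP//].
by rewrite mulf_eq0 invr_eq0 !(negPf (nz _ _)).
Qed.

(* The linearization of D_{x,x*x} = 0. *)
Lemma dfun_jordan a b c d :
  dfun (m a b) c d + dfun (m b c) a d + dfun (m c a) b d = 0.
Proof.
pose q x y z := m x (m y z) + m y (m x z) + m (m x y) z -
  6%:R^-1 *: (f x y *: z + f y z *: x + f x z *: y).
have q0 x y z : q x y z = 0 by rewrite /q cubic2 [- _ + _]addrC subrK subrr.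
apply: f_inj => z; rewrite f0l.
(* Three instances of the cubic identity with a product in the last slot, minus L_c, L_a, L_b
   applied to three further instances: the terms that are not in the claim cancel. *)
have <- : f (q a b (m c d) + q b c (m a d) + q c a (m b d)
    - m c (q a b d) - m a (q b c d) - m b (q c a d)) z = 0.
  by rewrite !q0 !m0r !subr0 !addr0 f0l.
rewrite /dfun /q !mE -!fA [m b a]mC [m c b]mC [m a c]mC !fE.
rewrite [f c a]fC.
by fieldnz.
Qed.

Lemma eq_of_sub (P Q L R : k) : P = 0 -> Q = 0 -> L - R = P - Q -> L = R.
Proof. by move=> -> -> /eqP; rewrite subr0 subr_eq0 => /eqP. Qed.

(** Paired with z, the Leibniz defect is the difference of the two instances of [dfun_jordan] at x,
    y followed by a, b in either order. *)
Lemma dfun_deriv a b : deriv (dop a b).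
Proof.
move=> x y; rewrite !dopE; apply: f_inj => z.
have := congr1 (f^~ z) (dfun_jordan x y a b).
have := congr1 (f^~ z) (dfun_jordan x y b a).
rewrite /dfun /= [m (_ - _ + _) y]mC !mE !f0l.
rewrite [m (m x y) b]mC [m (m y a) b]mC [m (m a x) b]mC.
rewrite [m (m x y) a]mC [m (m y b) a]mC [m (m b x) a]mC.
rewrite [m b a]mC [m y a]mC [m y b]mC [m x a]mC [m x b]mC.
rewrite [m (m b y) _]mC [m (m a y) (m b x)]mC.
rewrite [f b a]fC !fE ![f (m _ _) a]fC ![f (m _ _) b]fC -!fA [m b a]mC.
rewrite [f b x]fC [f b y]fC [f a x]fC [f a y]fC.
by move=> E1 E2; apply: (eq_of_sub E1 E2); ring.
Qed.

Lemma trDX a b X : linear X -> (forall u v, f (X u) v = - f u (X v)) ->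
  trf (fun w => m a (m b (X w))) - trf (fun w => m b (m a (X w)))
  = trf (fun w => dfun a b (X w)) - 2%:R / 3%:R * f (X a) b.
Proof.
move=> lX sX; rewrite /dfun !trfD trfZ trfD !trfN.
rewrite (@eq_trf (fun w => f b (X w) *: a) (fun w => f (- X b) w *: a)); last first.
  by move=> w; rewrite fNl sX opprK.
rewrite (@eq_trf (fun w => f a (X w) *: b) (fun w => f (- X a) w *: b)); last first.
  by move=> w; rewrite fNl sX opprK.
by rewrite !trf_rk !fE [f (X b) a]sX [f b _]fC; fieldnz.
Qed.

(** By cyclicity tr([L_a, L_b]X) = tr(L_a [L_b, X]) = -tr(L_a L_(Xb)), which gives 7/3, and the
    rank-one terms of [dfun] add 2/3. *)
Lemma tr_dfun a b X : deriv X ->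
  trf (fun w => dfun a b (X w)) = 3%:R * f (X a) b.
Proof.
move=> dX; have sX := deriv_skew dX.
have lX : linear X by move=> t u v; rewrite linearP.
have := trDX a b lX sX.
rewrite (@trfC (m b) (fun w => m a (X w))) //; last first.
  by move=> t u v; rewrite lX !mE.
rewrite -trfN -trfD.
rewrite (@eq_trf _ (fun w => - m a (m (X b) w))); last first.
  by move=> w; rewrite dX mDr opprD addrA addrC addrA addNr add0r.
rewrite trfN trLL => /esym/eqP; rewrite subr_eq => /eqP ->.
by rewrite [f a _]fC [f (X b) a]sX [f b _]fC; fieldnz.
Qed.

Lemma deriv_eq0 Z : deriv Z ->
  (forall a b, trf (fun w => dfun a b (Z w)) = 0) -> Z = 0.
Proof.
move=> dZ h; apply/lfunP => a; rewrite lfunE; apply: f_inj => b.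
have := h a b; rewrite tr_dfun // f0l => /eqP.
by rewrite mulf_eq0 (negPf (nz _ _)) // => /eqP.
Qed.

Lemma deriv_sub X Y : deriv X -> deriv Y -> deriv (X - Y).
Proof.
move=> dX dY a b; rewrite !lfunE /= !lfunE /= dX dY.
by rewrite !mE opprD addrACA.
Qed.

Lemma deriv_scale c X : deriv X -> deriv (c *: X).
Proof. by move=> dX a b; rewrite !lfunE /= dX !mE scalerDr. Qed.

Lemma deriv_sum (I : finType) (F : I -> 'End(W)) :
  (forall i, deriv (F i)) -> deriv (\sum_i F i).
Proof.
move=> dF a b; rewrite !sum_lfunE [m (\sum_i _) b]mC !m_sumr -big_split.
by apply: eq_bigr => i _ /=; rewrite dF [m b _]mC.
Qed.

(** Every derivation is inner. By [deriv_eq0] it suffices to compare traces against each [dop a b],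
    and [tr_dfun] evaluates both sides. *)
Lemma deriv_dop_sum X : deriv X ->
  \sum_i dop (X (bvec i)) (dvec i) = 3%:R *: X.
Proof.
move=> dX; apply/eqP; rewrite -subr_eq0; apply/eqP/deriv_eq0.
  apply: deriv_sub; last exact: deriv_scale.
  by apply: deriv_sum => i; apply: dfun_deriv.
move=> a b; set D := \sum_i _.
have dD : deriv D by apply: deriv_sum => i; apply: dfun_deriv.
rewrite tr_dfun; last exact: deriv_sub (deriv_scale _ dX).
rewrite add_lfunE opp_lfunE scale_lfunE fDl fNl fZl mulrDr -(tr_dfun _ _ dD).
(* The trace form is symmetric, so [tr_dfun] can be applied to each summand of D, with [dop a b] as
   the other derivation. *)
have -> : trf (fun w => dfun a b (D w)) =
    \sum_i trf (fun w => dop (X (bvec i)) (dvec i) (dfun a b w)).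
  rewrite (@trfC (dfun a b) D); first last.
  - by move=> t u v; rewrite linearP.
  - exact: dfun_linear.
  rewrite exchange_big /=; apply: eq_bigr => i _.
  by rewrite /D sum_lfunE f_suml.
under eq_bigr => i _.
  rewrite (@eq_trf _ (fun w => dfun (X (bvec i)) (dvec i) (dop a b w))); last first.
    by move=> w; rewrite !dopE.
  rewrite tr_dfun; last exact: dfun_deriv.
  over.
rewrite -mulr_sumr -mulrDr (_ : \sum_i _ = trf (fun w => dfun a b (X w))); last first.
  by apply: eq_bigr => i _; rewrite dopE.
by rewrite tr_dfun // subrr mulr0.
Qed.

Lemma dual_swapk (H : W -> W -> k) :
  (forall x, scalar (H x)) -> (forall x, scalar (H^~ x)) ->
  \sum_i H (bvec i) (dvec i) = \sum_i H (dvec i) (bvec i).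
Proof. exact: (@dual_swap k^o). Qed.

Lemma m_dual : \sum_i m (dvec i) (bvec i) = 0.
Proof.
apply: f_inj => z; rewrite f0l -[RHS](trL z) f_suml; apply: eq_bigr => i _.
by rewrite !fM [m z _]mC.
Qed.

Lemma dfun_linl b c : linear (fun a => dfun a b c).
Proof. by move=> t u v; rewrite dfunDl dfunZl. Qed.

Lemma dfun_linm a c : linear (fun b => dfun a b c).
Proof. by move=> t u v; rewrite dfunDr dfunZr. Qed.

(** The constant is 6 = (26 - 1)/3 - 7/3: rank-one terms, then [trLL]. The remaining term vanishes
    by [m_dual]. *)
Lemma dfun_contract a : \sum_i dfun a (dvec i) (bvec i) = 6%:R *: a.
Proof.
apply: f_inj => z; rewrite f_suml.
under eq_bigr => i _ do rewrite fdfun.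
rewrite big_split sumrB -mulr_sumr sumrB -mulr_suml -f_suml m_dual f0l /=.
rewrite (_ : \sum_i f (dvec i) (bvec i) = 26%:R); last first.
  by rewrite -tr1; apply: eq_bigr => i _; rewrite fC.
rewrite (_ : \sum_i f (m a (bvec i)) (m (dvec i) z) = 7%:R / 3%:R * f a z).
  rewrite (_ : \sum_i _ = f a z) ?fE; first by fieldnz.
  by rewrite -dual_contract; apply: eq_bigr => i _; rewrite [f z _]fC.
rewrite [f a z]fC -trLL; apply: eq_bigr => i _.
by rewrite [RHS]fM [m z _]mC.
Qed.

Lemma deriv_tr0 Y : deriv Y -> trf Y = 0.
Proof.
move=> dY; have sY := deriv_skew dY.
have E : trf Y = - trf Y.
  rewrite -trfN; apply: trf_adj => [t u v|x y]; last by rewrite sY fNr.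
  by rewrite linearP opprD scalerN.
apply: (mulfI (nz (n := 2) isT isT)).
by rewrite mulr0 mulr_natl mulr2n {1}E addNr.
Qed.

(** Transposition makes the trace antisymmetric in a and d, so it is half of tr(L_d [L_a, Y]) =
    -tr(L_d L_(Ya)), known from [trLL]. *)
Lemma trDLL Y a d : deriv Y ->
  trf (fun w => m d (m a (Y w))) = 7%:R / 6%:R * f (Y d) a.
Proof.
move=> dY; have sY := deriv_skew dY.
have lY : linear Y by move=> t u v; rewrite linearP.
have E : trf (fun w => m d (m a (Y w))) = - trf (fun w => m a (m d (Y w))).
  rewrite -trfN (@trfC (fun w => m d (m a w)) Y) //; last first.
    by move=> t u v; rewrite !mE.
  apply: trf_adj => [t u v|x y].
    by rewrite lY !mE opprD scalerN.
  by rewrite sY !fM !fE.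
have E2 : trf (fun w => m d (m a (Y w))) - trf (fun w => m a (m d (Y w))) =
    7%:R / 3%:R * f (Y d) a.
  rewrite (@trfC (m a) (fun w => m d (Y w))) //; last first.
    by move=> t u v; rewrite lY !mE.
  rewrite -trfN -trfD.
  rewrite (@eq_trf _ (fun w => - m d (m (Y a) w))); last first.
    by move=> w; rewrite dY mDr opprD addrA addrAC addrN add0r.
  by rewrite trfN trLL sY; ring.
apply: (mulfI (nz (n := 2) isT isT)).
by rewrite [LHS]mulr_natl mulr2n {2}E E2; fieldnz.
Qed.

Lemma m_deriv_dual Y : deriv Y -> \sum_i m (Y (dvec i)) (bvec i) = 0.
Proof.
move=> dY; have := congr1 Y m_dual; rewrite linear0 linear_sum /=.
under eq_bigr => i _ do rewrite dY.
rewrite big_split /= (@dual_swap _ (fun u v => m v (Y u))) => [|x t u v|x t u v].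
- under [X in _ + X]eq_bigr => i _ do rewrite mC.
  move=> E; apply: (scalerI (nz (n := 2) isT isT)).
  by rewrite scaler0 scaler_nat mulr2n; exact: E.
- by rewrite mDl mZl.
- by rewrite linearP mDr mZr.
Qed.

(** Companion of [dfun_contract] with a derivation inserted in the contraction; the two together
    give all the terms of the Killing form. *)
Lemma dfun_deriv_contract Y a : deriv Y ->
  \sum_i dfun a (Y (dvec i)) (bvec i) = - (3%:R / 2%:R) *: Y a.
Proof.
move=> dY; have sY := deriv_skew dY; apply: f_inj => z; rewrite f_suml.
under eq_bigr => i _ do rewrite fdfun.
rewrite big_split sumrB -mulr_sumr sumrB -mulr_suml -f_suml m_deriv_dual //=.
rewrite f0l.
rewrite (_ : \sum_i f (Y (dvec i)) (bvec i) = 0); last first.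
  rewrite -[RHS](deriv_tr0 dY) [RHS](@dual_swapk (fun u v => f (Y u) v)) //.
  by move=> x t u v; rewrite linearP fDl fZl.
rewrite (_ : \sum_i f (m a (bvec i)) (m (Y (dvec i)) z) =
  - (7%:R / 6%:R * f (Y z) a)).
  rewrite (_ : \sum_i _ = - f a (Y z)); last first.
    rewrite -dual_contract -sumrN; apply: eq_bigr => i _.
    by rewrite sY mulrN [f _ (Y z)]fC.
  by rewrite [f (Y z) a]fC fZl [f (Y a) z]sY; fieldnz.
rewrite -trDLL // (@trfC (fun w => m z (m a w)) Y); first last.
- by move=> t u v; rewrite linearP.
- by move=> t u v; rewrite !mE.
rewrite -sumrN; apply: eq_bigr => i _.
by rewrite sY opprK [m _ z]mC !fM.
Qed.

Lemma deriv_dfun Y a b c : deriv Y ->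
  Y (dfun a b c) = dfun (Y a) b c + dfun a (Y b) c + dfun a b (Y c).
Proof.
move=> dY; have sY := deriv_skew dY; apply: f_inj => z.
rewrite /dfun linearD linearB linearZ /= linearB !linearZ /= !dY !mE !fE.
by rewrite ![f (Y _) c]sY; ring.
Qed.

(** * A contraction of products of two inner derivations *)

Section Quadratic.
Variables a c x : W.

Lemma tr_LLLL : trf (fun w => m x (m c (m a (m x w)))) =
  2%:R^-1 * (f (m a c) (m x x)
    + 6%:R^-1 * (f x x * (7%:R / 3%:R * f a c) + 2%:R * f (m c x) (m a x))).
Proof.
rewrite (@trfC (m x) (fun w => m c (m a (m x w)))) //; last first.
  by move=> t u v; rewrite !mE.
rewrite (@eq_trf _ (fun w => 2%:R^-1 *: (- m c (m a (m (m x x) w))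
   + 6%:R^-1 *: (f x x *: m c (m a w) + 2%:R *: (f x w *: m c (m a x)))))).
  rewrite trfZ trfD trfN trfZ trfD !trfZ trLLL trLL trf_rk -[f x (m _ _)]fM.
  by rewrite [m c a]mC [f c a]fC opprK.
move=> w; have E : m x (m x w) = 2%:R^-1 *: (- m (m x x) w
   + 6%:R^-1 *: (f x x *: w + 2%:R *: (f x w *: x))).
  apply: (scalerI (nz (n := 2) isT isT)).
  rewrite [RHS]scalerA mulfV ?nz // scale1r scaler_nat mulr2n cubic2.
  by rewrite -addrA [2%:R *: _]scaler_nat mulr2n.
by rewrite E !mE.
Qed.

Lemma fm_quadratic : 2%:R * f (m c x) (m a x) = - f (m a c) (m x x)
  + 6%:R^-1 * (f a c * f x x + 2%:R * (f a x * f c x)).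
Proof.
have := congr1 (f^~ x) (cubic2 a c x); rewrite /= !fE !fM.
rewrite [m (m a c) x]mC -[f x (m x _)]fM -[f x (m a _)]fM.
rewrite [f (m a x) _]fC fM -[f c (m _ _)]fM [f (m a c) _]fC.
by move=> E; rewrite mulr_natl mulr2n E; ring.
Qed.

(** Quadratic form in x of the contracted product of two inner derivations. It is the computation
    behind the surjectivity of [phi0]. *)
Lemma dfun2_contract :
  \sum_i f (dfun c (dvec i) (dfun a (bvec i) x)) x =
  - (7%:R / 4%:R * (f a x * f c x) + 5%:R / 8%:R * (f a c * f x x)
     - 3%:R / 4%:R * f (m a c) (m x x)).
Proof.
pose z := m a x; pose y := m c x.
(* Skewness moves the outer derivation onto x, and the contracted index then occurs as the argument
   of a single operator, whose trace is expanded term by term. *)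
transitivity (- trf (fun w =>
   m x (m c (m a (m x w))) - m x (m c (m z w))
   + 3%:R^-1 *: (f x w *: m x (m c a)) - (3%:R^-1 * f a x) *: m x (m c w)
   - m y (m a (m x w)) + m y (m z w)
   - 3%:R^-1 *: (f x w *: m y a) + (3%:R^-1 * f a x) *: m y w
   + 3%:R^-1 *: (f (m x (m a c)) w *: x) - 3%:R^-1 *: (f (m z c) w *: x)
   + (9%:R^-1 * f a c) *: (f x w *: x) - (9%:R^-1 * f a x) *: (f c w *: x)
   - (3%:R^-1 * f c x) *: m a (m x w) + (3%:R^-1 * f c x) *: m z w
   - (9%:R^-1 * f c x) *: (f x w *: a) + (9%:R^-1 * f c x * f a x) *: w)).
  rewrite /trf -sumrN; apply: eq_bigr => i _.
  have key d v : f v (dfun c d x) =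
      f (m x (m c v) - m y v + 3%:R^-1 *: (f c v *: x - f c x *: v)) d.
    rewrite fC fdfun !fE [m d x]mC fM [f _ (m d v)]fC [m d v]mC fM.
    by rewrite [m v _]mC ![f d _]fC /y; ring.
  rewrite dfun_skew key /dfun -/z; congr (- f _ _); apply: f_inj => u.
  rewrite [m (bvec i) x]mC [m (bvec i) z]mC [f (bvec i) x]fC.
  rewrite [f (m x (m a c)) _]fM [f (m a c) _]fM [f (m z c) _]fM.
  by rewrite !mE !fE [f c a]fC; fieldnz.
rewrite !trfD !trfN !trfZ !trf_rk !trLL !trLLL trL tr_LLLL -/y -/z tr1.
rewrite -[trf (fun w => m z w)]/(trf (m z)) trL [m x c]mC -/y.
rewrite (_ : f x (m x (m c a)) = f (m a c) (m x x)); last first.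
  by rewrite -fM fC [m c a]mC.
rewrite (_ : f (m x (m a c)) x = f (m a c) (m x x)); last by rewrite fM.
rewrite (_ : f (m y a) x = f y z); last by rewrite fA.
rewrite (_ : f x (m y a) = f y z); last by rewrite fC fA.
rewrite (_ : f (m z c) x = f y z); last by rewrite fA fC.
rewrite (_ : f y z = 2%:R^-1 * (- f (m a c) (m x x)
  + 6%:R^-1 * (f a c * f x x + 2%:R * (f a x * f c x)))); last first.
  rewrite -fm_quadratic -/y -/z; by fieldnz.
by rewrite [f x c]fC [f x a]fC; fieldnz.
Qed.
End Quadratic.

Lemma fdfunC a b c d : f (dfun a b c) d = f (dfun b a d) c.
Proof. by rewrite !fdfun [f (m a d) _]fC [f (m b d) _]fC; ring. Qed.

Lemma dfun_suml (I : finType) (r : I -> k) (F : I -> W) b c :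
  dfun (\sum_i r i *: F i) b c = \sum_i r i *: dfun (F i) b c.
Proof.
elim/big_ind2: _ => // [|x1 x2 y1 y2 <- <-|i _]; last exact: dfunZl.
  by rewrite -[0 in LHS](scale0r 0) dfunZl scale0r.
exact: dfunDl.
Qed.

Lemma sprodDl a b c : sprod (a + b) c = sprod a c + sprod b c :> sym2 W.
Proof. by have := sprod_linear c 1 a b; rewrite !scale1r. Qed.
Lemma sprod0l c : sprod 0 c = 0 :> sym2 W.
Proof. by apply: (addIr (sprod 0 c)); rewrite -sprodDl !add0r. Qed.
Lemma sprodZl t a c : sprod (t *: a) c = t *: sprod a c :> sym2 W.
Proof. by have := sprod_linear c t a 0; rewrite sprod0l !addr0. Qed.
Lemma sprod_suml (I : finType) (F : I -> W) c :
  sprod (\sum_i F i) c = \sum_i sprod (F i) c :> sym2 W.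
Proof.
exact: (big_morph (fun a => sprod a c) (fun a b => sprodDl a b c) (sprod0l c)).
Qed.
Lemma sprodZr t a c : sprod a (t *: c) = t *: sprod a c :> sym2 W.
Proof. by rewrite ![sprod a _]sprodC sprodZl. Qed.
Lemma sprod_sumr (I : finType) (F : I -> W) c :
  sprod c (\sum_i F i) = \sum_i sprod c (F i) :> sym2 W.
Proof. by rewrite sprodC sprod_suml; apply: eq_bigr => i _; rewrite sprodC. Qed.

(** * S^2 W as symmetric operators, and the product star in that language *)

Section Sym2Op.
Variable op : {linear sym2 W -> 'End(W)}.
Hypothesis opE : forall a b x,
  op (sprod a b) x = 2%:R^-1 *: (f b x *: a + f a x *: b).

Lemma opP c u v x : op (c *: u + v) x = c *: op u x + op v x.
Proof. by rewrite linearP lfun_linE. Qed.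

(** Inverse of [op] on symmetric operators, by [sym2_opK] and [sym2_ofK]. *)
Definition sym2_of (T : 'End(W)) : sym2 W := \sum_i sprod (T (bvec i)) (dvec i).

Lemma sym2_of_linear : linear sym2_of.
Proof.
move=> c u v; rewrite /sym2_of scaler_sumr -big_split; apply: eq_bigr => i _.
by rewrite lfun_linE sprod_linear.
Qed.

Lemma sym2_opK : cancel op sym2_of.
Proof.
apply: eq_sym2_linear => [c u v|//|a b]; first by rewrite linearP sym2_of_linear.
rewrite /sym2_of; under eq_bigr => i _ do
  rewrite opE sprodZl sprodDl !sprodZl -!sprodZr.
rewrite -scaler_sumr big_split /= -!sprod_sumr -!dvec_sumr [sprod b a]sprodC.
have n2 : 2%:R != 0 :> k by apply: nz.
by rewrite -mulr2n -scaler_nat scalerA mulVf // scale1r.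
Qed.

Lemma op_sym u x y : f (op u x) y = f x (op u y).
Proof.
apply: (@eq_sym2_linear k W k^o (fun u => f (op u x) y) (fun u => f x (op u y))).
- by move=> c v w; rewrite opP !fE.
- by move=> c v w; rewrite opP !fE.
by move=> a b; rewrite !opE !fE ![f _ y]fC [f x a]fC [f x b]fC; ring.
Qed.

Lemma sym2_ofK (T : 'End(W)) : (forall x y, f (T x) y = f x (T y)) -> op (sym2_of T) = T.
Proof.
move=> sT; apply/lfunP => x; rewrite linear_sum sum_lfunE.
under eq_bigr => i _ do rewrite opE scalerDr.
rewrite big_split /= -!scaler_sumr.
have -> : \sum_i f (dvec i) x *: T (bvec i) = T x.
  rewrite [in RHS](dvec_sum x) linear_sum; apply: eq_bigr => i _.
  by rewrite linearZ /= fC.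
have -> : \sum_i f (T (bvec i)) x *: dvec i = T x.
  by rewrite [in RHS](dvec_sumr (T x)); apply: eq_bigr => i _; rewrite sT fC.
have n2 : 2%:R != 0 :> k by apply: nz.
by rewrite -scalerDr -mulr2n -scaler_nat scalerA mulVf // scale1r.
Qed.

(** Describes A as the orthogonal complement, for the trace form, of the multiplication operators
    L_z. *)
Lemma f_mu u z : f (sym2_lift m u) z = trf (fun w => op u (m z w)).
Proof.
apply: (@eq_sym2_linear k W k^o (fun u => f (sym2_lift m u) z)
  (fun u => trf (fun w => op u (m z w)))).
- by move=> c v w; rewrite linearP !fE.
- move=> c v w; rewrite [RHS](_ : _ = c * trf (fun w => op v (m z w))
    + trf (fun w0 => op w (m z w0))) // -trfZ -trfD.
  by apply: eq_trf => x; apply: opP.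
move=> a b; rewrite sym2_lift_sprod // => [|b' c u' v]; last by rewrite !mE.
rewrite (@eq_trf _ (fun w => 2%:R^-1 *: (f (m z b) w *: a + f (m z a) w *: b))).
  by rewrite trfZ trfD !trf_rk !(fA z) [m b a]mC [f z _]fC; field; nzs.
by move=> w; rewrite opE !fM.
Qed.

Lemma trf_op_sprod a b : trf (op (sprod a b)) = f a b.
Proof.
rewrite (eq_trf (opE a b)) trfZ trfD !trf_rk [f b a]fC; field; nzs.
Qed.

Lemma trf_op_linear (c : k) u v : trf (op (c *: u + v)) = c * trf (op u) + trf (op v).
Proof. by rewrite -trfZ -trfD; apply: eq_trf => x; apply: opP. Qed.

Lemma trf_form (F : W -> W) a b : linear F ->
  trf (fun w => f b (F w) *: a) = f b (F a).
Proof.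
move=> lF; pose Fl : {linear W -> W} := HB.pack F (GRing.isLinear.Build k W W _ F lF).
rewrite -[F a]/(Fl a) [in RHS](dvec_sum a) linear_sum f_sumr.
by apply: eq_bigr => i _; rewrite fZl linearZ /= fZr mulrC.
Qed.

Lemma trf_op (F : W -> W) a b : linear F ->
  trf (fun w => op (sprod a b) (F w)) = 2%:R^-1 * (f b (F a) + f a (F b)).
Proof.
move=> lF; rewrite (eq_trf (fun w => opE a b (F w))) trfZ trfD !trf_form //.
Qed.

Lemma m_lfun_linear (T : 'End(W)) x y : linear (fun w => m x (T (m y w))).
Proof. by move=> c u v; rewrite m_lin linearP m_lin. Qed.
Lemma lfun_m_linear (T : 'End(W)) x : linear (fun w => T (m x w)).
Proof. by move=> c u v; rewrite m_lin linearP. Qed.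

(** The cubic identity turns the symmetrised product [L_x L_y + L_y L_x] into
    [- L_(x * y)] up to terms of rank at most two and scalars. *)
Lemma trf_mm (T : 'End(W)) x y : (forall x y, f (T x) y = f x (T y)) ->
  trf (fun w => T (m x (m y w))) + trf (fun w => T (m y (m x w))) =
  - trf (fun w => T (m (m x y) w)) + 6%:R^-1 * (f x y * trf T + 2%:R * f (T x) y).
Proof.
move=> sT; rewrite -trfD.
transitivity (trf (fun w => - T (m (m x y) w) +
   6%:R^-1 *: (f x y *: T w + f y w *: T x + f x w *: T y))).
  apply: eq_trf => w; rewrite -linearD cubic2 linearD linearN linearZ /=.
  by rewrite !linearD !linearZ.
rewrite trfD trfN trfZ trfD trfD trfZ !trf_rk [f y _]fC -(sT x y); ring.
Qed.

Lemma fm_rot a x b : f a (m x b) = f (m b a) x.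
Proof. by rewrite fC fA fC. Qed.

Variable smul : sym2 W -> sym2 W -> sym2 W.
Hypothesis smulE : forall a b c d, smul (sprod a b) (sprod c d) =
  sprod (m a c) (m b d) + sprod (m a d) (m b c).
Hypothesis smul_l : forall v, linear (smul^~ v).
Hypothesis smul_r : forall u, linear (smul u).

(** Both sides are bilinear in u and v, so products of two vectors suffice; there each trace is that
    of an operator of rank at most two. *)
Lemma op_mul u v x y : f (op (smul u v) x) y =
  trf (fun w => op u (m x (op v (m y w)))) +
  trf (fun w => op u (m y (op v (m x w)))).
Proof.
pose T (u v : sym2 W) x y : k^o := trf (fun w => op u (m x (op v (m y w)))).
have Tl v' x' y' : linear (fun u => T u v' x' y').
  move=> c u1 u2; rewrite /T [RHS](_ : _ = c * T u1 v' x' y' + T u2 v' x' y') //.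
  by rewrite /T -trfZ -trfD; apply: eq_trf => w; apply: opP.
have Tr u' x' y' : linear (fun v => T u' v x' y').
  move=> c u1 u2; rewrite /T [RHS](_ : _ = c * T u' u1 x' y' + T u' u2 x' y') //.
  by rewrite /T -trfZ -trfD; apply: eq_trf => w; rewrite opP m_lin linearP.
move: u; apply: (@eq_sym2_linear k W k^o (fun u => f (op (smul u v) x) y)
   (fun u => T u v x y + T u v y x)) => [c u1 u2||a b].
- by rewrite smul_l opP !fE.
- exact: linear_fun_add.
move: v; apply: (@eq_sym2_linear k W k^o (fun v => f (op (smul (sprod a b) v) x) y)
   (fun v => T (sprod a b) v x y + T (sprod a b) v y x)) => [c u1 u2||c d].
- by rewrite smul_r opP !fE.
- exact: linear_fun_add.
rewrite smulE -[sprod (m a c) _]scale1r opP !opE /T !trf_op; try exact: m_lfun_linear.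
rewrite !opE !(mE, fE).
rewrite ![f _ (m x _)]fm_rot ![f _ (m y _)]fm_rot.
rewrite [m d b]mC [m c b]mC [m d a]mC [m c a]mC; field; nzs.
Qed.

Variable sid : sym2 W.
Hypothesis op_sid : forall x, op sid x = x.
Variable star : sym2 W -> sym2 W -> sym2 W.
Hypothesis starE : forall a b c d, star (sprod a b) (sprod c d) =
  24%:R^-1 *:
    (f a c *: (smul (sprod b d) sid + sprod b d)
     + f a d *: (smul (sprod b c) sid + sprod b c)
     + f b c *: (smul (sprod a d) sid + sprod a d)
     + f b d *: (smul (sprod a c) sid + sprod a c))
  + 36%:R^-1 *:
    (f a c *: sprod b d + f a d *: sprod b c
     + f b c *: sprod a d + f b d *: sprod a c
     + f a b *: sprod c d + f c d *: sprod a b)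
  - 6%:R^-1 *: smul (sprod a b) (sprod c d)
  - (72%:R^-1 * (f a c * f b d + f a d * f b c)) *: sid.
Hypothesis star_l : forall v, linear (star^~ v).
Hypothesis star_r : forall u, linear (star u).

Lemma opD u v x : op (u + v) x = op u x + op v x.
Proof. by rewrite linearD add_lfunE. Qed.
Lemma opZ c u x : op (c *: u) x = c *: op u x.
Proof. by rewrite linearZ scale_lfunE. Qed.
Lemma opN u x : op (- u) x = - op u x.
Proof. by rewrite linearN opp_lfunE. Qed.

Lemma op_mul_sid a b x y : f (op (smul (sprod a b) sid) x) y =
  - f (m a b) (m x y) + 6%:R^-1 * (f x y * f a b + f a x * f b y + f b x * f a y).
Proof.
rewrite op_mul (eq_trf (G := fun w => op (sprod a b) (m x (m y w)))); last first.
  by move=> w; rewrite op_sid.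
rewrite [X in _ + X](eq_trf (G := fun w => op (sprod a b) (m y (m x w)))); last first.
  by move=> w; rewrite op_sid.
rewrite trf_mm; last exact: op_sym.
rewrite trf_op_sprod trf_op ?opE; last exact: m_lin.
rewrite !fE ![f _ (m (m x y) _)]fm_rot [m b a]mC [f b x]fC [f a x]fC.
rewrite [f x b]fC [f x a]fC; field; nzs.
Qed.

Lemma op_op a b c d x : op (sprod a b) (op (sprod c d) x) =
  4%:R^-1 *: ((f b c * f d x + f b d * f c x) *: a + (f a c * f d x + f a d * f c x) *: b).
Proof. by apply: f_inj => z; rewrite !opE !fE; field; nzs. Qed.

Lemma trf_op_op_m a b c d z :
  trf (fun w => op (sprod a b) (op (sprod c d) (m z w))) =
  4%:R^-1 * (f b c * f (m a d) z + f b d * f (m a c) z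
     + f a c * f (m b d) z + f a d * f (m b c) z).
Proof.
rewrite (trf_op (F := fun w => op (sprod c d) (m z w))); last exact: lfun_m_linear.
rewrite !opE !fE ![f _ (m z _)]fm_rot; field; nzs.
Qed.

Lemma star_form u v x y : f (op (star u v) x) y =
  6%:R^-1 * (f (op u (op v x)) y + f (op v (op u x)) y)
  - 12%:R^-1 * (trf (fun w => op u (op v (m (m x y) w)))
                + trf (fun w => op v (op u (m (m x y) w))))
  - 6%:R^-1 * (trf (fun w => op u (m x (op v (m y w))))
               + trf (fun w => op u (m y (op v (m x w)))))
  + 36%:R^-1 * (trf (op u) * f (op v x) y + trf (op v) * f (op u x) y).
Proof.
rewrite -op_mul.
have h1 (v' : sym2 W) : scalar (fun u => trf (fun w => op u (op v' (m (m x y) w)))).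
  by move=> c u1 u2; rewrite -trfZ -trfD; apply: eq_trf => w; apply: opP.
have h2 (v' : sym2 W) : scalar (fun u => trf (fun w => op v' (op u (m (m x y) w)))).
  by move=> c u1 u2; rewrite -trfZ -trfD; apply: eq_trf => w; rewrite opP linearP.
have h3 : scalar (fun u => trf (op u)) by exact: trf_op_linear.
move: u; apply: (@eq_sym2_linear k W k^o (fun u => _) (fun u => _)) => [c u1 u2|c u1 u2|a b].
- by rewrite star_l opP !fE.
- rewrite smul_l !h1 !h2 !h3 !opP !linearP !fE /GRing.scale /=; ring.
move: v; apply: (@eq_sym2_linear k W k^o (fun v => _) (fun v => _)) => [c u1 u2|c u1 u2|c d].
- by rewrite star_r opP !fE.
- rewrite smul_r !h1 !h2 !h3 !opP !linearP !fE /GRing.scale /=; ring.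
rewrite starE !(opD, opZ, opN) op_sid !fE !op_mul_sid.
set sm := f (op (smul (sprod a b) (sprod c d)) x) y.
rewrite !trf_op_op_m !trf_op_sprod !op_op !opE !fE.
rewrite [f c b]fC [f d b]fC [f c a]fC [f d a]fC [m c b]mC [m d b]mC [m c a]mC [m d a]mC.
field; nzs.
Qed.


(** * The Lie algebra of derivations and its Killing form *)

Section Lie.
Variables (g : vectType k) (br : {bilinear g -> g -> g}).
Variables (rho : g -> 'End(W)) (delta : W -> W -> g).
Hypothesis rho_lin : linear rho.
Hypothesis rho_inj : injective rho.
Hypothesis rho_br : forall X Y w,
  rho (br X Y) w = rho X (rho Y w) - rho Y (rho X w).
Hypothesis rho_der : forall X, deriv (rho X).
Hypothesis rho_delta : forall a b, rho (delta a b) = dop a b.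

Let rhoE c X Y w : rho (c *: X + Y) w = c *: rho X w + rho Y w.
Proof. by rewrite rho_lin lfun_linE. Qed.

Lemma rho_sum (I : finType) (r : I -> k) (F : I -> g) :
  rho (\sum_i r i *: F i) = \sum_i r i *: rho (F i).
Proof.
have rho0 : rho 0 = 0.
  by have := rho_lin (-1) 0 0; rewrite scaler0 addr0 scaleN1r addNr.
elim/big_ind2: _ => // [x1 x2 y1 y2 <- <-|i _].
  by have := rho_lin 1 x2 y2; rewrite !scale1r.
by have := rho_lin (r i) (F i) 0; rewrite rho0 !addr0.
Qed.

(** [deriv_dop_sum] read in g. It expresses X through the spanning family [delta] with coefficients
    linear in X, so it serves as a resolution of the identity of g. *)
Lemma rho_delta_sum X : X = \sum_p (3%:R^-1 * f (rho X (bvec p.1)) (dvec p.2)) *: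
  delta (bvec p.2) (dvec p.1).
Proof.
apply: rho_inj; rewrite rho_sum; apply: (scalerI (nz (n := 3) isT isT)).
rewrite -deriv_dop_sum // scaler_sumr -(pair_bigA _ (fun j i =>
  3%:R *: ((3%:R^-1 * f (rho X (bvec j)) (dvec i)) *: rho (delta (bvec i) (dvec j))))) /=.
apply: eq_bigr => j _; apply/lfunP => w; rewrite sum_lfunE dopE.
apply: f_inj => z; rewrite f_suml.
rewrite [in LHS](dvec_sum (rho X (bvec j))) dfun_suml f_suml.
apply: eq_bigr => i _; rewrite scalerA mulrA mulfV ?nz // mul1r.
by rewrite scale_lfunE rho_delta dopE.
Qed.

(** The resolution of the identity from [rho_delta_sum] turns a trace on g into a double sum over
    dual bases of W. *)
Lemma lfun_tr_rho (Q : 'End(g)) : lfun_tr Q = 3%:R^-1 *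
  \sum_i \sum_j f (rho (Q (delta (bvec i) (dvec j))) (bvec j)) (dvec i).
Proof.
transitivity (\sum_l \sum_p 3%:R^-1 * f (rho (bvec l) (bvec p.1)) (dvec p.2)
   * bcoord l (Q (delta (bvec p.2) (dvec p.1)))).
  apply: eq_bigr => l _.
  rewrite [X in Q X]rho_delta_sum linear_sum /bcoord linear_sum.
  by apply: eq_bigr => p _; rewrite !linearZ.
rewrite exchange_big mulr_sumr /=.
under [RHS]eq_bigr => i _ do rewrite mulr_sumr.
rewrite [RHS]exchange_big [RHS]pair_bigA; apply: eq_bigr => -[j i] _ /=.
set Z := Q _.
rewrite [in RHS](bvec_sum Z) rho_sum sum_lfunE f_suml mulr_sumr.
by apply: eq_bigr => l _; rewrite scale_lfunE fZl; ring.
Qed.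

Lemma rho_br_delta Y a b :
  rho (br Y (delta a b)) = dop (rho Y a) b + dop a (rho Y b).
Proof.
apply/lfunP => w; rewrite rho_br rho_delta add_lfunE !dopE deriv_dfun //.
by rewrite addrK.
Qed.

(** By the Leibniz rule, ad X ad Y sends [delta a b] to four terms. Their contractions are 6, -3/2,
    -3/2 and 6 times tr(XY), which add up to 9, and [lfun_tr_rho] divides by 3. *)
Lemma killing_trf X Y :
  killing br X Y = 3%:R * trf (fun w => rho X (rho Y w)).
Proof.
have brD (U V : g) : br X (U + V) = br X U + br X V by rewrite linearDr.
have E a b w : rho (br X (br Y (delta a b))) w =
    dfun (rho X (rho Y a)) b w + dfun (rho Y a) (rho X b) w
    + dfun (rho X a) (rho Y b) w + dfun a (rho X (rho Y b)) w.
  rewrite rho_br rho_br_delta !add_lfunE !dopE linearD /= !deriv_dfun //.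
  by apply: f_inj => z; rewrite !fE; ring.
rewrite /killing lfun_tr_rho.
under eq_bigr => i _ do under eq_bigr => j _ do
  rewrite comp_lfunE !adE E 3!fDl.
under eq_bigr => i _ do rewrite !big_split /= -!f_suml
  dfun_contract !dfun_deriv_contract // !fZl.
rewrite !big_split -!mulr_sumr /=.
(* [fdfunC] exchanges the roles of the two contracted indices, which reduces this term to
   [dfun_contract]. *)
have -> : \sum_i f (\sum_j dfun (bvec i) (rho X (rho Y (dvec j))) (bvec j)) (dvec i)
    = 6%:R * trf (fun w => rho X (rho Y w)).
  under eq_bigr => i _ do rewrite f_suml.
  rewrite exchange_big /trf (@dual_swapk (fun v w => f (rho X (rho Y v)) w)) //=; last first.
    by move=> x t v w; rewrite !linearP fDl fZl.
  rewrite mulr_sumr; apply: eq_bigr => j _.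
  set u := rho X _.
  transitivity (f (\sum_i dfun u (bvec i) (dvec i)) (bvec j)).
    by rewrite f_suml; apply: eq_bigr => i _; rewrite fdfunC.
  rewrite (@dual_swap _ (fun v w => dfun u v w)) => [|x|x].
  - by rewrite dfun_contract fZl.
  - exact: dfun_linear.
  - exact: dfun_linm.
rewrite -/(trf (fun w => rho X (rho Y w))) -/(trf (fun w => rho Y (rho X w))).
rewrite (@trfC (rho Y) (rho X)); first by fieldnz.
  by move=> t u v; rewrite linearP.
by move=> t u v; rewrite linearP.
Qed.


(** * Operator form of the diamond formula, and the identities it rests on *)

Definition anti (X Y : 'End(W)) : 'End(W) := ((X \o Y) + (Y \o X))%VF.
Definition lbr (X Y : 'End(W)) : 'End(W) := ((X \o Y) - (Y \o X))%VF.
Definition ldbr C D B := lbr C (lbr D B) + lbr D (lbr C B).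
(** Twice the six derivative terms of the diamond formula, with [anti] for the symmetric product:
    [ldbr C D] is twice the symmetrised product of ad C and ad D, hence the explicit 2 on the last
    two terms. *)
Definition six A B C D : 'End(W) :=
  anti A (ldbr C D B) + anti (ldbr C D A) B + anti C (ldbr A B D)
  + anti (ldbr A B C) D
  + 2%:R *: (anti (lbr A C) (lbr B D) + anti (lbr A D) (lbr B C)).
Definition tau (X Y : 'End(W)) : k := trf (fun w => X (Y w)).
(** With the factor 27 and this scalar correction, [star_phi0] carries exactly the coefficients of
    the diamond formula. *)
Definition kap (T : 'End(W)) : 'End(W) :=
  27%:R *: T - (3%:R / 4%:R * trf T) *: \1%VF.

Lemma antiE X Y w : anti X Y w = X (Y w) + Y (X w).
Proof. by rewrite /anti add_lfunE !comp_lfunE. Qed.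
Lemma antiC X Y : anti X Y = anti Y X.
Proof. by rewrite /anti addrC. Qed.
Lemma lbrE X Y w : lbr X Y w = X (Y w) - Y (X w).
Proof. by rewrite /lbr add_lfunE opp_lfunE !comp_lfunE. Qed.
Lemma kapE T w : kap T w = 27%:R *: T w - (3%:R / 4%:R * trf T) *: w.
Proof. by rewrite /kap add_lfunE opp_lfunE !scale_lfunE id_lfunE. Qed.

Lemma trf_lfunP c (X Y : 'End(W)) : trf (c *: X + Y) = c * trf X + trf Y.
Proof. by rewrite -trfZ -trfD; apply: eq_trf => w; rewrite lfun_linE. Qed.

Lemma trf_lin (F : W -> W) (T : 'End(W)) c : (forall w, F w = c *: T w) ->
  trf F = c * trf T.
Proof. by move=> h; rewrite (eq_trf h) trfZ. Qed.

Lemma kap_linear : linear kap.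
Proof.
move=> c X Y; apply/lfunP => w; rewrite [RHS]lfun_linE !kapE trf_lfunP lfun_linE.
by apply: f_inj => z; rewrite !fE; ring.
Qed.

Lemma anti_linear Y : linear (anti^~ Y).
Proof.
move=> c X X'; apply/lfunP => w; rewrite lfun_linE !antiE !lfun_linE linearP.
by rewrite scalerDr addrACA.
Qed.

Lemma tr_anti X Y : trf (anti X Y) = 2%:R * tau X Y.
Proof.
rewrite (eq_trf (antiE X Y)) trfD -/(tau X Y) mulr_natl mulr2n; congr (_ + _).
by rewrite trfC // => c u v; rewrite linearP.
Qed.

Lemma trf_kap T : trf (kap T) = 15%:R / 2%:R * trf T.
Proof.
rewrite (eq_trf (kapE T)) trfD trfN !trfZ.
by rewrite -[trf (fun w => w)]/(trf id) tr1; field; nzs.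
Qed.

Lemma deriv_lbr X Y : deriv X -> deriv Y -> deriv (lbr X Y).
Proof.
move=> dX dY a b; rewrite !lbrE dX dY !linearD /= !dX !dY.
by apply: f_inj => z; rewrite !mE !fE; ring.
Qed.

Lemma anti_sym X Y : deriv X -> deriv Y ->
  forall x y, f (anti X Y x) y = f x (anti X Y y).
Proof.
move=> dX dY x y; have sX := deriv_skew dX; have sY := deriv_skew dY.
by rewrite !antiE !fE sX !sY sX !opprK addrC.
Qed.

Lemma kap_sym (T : 'End(W)) : (forall x y, f (T x) y = f x (T y)) ->
  forall x y, f (kap T x) y = f x (kap T y).
Proof. by move=> sT x y; rewrite !kapE !fE sT. Qed.

(** Places the image of [phi0] inside A. It reflects the absence of an invariant map from S^2 g to
    W. *)
Hypothesis derZ : forall A B z, deriv A -> deriv B ->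
  trf (fun w => A (B (m z w))) = 0.
(** Polarisation of tr X^4 = (tr X^2)^2/12, valid because F4 has no independent invariant of degree
    4. *)
Hypothesis derQ : forall A B C D, deriv A -> deriv B -> deriv C -> deriv D ->
  trf (fun w => A (B (C (D w)))) + trf (fun w => A (C (B (D w))))
  + trf (fun w => A (B (D (C w))))
  = 12%:R^-1 * (tau A B * tau C D + tau A C * tau B D + tau A D * tau B C).
(** The core of the compatibility of star with diamond: what remains of it once the scalar parts of
    [kap] and the traces controlled by [derZ] and [trf_mm] are removed. *)
Hypothesis derP : forall A B C D x y,
  deriv A -> deriv B -> deriv C -> deriv D ->
  216%:R * f (anti (anti A B) (anti C D) x) y
  - 108%:R * trf (fun w => anti (anti A B) (anti C D) (m (m x y) w))
  - 216%:R * (trf (fun w => anti A B (m x (anti C D (m y w))))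
              + trf (fun w => anti A B (m y (anti C D (m x w)))))
  + trf (anti A B) * trf (anti C D) * f x y
  = 108%:R * f (six A B C D x) y - 3%:R * trf (six A B C D) * f x y
  + 36%:R * (tau A C * f (anti B D x) y + tau A D * f (anti B C x) y
             + tau B C * f (anti A D x) y + tau B D * f (anti A C x) y)
  - 4%:R * (tau A C * tau B D + tau A D * tau B C) * f x y.

Lemma anti_Z A B z : deriv A -> deriv B -> trf (fun w => anti A B (m z w)) = 0.
Proof.
move=> dA dB; rewrite (eq_trf (fun w => antiE A B (m z w))) trfD.
by rewrite !derZ // addr0.
Qed.

(** Lets [ring] or [field] prove an equation from up to three known ones, given the coefficients of
    the linear combination. *)
Lemma eq_of_lin3 (l r p p' q q' v v' s t u : k) : p = p' -> q = q' -> v = v' ->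
  l - r = s * (p - p') + t * (q - q') + u * (v - v') -> l = r.
Proof.
by move=> -> -> -> /eqP; rewrite !subrr !mulr0 !addr0 subr_eq0 => /eqP.
Qed.

(** In [star_form] the terms mixing an operator with the scalar part of the other are evaluated by
    [trf_mm], where [derZ] kills the trace against L_(x*y); the rest is a multiple of [derP]. *)
Lemma star_kap A B C D u v x y :
  deriv A -> deriv B -> deriv C -> deriv D ->
  op u = kap (anti A B) -> op v = kap (anti C D) ->
  f (op (star u v) x) y = 9%:R / 4%:R * f (kap (six A B C D) x) y
  + 3%:R / 4%:R * (tau A C * f (kap (anti B D) x) y + tau A D * f (kap (anti B C) x) y
             + tau B C * f (kap (anti A D) x) y + tau B D * f (kap (anti A C) x) y).
Proof.
move=> dA dB dC dD uE vE; rewrite star_form uE vE.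
have lE (T : 'End(W)) : linear T by move=> c p q; rewrite linearP.
pose al := 3%:R / 4%:R * trf (anti A B); pose ga := 3%:R / 4%:R * trf (anti C D).
have T1 : trf (fun w => kap (anti A B) (kap (anti C D) (m (m x y) w)))
  + trf (fun w => kap (anti C D) (kap (anti A B) (m (m x y) w))) =
  729%:R * trf (fun w => anti (anti A B) (anti C D) (m (m x y) w)).
  rewrite -trfD (eq_trf (G := fun w => 729%:R *: anti (anti A B) (anti C D) (m (m x y) w)
     + ((- 54%:R * ga) *: anti A B (m (m x y) w) + ((- 54%:R * al) *: anti C D (m (m x y) w)
     + (2%:R * al * ga) *: m (m x y) w)))); last first.
    move=> w; rewrite !kapE -/al -/ga (antiE (anti A B)) !linearB /= !linearZ /=.
    by apply: f_inj => z; rewrite !fE; ring.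
  by rewrite !trfD !trfZ (anti_Z _ dA dB) (anti_Z _ dC dD) (trL (m x y)) !mulr0 !addr0.
have T2 x' y' : trf (fun w => kap (anti A B) (m x' (kap (anti C D) (m y' w)))) =
  729%:R * trf (fun w => anti A B (m x' (anti C D (m y' w))))
  - 27%:R * ga * trf (fun w => anti A B (m x' (m y' w)))
  - 27%:R * al * trf (fun w => anti C D (m y' (m x' w)))
  + al * ga * (7%:R / 3%:R * f x' y').
  rewrite -(trfC (F := m x') (G := fun w => anti C D (m y' w))) //; last first.
    by move=> c p q; rewrite m_lin linearP.
  rewrite -trLL -!trfZ -!trfN -!trfD; apply: eq_trf => w.
  rewrite !kapE -/al -/ga !(mE, linearB, linearD, linearN, linearZ) /=.
  by rewrite !(mE, linearB, linearD, linearN, linearZ) /=; apply: f_inj => z; rewrite !fE; ring.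
rewrite T1 !T2 !trf_kap.
have sa := anti_sym dA dB; have sc := anti_sym dC dD.
have Ea := trf_mm x y sa; have Ec := trf_mm x y sc; have P := derP x y dA dB dC dD.
rewrite (anti_Z _ dA dB) in Ea; rewrite (anti_Z _ dC dD) in Ec.
(* The factor 9/16 is 27^2/(6.216), the ratio of the leading coefficients in star and in [derP]; 9/2
   is 27/6, from the mixed terms. *)
apply: (eq_of_lin3 (s := 9%:R / 16%:R) (t := 9%:R / 2%:R * ga)
  (u := 9%:R / 2%:R * al) P Ea Ec).
rewrite /al /ga !kapE !linearB /= !linearZ /= (antiE (anti A B)) !fE !tr_anti (fC y x).
field; nzs.
Qed.

Lemma lfunL (T : 'End(W)) : linear T. Proof. by move=> c u v; rewrite linearP. Qed.
Hint Resolve lfunL : core.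

(** * The comparison map from S^2 g to S^2 W *)

Definition phi0 : 'Hom(sym2 g, sym2 W) :=
  linfun (sym2_lift (fun X Y => sym2_of (kap (anti (rho X) (rho Y))))).

Lemma phi0_sprod X Y : phi0 (sprod X Y) = sym2_of (kap (anti (rho X) (rho Y))).
Proof.
rewrite lfunE /= sym2_lift_sprod // => [A B|B c A A']; first by rewrite antiC.
by rewrite rho_lin anti_linear kap_linear sym2_of_linear.
Qed.

Lemma op_phi0 X Y : op (phi0 (sprod X Y)) = kap (anti (rho X) (rho Y)).
Proof.
by rewrite phi0_sprod sym2_ofK //; apply/kap_sym/anti_sym; apply: rho_der.
Qed.

Lemma mu_phi0 u : sym2_lift m (phi0 u) = 0.
Proof.
move: u; apply: (@eq_sym2_linear k g W (fun u => _) (fun u => _)) => [c u v|c u v|X Y].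
- by rewrite linearP linearP.
- by rewrite scaler0 addr0.
apply: f_inj => z; rewrite f_mu op_phi0 f0l.
rewrite (eq_trf (fun w => kapE _ (m z w))) trfD trfN !trfZ anti_Z //.
by rewrite [trf (fun w => m z w)](trL z) !mulr0 subr0.
Qed.

Lemma rhoD X Y : rho (X + Y) = rho X + rho Y.
Proof. by have := rho_lin 1 X Y; rewrite !scale1r. Qed.
Lemma rhoZ c X : rho (c *: X) = c *: rho X.
Proof.
have := rho_lin c X 0; rewrite addr0 => ->.
have := rho_lin (-1) 0 0; rewrite scaler0 addr0 scaleN1r addNr => ->.
by rewrite addr0.
Qed.

Lemma rho_lbr X Y : rho (br X Y) = lbr (rho X) (rho Y).
Proof. by apply/lfunP => w; rewrite rho_br lbrE. Qed.

Lemma rho_ldbr C D B :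
  rho (lfun_bullet (ad br C) (ad br D) B) = 2%:R^-1 *: ldbr (rho C) (rho D) (rho B).
Proof. by rewrite lfun_bulletE rhoZ rhoD !adE !rho_lbr. Qed.

Lemma antiZr c X Y : anti X (c *: Y) = c *: anti X Y.
Proof.
rewrite antiC; have := anti_linear X c Y 0; rewrite addr0 => ->.
rewrite (_ : anti 0 X = 0) ?addr0 1?antiC //.
by apply/lfunP => w; rewrite antiE !zero_lfunE linear0 addr0.
Qed.
Lemma antiZl c X Y : anti (c *: X) Y = c *: anti X Y.
Proof. by rewrite antiC antiZr antiC. Qed.

(** This is the formula of [is_diamond] with [phi0] in place of S and star in place of diamond. The
    coefficient 9/2 is h/2, and 3 tau is the Killing form. *)
Lemma star_phi0 A B C D : star (phi0 (sprod A B)) (phi0 (sprod C D)) =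
  (9%:R / 2%:R) *:
    (phi0 (sprod A (lfun_bullet (ad br C) (ad br D) B))
     + phi0 (sprod (lfun_bullet (ad br C) (ad br D) A) B)
     + phi0 (sprod C (lfun_bullet (ad br A) (ad br B) D))
     + phi0 (sprod (lfun_bullet (ad br A) (ad br B) C) D)
     + phi0 (sprod (br A C) (br B D)) + phi0 (sprod (br A D) (br B C)))
  + 4%:R^-1 *:
    (killing br A C *: phi0 (sprod B D) + killing br A D *: phi0 (sprod B C)
     + killing br B C *: phi0 (sprod A D) + killing br B D *: phi0 (sprod A C)).
Proof.
apply: (can_inj sym2_opK); apply/lfunP => x; apply: f_inj => y.
rewrite (star_kap x y _ _ _ _ (op_phi0 A B) (op_phi0 C D)) //.
rewrite !(opD, opZ) !op_phi0 !rho_ldbr !rho_lbr !antiZl !antiZr !killing_trf.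
rewrite -!/(tau _ _) /six.
set a1 := anti (rho A) _; set a2 := anti _ (rho B); set a3 := anti (rho C) _.
set a4 := anti _ (rho D); set a5 := anti (lbr _ _) _; set a6 := anti (lbr _ _) _.
have kD X Y : kap (X + Y) = kap X + kap Y.
  by have := kap_linear 1 X Y; rewrite !scale1r.
have k0 : kap 0 = 0.
  by have := kap_linear (-1) 0 0; rewrite scaler0 addr0 scaleN1r addNr.
have kZ c X : kap (c *: X) = c *: kap X.
  by have := kap_linear c X 0; rewrite k0 !addr0.
rewrite !(kD, kZ) !(add_lfunE, scale_lfunE) !fE; field; nzs.
Qed.

Lemma tauC X Y : tau X Y = tau Y X.
Proof. exact: trfC. Qed.

Lemma trf_rot (A B C D : 'End(W)) :
  trf (fun w => A (B (C (D w)))) = trf (fun w => B (C (D (A w)))).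
Proof.
by rewrite (trfC (F := A) (G := fun w => B (C (D w)))) // => c u v; rewrite !linearP.
Qed.

Lemma trf_anti2 (A B C D : 'End(W)) : tau (anti A B) (anti C D) =
  trf (fun w => A (B (C (D w)))) + trf (fun w => A (B (D (C w)))) +
  (trf (fun w => B (A (C (D w)))) + trf (fun w => B (A (D (C w))))).
Proof.
by rewrite -!trfD; apply: eq_trf => w; rewrite !antiE !linearD.
Qed.

Lemma trf_ldbr (A B C D : 'End(W)) : trf (fun w => ldbr A B C (D w)) =
  tau (anti A B) (anti C D)
  - 2%:R * (trf (fun w => A (C (B (D w)))) + trf (fun w => B (C (A (D w))))).
Proof.
rewrite (eq_trf (G := fun w => A (B (C (D w))) - A (C (B (D w))) - B (C (A (D w)))
    + C (B (A (D w))) + (B (A (C (D w))) - B (C (A (D w))) - A (C (B (D w)))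
    + C (A (B (D w)))))); last first.
  move=> w; rewrite add_lfunE !lbrE !linearB /=.
  by apply: f_inj => z; rewrite !fE; ring.
by rewrite trf_anti2 !(trfD, trfN) (trf_rot C B) (trf_rot C A); ring.
Qed.

Lemma tr_anti_quartic (A B C D : 'End(W)) : deriv A -> deriv B -> deriv C -> deriv D ->
  trf (fun w => A (C (B (D w)))) + trf (fun w => B (C (A (D w)))) =
  6%:R^-1 * (tau A B * tau C D + tau A C * tau B D + tau A D * tau B C)
  - tau (anti A B) (anti C D).
Proof.
move=> dA dB dC dD; have Q1 := derQ dA dB dC dD; have Q2 := derQ dB dA dC dD.
apply: (eq_of_lin3 (s := 1) (t := 1) (u := 0) Q1 Q2 (erefl 0)).
rewrite trf_anti2 (tauC B A); field; nzs.
Qed.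

Lemma tau_kap T T' : tau (kap T) (kap T') =
  729%:R * tau T T' - 207%:R / 8%:R * trf T * trf T'.
Proof.
pose t := 3%:R / 4%:R * trf T; pose t' := 3%:R / 4%:R * trf T'.
have -> : tau (kap T) (kap T') = 729%:R * tau T T' - 27%:R * t' * trf T
   - 27%:R * t * trf T' + t * t' * trf id.
  rewrite -!trfZ -!trfN -!trfD; apply: eq_trf => w.
  by rewrite !kapE linearB !linearZ /= -/t -/t'; apply: f_inj => z; rewrite !fE; ring.
by rewrite tr1 /t /t'; field; nzs.
Qed.

(** Expanding K(S(XY)Z,Z') produces traces of words of length four in derivations, and [derQ]
    expresses the non-symmetrised ones through the symmetrised ones that occur in [kap]. *)
Lemma killing_S u Z Z' : killing br (cg_S br 9%:R u Z) Z' =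
  18%:R^-1 * tau (op (phi0 u)) (kap (anti (rho Z) (rho Z')))
  + 180%:R^-1 * (trf (op (phi0 u)) * trf (kap (anti (rho Z) (rho Z')))).
Proof.
move: u; apply: (@eq_sym2_linear k g k^o (fun u => _) (fun u => _)) => [c u v|c u v|X Y].
- by rewrite linearP lfun_linE killing_scalarl.
- have h : tau (op (phi0 (c *: u + v))) (kap (anti (rho Z) (rho Z'))) =
     c * tau (op (phi0 u)) (kap (anti (rho Z) (rho Z')))
     + tau (op (phi0 v)) (kap (anti (rho Z) (rho Z'))).
    by rewrite -trfZ -trfD; apply: eq_trf => w; rewrite linearP opP.
  by rewrite h linearP trf_op_linear /GRing.scale /=; ring.
rewrite op_phi0 tau_kap !trf_kap !tr_anti cg_S_sprod.
rewrite killing_trf !(rhoD, rhoZ) rho_ldbr !killing_trf -!/(tau _ _).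
have tauP c P Q R : tau (c *: P + Q) R = c * tau P R + tau Q R.
  by rewrite -trfZ -trfD; apply: eq_trf => w; rewrite lfun_linE.
have tauZ c P R : tau (c *: P) R = c * tau P R.
  by rewrite -trfZ; apply: eq_trf => w; rewrite scale_lfunE.
rewrite !(tauP, tauZ) /(tau (ldbr _ _ _)) trf_ldbr tr_anti_quartic //.
by field; nzs.
Qed.

(** Nondegeneracy of the Killing form: pairing with [delta a b] already detects X, by
    [deriv_eq0]. *)
Lemma killing_eq0 X : (forall Z, killing br X Z = 0) -> X = 0.
Proof.
move=> h; apply: rho_inj.
have -> : rho 0 = 0 by rewrite -[0]/(0 : g) -(scale0r 0) rhoZ scale0r.
apply: deriv_eq0 => // a b.
have := h (delta a b); rewrite killing_trf => /eqP.
have n3 : 3%:R != 0 :> k by apply: nz.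
rewrite mulf_eq0 (negPf n3) /= => /eqP; rewrite trfC // => <-.
by apply: eq_trf => w; rewrite rho_delta dopE.
Qed.

(** * The image of [phi0] is A and its kernel is that of S *)

Definition albert_alg : {vspace sym2 W} := lker (linfun (sym2_lift m)).

Lemma mem_albert u : (u \in albert_alg) = (sym2_lift m u == 0).
Proof. by rewrite memv_ker lfunE. Qed.

Lemma phi0_albert u : phi0 u \in albert_alg.
Proof. by rewrite mem_albert mu_phi0. Qed.

Lemma phi0_delta a c x :
  \sum_i f (op (phi0 (sprod (delta a (bvec i)) (delta c (dvec i)))) x) x =
  - (189%:R / 2%:R) * (f a x * f c x) - 27%:R / 4%:R * (f a c * f x x)
  + 81%:R / 2%:R * f (m a c) (m x x).
Proof.
have E i : f (op (phi0 (sprod (delta a (bvec i)) (delta c (dvec i)))) x) x =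
    54%:R * f (dfun c (dvec i) (dfun a (bvec i) x)) x
    + 9%:R / 2%:R * f x x * f a (dfun c (dvec i) (bvec i)).
  rewrite op_phi0 kapE !rho_delta antiE !dopE fDl fNl !fZl fDl tr_anti.
  rewrite (_ : f (dfun a _ _) x = f (dfun c (dvec i) (dfun a (bvec i) x)) x); last first.
    by rewrite dfun_skew dfun_skew opprK fC.
  rewrite [tau _ _](_ : _ = 3%:R * f (dop c (dvec i) a) (bvec i)); last first.
    rewrite -(tr_dfun a (bvec i) (dfun_deriv c (dvec i))).
    by apply: eq_trf => w; rewrite dopE.
  rewrite dopE (dfun_skew c (dvec i) a); field; nzs.
rewrite (eq_bigr _ (fun i _ => E i)) big_split /= -!mulr_sumr dfun2_contract.
by rewrite -f_sumr dfun_contract fZr; field; nzs.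
Qed.

(** Contraction of products of inner derivations with u, an equivariant candidate for a section of
    [phi0]. *)
Definition delta_lift (u : sym2 W) : sym2 g := \sum_j \sum_i
  sprod (delta (op u (bvec j)) (bvec i)) (delta (dvec j) (dvec i)).

Lemma f_delta_lift u x : f (op (phi0 (delta_lift u)) x) x =
  - (189%:R / 2%:R) * f (op u x) x - 27%:R / 4%:R * (trf (op u) * f x x)
  + 81%:R / 2%:R * f (sym2_lift m u) (m x x).
Proof.
have muE : sym2_lift m u = \sum_j m (op u (bvec j)) (dvec j).
  rewrite -[in LHS](sym2_opK u) linear_sum; apply: eq_bigr => j _.
  by rewrite /= sym2_lift_sprod // => b c v w; rewrite !mE.
have opS (I : finType) (F : I -> sym2 W) y : op (\sum_i F i) y = \sum_i op (F i) y.
  by rewrite linear_sum sum_lfunE.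
rewrite /delta_lift linear_sum opS f_suml.
under eq_bigr => j _ do rewrite linear_sum opS f_suml phi0_delta.
rewrite !big_split /= sumrN -!mulr_sumr muE f_suml -mulr_suml.
congr (_ * _ - _ + _).
rewrite -(dual_contract (op u x) x); apply: eq_bigr => j _.
by rewrite [f (dvec j) x]fC op_sym fC.
Qed.

Lemma op_ext u v : (forall x, f (op u x) x = f (op v x) x) -> u = v.
Proof.
move=> h; apply: (can_inj sym2_opK); apply/lfunP => x; apply: f_inj => y.
have := h (x + y); rewrite !linearD /= !fE !h.
rewrite [f (op u y) x]op_sym [f (op v y) x]op_sym ![f y _]fC => E.
have {}E : 2%:R * f (op u x) y = 2%:R * f (op v x) y.
  apply: (eq_of_lin3 (s := 1) (t := 0) (u := 0) E (erefl 0) (erefl 0)); ring.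
by apply: (mulfI (nz (n := 2) isT isT)) E.
Qed.

(** In [f_delta_lift] the only term that is neither a multiple of u nor a scalar operator contains
    the sum of the X_i*Y_i, which vanishes on A. *)
Lemma phi0_delta_lift u : u \in albert_alg ->
  phi0 (delta_lift u) = - (189%:R / 2%:R) *: u - (27%:R / 4%:R * trf (op u)) *: sid.
Proof.
rewrite mem_albert => /eqP mu0; apply: op_ext => x.
rewrite f_delta_lift mu0 f0l !(opD, opZ, opN) op_sid !fE; ring.
Qed.

Lemma sid_albert : sid \in albert_alg.
Proof.
rewrite mem_albert; apply/eqP/f_inj => z; rewrite f_mu f0l.
rewrite (eq_trf (fun w => op_sid (m z w))); exact: trL.
Qed.

Lemma phi0_sid : phi0 (- 270%:R^-1 *: delta_lift sid) = sid.
Proof.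
rewrite linearZ /= phi0_delta_lift ?sid_albert //.
(* At the identity the two coefficients combine: 189/2 + (27/4).26 = 270. *)
rewrite (eq_trf op_sid) -[trf (fun w => w)]/(trf id) tr1 -scalerBl scalerA.
rewrite [X in X *: _](_ : _ = 1) ?scale1r //; field; nzs.
Qed.

Lemma phi0_onto u : u \in albert_alg -> exists v, phi0 v = u.
Proof.
move=> uA; exists (- (2%:R / 189%:R) *: (delta_lift u +
  (27%:R / 4%:R * trf (op u)) *: (- 270%:R^-1 *: delta_lift sid))).
rewrite linearZ linearD /= phi0_delta_lift // [phi0 (_ *: (_ *: _))]linearZ /= phi0_sid subrK scalerA.
rewrite [X in X *: _](_ : _ = 1) ?scale1r //; field; nzs.
Qed.

Definition Lop z : 'End(W) := linfun (m z).
Lemma LopE z w : Lop z w = m z w.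
Proof. exact: linfunP. Qed.

Lemma mu_Lop z : sym2_lift m (sym2_of (Lop z)) = (7%:R / 3%:R) *: z.
Proof.
apply: f_inj => y; rewrite f_mu sym2_ofK => [|u v]; last by rewrite !LopE fM.
by rewrite (eq_trf (fun w => LopE z (m y w))) trLL fZl.
Qed.

Lemma tau_op_linear (T : 'End(W)) c u v :
  tau T (op (c *: u + v)) = c * tau T (op u) + tau T (op v).
Proof. by rewrite -trfZ -trfD; apply: eq_trf => w; rewrite opP linearP. Qed.

(** The trace form is nondegenerate on symmetric operators, A is orthogonal to all L_z, and by
    [mu_Lop] every operator can be moved into A by subtracting some L_z. *)
Lemma albert_perp u : u \in albert_alg ->
  (forall v, v \in albert_alg -> tau (op u) (op v) = 0) -> u = 0.
Proof.
move=> uA h; have h0 a b : f (op u a) b = 0.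
  (* Since the product map sends L_z to (7/3)z, this correction of ab by L_(a*b) lies in A. *)
  pose t := - (3%:R / 7%:R) *: sym2_of (Lop (m a b)) + sprod a b.
  have /h : t \in albert_alg.
    rewrite mem_albert linearP /= mu_Lop sym2_lift_sprod // => [|b' c v w]; last first.
      by rewrite !mE.
    apply/eqP; rewrite scalerA [X in X *: _](_ : _ = - 1); last by field; nzs.
    by rewrite scaleN1r addNr.
  have -> : tau (op u) (op t) = tau (op u) (op (sprod a b)).
    rewrite tau_op_linear sym2_ofK => [|v w]; last by rewrite !LopE fM.
    rewrite [tau _ (Lop _)](_ : _ = 0) ?mulr0 ?add0r //.
    rewrite /tau (eq_trf (fun w => congr1 (op u) (LopE (m a b) w))) -f_mu.
    by move: uA; rewrite mem_albert => /eqP ->; rewrite f0l.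
  rewrite tauC /tau trf_op // [f b _]fC -(op_sym u a b).
  have n2 : 2%:R != 0 :> k by apply: nz.
  by rewrite -mulr2n -[f _ _ *+ 2]mulr_natl mulrA mulVf // mul1r.
apply: (can_inj sym2_opK); apply/lfunP => a; rewrite linear0 zero_lfunE.
by apply: f_inj => b; rewrite h0 f0l.
Qed.

(** If [phi0 u] = 0, then [killing_S] and [killing_eq0] give S(u) = 0. Conversely S(u) = 0 makes a
    modified trace form vanish between [phi0 u] and all of A, and this form is nondegenerate. *)
Lemma ker_phi0 u : (cg_S br 9%:R u == 0) = (phi0 u == 0).
Proof.
apply/eqP/eqP => [S0|p0]; last first.
  apply/lfunP => Z; rewrite zero_lfunE; apply: killing_eq0 => Z'.
  have op0 w : op (phi0 u) w = 0 by rewrite p0 linear0 zero_lfunE.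
  rewrite killing_S.
  have z0 (F : W -> W) : (forall w, F w = 0) -> trf F = 0.
    by move=> F0; rewrite /trf big1 // => i _; rewrite F0 f0l.
  rewrite (z0 _ op0) mul0r mulr0 addr0 /tau z0 ?mulr0 // => w; exact: op0.
have h v : 18%:R^-1 * tau (op (phi0 u)) (op (phi0 v))
    + 180%:R^-1 * (trf (op (phi0 u)) * trf (op (phi0 v))) = 0.
  move: v; apply: (@eq_sym2_linear k g k^o (fun v => _) (fun v => 0)) => [c v w|c v w|X Y].
  - by rewrite linearP tau_op_linear trf_op_linear /GRing.scale /=; ring.
  - by rewrite scaler0 addr0.
  rewrite op_phi0 -killing_S S0 zero_lfunE killing_trf.
  by rewrite -[0]/(0 : g) -(scale0r 0) rhoZ scale0r /trf big1 ?mulr0 // => i _;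
    rewrite zero_lfunE f0l.
have {}h t : t \in albert_alg -> 18%:R^-1 * tau (op (phi0 u)) (op t)
    + 180%:R^-1 * (trf (op (phi0 u)) * trf (op t)) = 0.
  by case/phi0_onto => v <-.
(* Testing against the identity gives (1/18 + 26/180) tr = tr/5, so the trace vanishes and only the
   trace form of [albert_perp] remains. *)
have tr0 : trf (op (phi0 u)) = 0.
  have := h _ sid_albert; rewrite (eq_trf op_sid) -[trf (fun w => w)]/(trf id) tr1.
  rewrite [tau _ _](eq_trf (fun w => congr1 (op (phi0 u)) (op_sid w))) => E.
  have := congr1 (fun z => 5%:R * z) E; rewrite mulr0 => <-.
  rewrite [trf (fun x => _)](_ : _ = trf (op (phi0 u))) //; field; nzs.
apply: albert_perp (phi0_albert u) _ => v /h.
rewrite tr0 mul0r mulr0 addr0 => /eqP; rewrite mulf_eq0 invr_eq0.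
have n18 : 18%:R != 0 :> k by apply: nz.
by rewrite (negPf n18) => /eqP.
Qed.

Lemma mu_star_phi0 u v : sym2_lift m (star (phi0 u) (phi0 v)) = 0.
Proof.
have z0 : linear (fun _ : sym2 g => 0 : W) by move=> c x y; rewrite scaler0 addr0.
move: u; apply: (@eq_sym2_linear k g W (fun u => _) (fun u => _)) => // [c x y|A B].
  by rewrite linearP star_l linearP.
move: v; apply: (@eq_sym2_linear k g W (fun v => _) (fun v => _)) => // [c x y|C D].
  by rewrite linearP star_r linearP.
rewrite star_phi0 !(linearD, linearZ) /= !mu_phi0.
by rewrite !(scaler0, addr0).
Qed.

(** A is the image of [phi0], and by [star_phi0] star of two images is a combination of images. *)
Lemma star_albert u v : u \in albert_alg -> v \in albert_alg ->
  star u v \in albert_alg.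
Proof.
by move=> /phi0_onto[u' <-] /phi0_onto[v' <-]; rewrite mem_albert mu_star_phi0.
Qed.

Lemma starC u v : star u v = star v u.
Proof.
apply: op_ext => x; rewrite !star_form.
rewrite (trfC (F := fun w => op u (m x w)) (G := fun w => op v (m x w)));
  try exact: lfun_m_linear.
ring.
Qed.

(** * The isomorphism of A(g) with A, and the product transported along it *)

Local Notation S := (cg_S br 9%:R).
Local Notation A := (cg_alg br 9%:R).

(** The map induced by [phi0] on the image of S. The chosen preimage does not matter, because the
    kernels agree ([psi_proj]). *)
Definition psi (x : subvs_of A) : sym2 W := phi0 ((S^-1)%VF (vsval x)).

Lemma psi_linear : linear psi.
Proof. by move=> c x y; rewrite /psi !linearP. Qed.

Lemma psi_proj u : psi (cg_proj br 9%:R u) = phi0 u.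
Proof.
rewrite /psi vsprojK ?memv_img ?memvf //.
apply/eqP; rewrite -subr_eq0 -linearB -ker_phi0 linearB /= subr_eq0.
by rewrite limg_lfunVK // memv_img ?memvf.
Qed.

Lemma psi_inj : injective psi.
Proof.
move=> x y; have [u ->] := cg_alg_span x; have [v ->] := cg_alg_span y.
rewrite !psi_proj => /eqP; rewrite -subr_eq0 -linearB -ker_phi0 linearB /= subr_eq0.
by move/eqP; rewrite /cg_proj => ->.
Qed.

Lemma psi_albert x : psi x \in albert_alg.
Proof. exact: phi0_albert. Qed.

Definition psi_inv (u : sym2 W) : subvs_of A := cg_proj br 9%:R ((phi0^-1)%VF u).

Lemma psi_invK u : u \in albert_alg -> psi (psi_inv u) = u.
Proof.
by case/phi0_onto => v <-; rewrite psi_proj limg_lfunVK // memv_img ?memvf.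
Qed.

Lemma psi_inv_linear : linear psi_inv.
Proof. by move=> c u v; rewrite /psi_inv /cg_proj !linearP. Qed.

(** Transporting star yields a bilinear product at once; [diamond_cg] then shows that the prescribed
    formula holds, which also settles its well-definedness. *)
Definition diamond x y := psi_inv (star (psi x) (psi y)).

Lemma psi_diamond x y : psi (diamond x y) = star (psi x) (psi y).
Proof. by rewrite psi_invK // star_albert ?psi_albert. Qed.

Lemma diamond_bilinear : bilinear_for *:%R *:%R diamond.
Proof.
split=> [y|x] c u v; rewrite /diamond psi_linear.
  by rewrite star_l psi_inv_linear.
by rewrite star_r psi_inv_linear.
Qed.

HB.instance Definition _ := bilinear_isBilinear.Build k (subvs_of A) (subvs_of A)
  (subvs_of A) *:%R *:%R diamond diamond_bilinear.

Lemma diamond_cg : is_diamond (h := 9%:R) (diamond : {bilinear _ -> _ -> _}).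
Proof.
move=> B C D E; apply: psi_inj; rewrite psi_diamond !psi_proj star_phi0.
pose P : {linear subvs_of A -> sym2 W} :=
  HB.pack psi (GRing.isLinear.Build k _ _ _ psi psi_linear).
rewrite -[RHS]/(P _); set l := LHS.
by rewrite !(linearD, linearZ) /= !psi_proj.
Qed.

Definition isom x : subvs_of albert_alg := vsproj albert_alg (psi x).

Lemma isom_linear : linear isom.
Proof. by move=> c x y; rewrite /isom psi_linear linearP. Qed.
HB.instance Definition _ :=
  GRing.isLinear.Build k (subvs_of A) (subvs_of albert_alg) _ isom isom_linear.

Lemma isomE x : vsval (isom x) = psi x.
Proof. by rewrite vsprojK ?psi_albert. Qed.

Lemma isom_bij : bijective isom.
Proof.
exists (fun u => psi_inv (vsval u)) => [x|u].
  by apply: psi_inj; rewrite isomE psi_invK ?psi_albert.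
by apply: val_inj; rewrite /= isomE psi_invK // subvsP.
Qed.

Theorem chayet_garibaldi_albert :
  (forall u v, u \in albert_alg -> v \in albert_alg -> star u v \in albert_alg) /\
  exists dia : {bilinear subvs_of A -> subvs_of A -> subvs_of A},
    [/\ is_diamond dia, forall x y, dia x y = dia y x
      & exists phi : {linear subvs_of A -> subvs_of albert_alg},
          bijective phi /\
          forall x y, vsval (phi (dia x y)) = star (vsval (phi x)) (vsval (phi y))].
Proof.
split; first exact: star_albert.
exists (diamond : {bilinear _ -> _ -> _}); split.
- exact: diamond_cg.
- by move=> x y; rewrite /= /diamond starC.
exists (isom : {linear _ -> _}); split=> [|x y]; first exact: isom_bij.
by rewrite /= !isomE psi_diamond.
Qed.

End Lie.
End Sym2Op.
End Springer.

(** * Sparse integer matrices that compute, and their meaning over a field *)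

Definition srow := seq (nat * Z).
Definition smat := seq srow.

(** Entries listed several times for one column add up, so that rows are added by concatenation;
    [snorm] merges them. *)
Definition coef (r : srow) (j : nat) : Z :=
  foldr (fun e s => if e.1 == j then Z.add e.2 s else s) Z0 r.

Definition rowscale (c : Z) (r : srow) : srow :=
  [seq (e.1, Z.mul c e.2) | e <- r].

Definition srw (A : smat) i : srow := nth [::] A i.

Definition rowmul (r : srow) (B : smat) : srow :=
  flatten [seq rowscale e.2 (srw B e.1) | e <- r].

(** Cutting B to 26 rows makes column indices beyond 25 in A contribute nothing, in agreement with
    the 26 x 26 semantics. *)
Definition smul (A B : smat) : smat :=
  let B := take 26 B in [seq rowmul r B | r <- A].
Definition sscale c (A : smat) : smat := [seq rowscale c r | r <- A].
Definition sadd (A B : smat) : smat := [seq srw A i ++ srw B i | i <- iota 0 26].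
Definition sone : smat := [seq [:: (i, 1%bZ)] | i <- iota 0 26].
Definition sdelta i j : smat :=
  [seq if l == i then [:: (j, 1%bZ)] else [::] | l <- iota 0 26].
Definition strace (A : smat) : Z :=
  foldr (fun i s => Z.add (coef (srw A i) i) s) Z0 (iota 0 26).
Definition szero (A : smat) : bool :=
  all (fun r => all (fun e : nat * Z => Z.eqb (coef r e.1) 0) r) A.

Lemma coef_notin r j : j \notin [seq e.1 | e <- r] -> coef r j = Z0.
Proof.
elim: r => [//|e r IH] /=; rewrite inE negb_or eq_sym => /andP[/negPf -> h].
exact: IH.
Qed.

Definition srow_of (F : nat -> Z) (s : seq nat) : srow :=
  [seq e <- [seq (i, F i) | i <- s] | ~~ Z.eqb e.2 0].

Lemma coef_srow_of F s j : uniq s ->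
  coef (srow_of F s) j = if j \in s then F j else Z0.
Proof.
rewrite /srow_of; elim: s => [//|i s IH] /= /andP[i_s us]; rewrite inE eq_sym.
have [ij|ij] := eqVneq i j; first subst j; case: (boolP (Z.eqb (F i) 0)) => Fi /=.
- by rewrite IH // (negPf i_s); move/Z.eqb_eq: Fi => ->.
- by rewrite eqxx IH // (negPf i_s) Z.add_0_r.
- by rewrite IH.
- by rewrite (negPf ij) IH.
Qed.

Definition str (A : smat) : smat :=
  [seq srow_of (fun i => coef (srw A i) j) (iota 0 26) | j <- iota 0 26].

Definition snorm (A : smat) : smat :=
  [seq srow_of (coef r) (undup [seq e.1 | e <- r]) | r <- A].

Section Sem.
Variable L : fieldType.

Definition zL (z : Z) : L := (int_of_Z z)%:~R.

Lemma zLD a b : zL (Z.add a b) = zL a + zL b.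
Proof. by rewrite /zL -[Z.add a b]/(a + b) !rmorphD. Qed.
Lemma zLM a b : zL (Z.mul a b) = zL a * zL b.
Proof. by rewrite /zL -[Z.mul a b]/(a * b) !rmorphM. Qed.
Lemma zL0 : zL Z0 = 0. Proof. by []. Qed.
Lemma zL1 : zL 1%bZ = 1. Proof. by []. Qed.
Lemma zLn n : zL (Z.of_nat n) = n%:R.
Proof.
elim: n => [//|n IH].
by rewrite Nat2Z.inj_succ -Z.add_1_l zLD IH zL1 -natr1 addrC.
Qed.
Lemma zLN a : zL (Z.opp a) = - zL a.
Proof. by rewrite /zL -[Z.opp a]/(- a) !rmorphN. Qed.

Lemma coef_cat r s j : zL (coef (r ++ s) j) = zL (coef r j) + zL (coef s j).
Proof.
elim: r => [|e r IH] /=; first by rewrite zL0 add0r.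
by case: eqP => // _; rewrite !zLD IH addrA.
Qed.

Lemma coef_scale c r j : zL (coef (rowscale c r) j) = zL c * zL (coef r j).
Proof.
elim: r => [|e r IH] /=; first by rewrite zL0 mulr0.
by case: eqP => // _; rewrite !zLD IH zLM mulrDr.
Qed.

Definition mx (A : smat) : 'M[L]_26 := \matrix_(i, j) zL (coef (srw A i) j).
Definition rv (r : srow) : 'rV[L]_26 := \row_j zL (coef r j).

Lemma row_mx A (i : 'I_26) : row i (mx A) = rv (srw A i).
Proof. by apply/rowP => j; rewrite !mxE. Qed.

Lemma eq_mx_rv A B : (forall i : 'I_26, rv (srw A i) = rv (srw B i)) ->
  mx A = mx B.
Proof. by move=> h; apply/row_matrixP => i; rewrite !row_mx. Qed.

Lemma rv_cat r s : rv (r ++ s) = rv r + rv s.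
Proof. by apply/rowP => j; rewrite !mxE coef_cat. Qed.
Lemma rv_scale c r : rv (rowscale c r) = zL c *: rv r.
Proof. by apply/rowP => j; rewrite !mxE coef_scale. Qed.
Lemma rv_nil : rv [::] = 0.
Proof. by apply/rowP => j; rewrite !mxE. Qed.

Lemma rv_rowmul r B : (size B <= 26)%N -> rv (rowmul r B) = rv r *m mx B.
Proof.
move=> sB; elim: r => [|e r IH]; first by rewrite rv_nil mul0mx.
rewrite /rowmul /= -/(rowmul r B) rv_cat {}IH rv_scale.
have -> : rv (e :: r) = rv [:: e] + rv r by rewrite -rv_cat.
rewrite mulmxDl; congr (_ + _).
case: (ltnP e.1 26) => [e26|e26].
  have -> : rv [:: e] = zL e.2 *: delta_mx 0 (Ordinal e26).
    apply/rowP => j; rewrite !mxE /= -val_eqE /= [j == _ :> nat]eq_sym.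
    by case: eqP; rewrite ?mulr1 ?mulr0 // zLD addr0.
  by rewrite -scalemxAl -rowE row_mx.
have -> : rv [:: e] = 0.
  apply/rowP => j; rewrite !mxE /=; case: eqP => // E.
  by have := ltn_ord j; rewrite -E ltnNge e26.
by rewrite mul0mx /srw nth_default ?rv_nil ?scaler0 // (leq_trans sB).
Qed.

Lemma srw_take A (i : 'I_26) : srw (take 26 A) i = srw A i.
Proof. by rewrite /srw nth_take. Qed.

Lemma mx_take A : mx (take 26 A) = mx A.
Proof. by apply: eq_mx_rv => i; rewrite srw_take. Qed.

Lemma srw_smul A B i : srw (smul A B) i = rowmul (srw A i) (take 26 B).
Proof.
rewrite /srw /smul; case: (ltnP i (size A)) => h; first by rewrite (nth_map [::]).
by rewrite !nth_default ?size_map.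
Qed.

Lemma rv_rowmul_take r B : rv (rowmul r (take 26 B)) = rv r *m mx B.
Proof.
by rewrite rv_rowmul ?mx_take // size_take; case: ltnP.
Qed.

Lemma mx_smul A B : mx (smul A B) = mx A *m mx B.
Proof.
apply/row_matrixP => i.
by rewrite row_mx srw_smul rv_rowmul_take row_mul row_mx.
Qed.

Lemma mx_sscale c A : mx (sscale c A) = zL c *: mx A.
Proof.
apply/row_matrixP => i; rewrite linearZ /= !row_mx -rv_scale; congr rv.
rewrite /srw /sscale; case: (ltnP i (size A)) => h.
  by rewrite (nth_map [::]).
by rewrite !nth_default ?size_map.
Qed.

Lemma srw_iota (F : nat -> srow) (i : 'I_26) :
  srw [seq F j | j <- iota 0 26] i = F i.
Proof. by rewrite /srw (nth_map 0%N) ?size_iota // nth_iota. Qed.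

Lemma mx_sadd A B : mx (sadd A B) = mx A + mx B.
Proof.
apply/row_matrixP => i; rewrite linearD /= !row_mx -rv_cat; congr rv.
exact: srw_iota.
Qed.

Lemma mx_sone : mx sone = 1%:M.
Proof.
apply/matrixP => i j; rewrite !mxE /sone srw_iota /= -val_eqE /=.
by case: eqP => // _; rewrite zLD addr0.
Qed.

Lemma mx_sdelta (i j : 'I_26) : mx (sdelta i j) = delta_mx i j.
Proof.
apply/matrixP => a b; rewrite !mxE /sdelta srw_iota -!val_eqE /=.
case: eqP => [_|] //=; rewrite [b == j :> nat]eq_sym.
by case: eqP => // _; rewrite zLD addr0.
Qed.

Lemma strace_mx A : zL (strace A) = \tr (mx A).
Proof.
rewrite /strace /mxtrace.
have -> : \sum_i mx A i i = \sum_(i < 26) zL (coef (srw A i) i).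
  by apply: eq_bigr => i _; rewrite mxE.
rewrite -(big_mkord xpredT (fun i => zL (coef (srw A i) i))) /index_iota subn0.
elim: (iota 0 26) => [|i s IH] /=; first by rewrite big_nil.
by rewrite zLD IH big_cons.
Qed.

Lemma mx_str A : mx (str A) = (mx A)^T.
Proof.
apply/matrixP => i j; rewrite !mxE /str srw_iota coef_srow_of ?iota_uniq //.
by rewrite mem_iota ltn_ord.
Qed.

Lemma mx_snorm A : mx (snorm A) = mx A.
Proof.
apply: eq_mx_rv => i; apply/rowP => j; rewrite !mxE; congr zL.
rewrite {1}/srw /snorm; case: (ltnP i (size A)) => h; last first.
  by rewrite /srw !nth_default ?size_map.
rewrite (nth_map [::]) // coef_srow_of ?undup_uniq // mem_undup.
by case: ifP => // /negbT/coef_notin.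
Qed.

Definition sopp (A : smat) : smat := sscale (-1)%bZ A.
Definition ssub (A B : smat) : smat := sadd A (sopp B).
Definition eq_smat (A B : smat) : bool := szero (ssub A B).

Lemma mx_sopp A : mx (sopp A) = - mx A.
Proof. by rewrite mx_sscale -[Zneg 1]/(Z.opp 1%bZ) zLN zL1 scaleN1r. Qed.
Lemma mx_ssub A B : mx (ssub A B) = mx A - mx B.
Proof. by rewrite mx_sadd mx_sopp. Qed.

Lemma szero_mx A : szero A -> mx A = 0.
Proof.
move=> /allP h; apply/matrixP => i j; rewrite !mxE.
case: (ltnP i (size A)) => [iA|iA]; last by rewrite /srw nth_default.
have /allP hr := h _ (mem_nth [::] iA).
case: (boolP ((j : nat) \in [seq e.1 | e <- srw A i])) => [/mapP[e er ->]|hn].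
  by have /Z.eqb_eq -> := hr _ er.
by rewrite coef_notin.
Qed.

Lemma eq_smat_mx A B : eq_smat A B -> mx A = mx B.
Proof. by move/szero_mx; rewrite mx_ssub => /eqP; rewrite subr_eq0 => /eqP. Qed.

Definition scomb (cs : seq Z) (K : seq smat) : smat :=
  foldr sadd [::] [seq sscale p.1 p.2 | p <- zip cs K & ~~ Z.eqb p.1 0].

Lemma mx_nil : mx [::] = 0.
Proof. by apply/matrixP => i j; rewrite !mxE /srw nth_nil. Qed.

Lemma mx_scomb cs K :
  mx (scomb cs K) = \sum_(p <- zip cs K) zL p.1 *: mx p.2.
Proof.
rewrite /scomb; elim: (zip cs K) => [|p s IH] /=.
  by rewrite big_nil mx_nil.
rewrite big_cons -{}IH; case: (boolP (Z.eqb p.1 0)) => [/Z.eqb_eq ->|_] /=.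
  by rewrite zL0 scale0r add0r.
by rewrite mx_sadd mx_sscale.
Qed.

End Sem.

(** * The split model: structure constants, root vectors and certificates *)

Local Notation "i :- c" := (pair i%N c%bZ) (at level 70).

(** Six times the multiplication operators of traceless hermitian 3 x 3 octonion matrices, which
    makes them integral. Coordinates 0 and 1 are the first two diagonal entries; the octonions at
    (0,1), (0,2), (1,2) start at 2, 10 and 18. The meaning is proved in [jordan_herm_fun]. *)
Definition Ms : seq smat :=
  [:: [:: [:: 0 :- 2; 1 :- (-4)]; [:: 0 :- (-2); 1 :- (-2)]; [:: 2 :- 3]; [::
  3 :- 3]; [:: 4 :- 3]; [:: 5 :- 3]; [:: 6 :- 3]; [:: 7 :- 3]; [:: 8 :- 3];
  [:: 9 :- 3]; [::]; [::]; [::]; [::]; [::]; [::]; [::]; [::]; [:: 18 :-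
  (-3)]; [:: 19 :- (-3)]; [:: 20 :- (-3)]; [:: 21 :- (-3)]; [:: 22 :- (-3)];
  [:: 23 :- (-3)]; [:: 24 :- (-3)]; [:: 25 :- (-3)]]; [:: [:: 0 :- (-2); 1 :-
  (-2)]; [:: 0 :- (-4); 1 :- 2]; [:: 2 :- 3]; [:: 3 :- 3]; [:: 4 :- 3]; [:: 5
  :- 3]; [:: 6 :- 3]; [:: 7 :- 3]; [:: 8 :- 3]; [:: 9 :- 3]; [:: 10 :- (-3)];
  [:: 11 :- (-3)]; [:: 12 :- (-3)]; [:: 13 :- (-3)]; [:: 14 :- (-3)]; [:: 15
  :- (-3)]; [:: 16 :- (-3)]; [:: 17 :- (-3)]; [::]; [::]; [::]; [::]; [::];
  [::]; [::]; [::]]; [:: [:: 2 :- 3]; [:: 2 :- 3]; [::]; [::]; [::]; [:: 0 :-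
  1; 1 :- 1]; [::]; [::]; [::]; [::]; [::]; [::]; [:: 20 :- 3]; [:: 21 :- 3];
  [::]; [:: 23 :- 3]; [::]; [:: 25 :- 3]; [:: 10 :- 3]; [:: 11 :- 3]; [::];
  [::]; [:: 14 :- 3]; [::]; [:: 16 :- 3]; [::]]; [:: [:: 3 :- 3]; [:: 3 :- 3];
  [::]; [::]; [:: 0 :- (-1); 1 :- (-1)]; [::]; [::]; [::]; [::]; [::]; [::];
  [::]; [:: 18 :- (-3)]; [:: 19 :- (-3)]; [:: 23 :- (-3)]; [::]; [:: 25 :-
  (-3)]; [::]; [::]; [::]; [:: 10 :- 3]; [:: 11 :- 3]; [:: 15 :- 3]; [::]; [::
  17 :- 3]; [::]]; [:: [:: 4 :- 3]; [:: 4 :- 3]; [::]; [:: 0 :- (-1); 1 :-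
  (-1)]; [::]; [::]; [::]; [::]; [::]; [::]; [:: 20 :- (-3)]; [:: 21 :- (-3)];
  [::]; [::]; [::]; [:: 22 :- (-3)]; [::]; [:: 24 :- (-3)]; [:: 12 :- 3]; [::
  13 :- 3]; [::]; [::]; [::]; [:: 14 :- 3]; [::]; [:: 16 :- 3]]; [:: [:: 5 :-
  3]; [:: 5 :- 3]; [:: 0 :- 1; 1 :- 1]; [::]; [::]; [::]; [::]; [::]; [::];
  [::]; [:: 18 :- 3]; [:: 19 :- 3]; [::]; [::]; [:: 22 :- 3]; [::]; [:: 24 :-
  3]; [::]; [::]; [::]; [:: 12 :- 3]; [:: 13 :- 3]; [::]; [:: 15 :- 3]; [::];
  [:: 17 :- 3]]; [:: [:: 6 :- 3]; [:: 6 :- 3]; [::]; [::]; [::]; [::]; [::];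
  [::]; [::]; [:: 0 :- (-1); 1 :- (-1)]; [::]; [:: 23 :- 3]; [::]; [:: 22 :-
  (-3)]; [::]; [::]; [:: 20 :- 3]; [:: 18 :- (-3)]; [::]; [:: 15 :- (-3)];
  [::]; [:: 14 :- 3]; [::]; [::]; [:: 12 :- (-3)]; [:: 10 :- 3]]; [:: [:: 7 :-
  3]; [:: 7 :- 3]; [::]; [::]; [::]; [::]; [::]; [::]; [:: 0 :- 1; 1 :- 1];
  [::]; [:: 23 :- (-3)]; [::]; [:: 22 :- 3]; [::]; [::]; [::]; [:: 21 :- 3];
  [:: 19 :- (-3)]; [:: 15 :- 3]; [::]; [:: 14 :- (-3)]; [::]; [::]; [::]; [::
  13 :- (-3)]; [:: 11 :- 3]]; [:: [:: 8 :- 3]; [:: 8 :- 3]; [::]; [::]; [::];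
  [::]; [::]; [:: 0 :- 1; 1 :- 1]; [::]; [::]; [::]; [:: 25 :- 3]; [::]; [::
  24 :- (-3)]; [:: 20 :- (-3)]; [:: 18 :- 3]; [::]; [::]; [::]; [:: 17 :-
  (-3)]; [::]; [:: 16 :- 3]; [:: 12 :- 3]; [:: 10 :- (-3)]; [::]; [::]]; [::
  [:: 9 :- 3]; [:: 9 :- 3]; [::]; [::]; [::]; [::]; [:: 0 :- (-1); 1 :- (-1)];
  [::]; [::]; [::]; [:: 25 :- (-3)]; [::]; [:: 24 :- 3]; [::]; [:: 21 :-
  (-3)]; [:: 19 :- 3]; [::]; [::]; [:: 17 :- 3]; [::]; [:: 16 :- (-3)]; [::];
  [:: 13 :- 3]; [:: 11 :- (-3)]; [::]; [::]]; [:: [::]; [:: 10 :- (-3)]; [::];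
  [::]; [:: 20 :- (-3)]; [:: 18 :- 3]; [::]; [:: 23 :- (-3)]; [::]; [:: 25 :-
  (-3)]; [::]; [::]; [::]; [:: 0 :- 1; 1 :- (-2)]; [::]; [::]; [::]; [::];
  [::]; [:: 3 :- (-3)]; [::]; [:: 2 :- 3]; [:: 6 :- (-3)]; [::]; [:: 8 :-
  (-3)]; [::]]; [:: [::]; [:: 11 :- (-3)]; [::]; [::]; [:: 21 :- (-3)]; [:: 19
  :- 3]; [:: 23 :- 3]; [::]; [:: 25 :- 3]; [::]; [::]; [::]; [:: 0 :- (-1); 1
  :- 2]; [::]; [::]; [::]; [::]; [::]; [:: 3 :- 3]; [::]; [:: 2 :- (-3)];
  [::]; [:: 7 :- (-3)]; [::]; [:: 9 :- (-3)]; [::]]; [:: [::]; [:: 12 :-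
  (-3)]; [:: 20 :- 3]; [:: 18 :- (-3)]; [::]; [::]; [::]; [:: 22 :- 3]; [::];
  [:: 24 :- 3]; [::]; [:: 0 :- (-1); 1 :- 2]; [::]; [::]; [::]; [::]; [::];
  [::]; [::]; [:: 5 :- (-3)]; [::]; [:: 4 :- 3]; [::]; [:: 6 :- (-3)]; [::];
  [:: 8 :- (-3)]]; [:: [::]; [:: 13 :- (-3)]; [:: 21 :- 3]; [:: 19 :- (-3)];
  [::]; [::]; [:: 22 :- (-3)]; [::]; [:: 24 :- (-3)]; [::]; [:: 0 :- 1; 1 :-
  (-2)]; [::]; [::]; [::]; [::]; [::]; [::]; [::]; [:: 5 :- 3]; [::]; [:: 4 :-
  (-3)]; [::]; [::]; [:: 7 :- (-3)]; [::]; [:: 9 :- (-3)]]; [:: [::]; [:: 14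
  :- (-3)]; [::]; [:: 23 :- (-3)]; [::]; [:: 22 :- 3]; [::]; [::]; [:: 20 :-
  (-3)]; [:: 21 :- (-3)]; [::]; [::]; [::]; [::]; [::]; [::]; [::]; [:: 0 :-
  (-1); 1 :- 2]; [:: 6 :- 3]; [:: 7 :- 3]; [::]; [::]; [::]; [::]; [:: 4 :-
  3]; [:: 2 :- (-3)]]; [:: [::]; [:: 15 :- (-3)]; [:: 23 :- 3]; [::]; [:: 22
  :- (-3)]; [::]; [::]; [::]; [:: 18 :- 3]; [:: 19 :- 3]; [::]; [::]; [::];
  [::]; [::]; [::]; [:: 0 :- 1; 1 :- (-2)]; [::]; [::]; [::]; [:: 6 :- 3]; [::
  7 :- 3]; [::]; [::]; [:: 5 :- 3]; [:: 3 :- (-3)]]; [:: [::]; [:: 16 :-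
  (-3)]; [::]; [:: 25 :- (-3)]; [::]; [:: 24 :- 3]; [:: 20 :- 3]; [:: 21 :-
  3]; [::]; [::]; [::]; [::]; [::]; [::]; [::]; [:: 0 :- 1; 1 :- (-2)]; [::];
  [::]; [:: 8 :- 3]; [:: 9 :- 3]; [::]; [::]; [:: 4 :- (-3)]; [:: 2 :- 3];
  [::]; [::]]; [:: [::]; [:: 17 :- (-3)]; [:: 25 :- 3]; [::]; [:: 24 :- (-3)];
  [::]; [:: 18 :- (-3)]; [:: 19 :- (-3)]; [::]; [::]; [::]; [::]; [::]; [::];
  [:: 0 :- (-1); 1 :- 2]; [::]; [::]; [::]; [::]; [::]; [:: 8 :- 3]; [:: 9 :-
  3]; [:: 5 :- (-3)]; [:: 3 :- 3]; [::]; [::]]; [:: [:: 18 :- (-3)]; [::]; [::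
  10 :- 3]; [::]; [:: 12 :- 3]; [::]; [::]; [:: 15 :- 3]; [::]; [:: 17 :- 3];
  [::]; [:: 3 :- 3]; [::]; [:: 5 :- 3]; [:: 6 :- 3]; [::]; [:: 8 :- 3]; [::];
  [::]; [::]; [::]; [:: 0 :- (-2); 1 :- 1]; [::]; [::]; [::]; [::]]; [:: [::
  19 :- (-3)]; [::]; [:: 11 :- 3]; [::]; [:: 13 :- 3]; [::]; [:: 15 :- (-3)];
  [::]; [:: 17 :- (-3)]; [::]; [:: 3 :- (-3)]; [::]; [:: 5 :- (-3)]; [::]; [::
  7 :- 3]; [::]; [:: 9 :- 3]; [::]; [::]; [::]; [:: 0 :- 2; 1 :- (-1)]; [::];
  [::]; [::]; [::]; [::]]; [:: [:: 20 :- (-3)]; [::]; [::]; [:: 10 :- 3];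
  [::]; [:: 12 :- 3]; [::]; [:: 14 :- (-3)]; [::]; [:: 16 :- (-3)]; [::]; [::
  2 :- (-3)]; [::]; [:: 4 :- (-3)]; [::]; [:: 6 :- 3]; [::]; [:: 8 :- 3];
  [::]; [:: 0 :- 2; 1 :- (-1)]; [::]; [::]; [::]; [::]; [::]; [::]]; [:: [::
  21 :- (-3)]; [::]; [::]; [:: 11 :- 3]; [::]; [:: 13 :- 3]; [:: 14 :- 3];
  [::]; [:: 16 :- 3]; [::]; [:: 2 :- 3]; [::]; [:: 4 :- 3]; [::]; [::]; [:: 7
  :- 3]; [::]; [:: 9 :- 3]; [:: 0 :- (-2); 1 :- 1]; [::]; [::]; [::]; [::];
  [::]; [::]; [::]]; [:: [:: 22 :- (-3)]; [::]; [:: 14 :- 3]; [:: 15 :- 3];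
  [::]; [::]; [::]; [::]; [:: 12 :- 3]; [:: 13 :- 3]; [:: 6 :- (-3)]; [:: 7 :-
  (-3)]; [::]; [::]; [::]; [::]; [:: 4 :- (-3)]; [:: 5 :- (-3)]; [::]; [::];
  [::]; [::]; [::]; [::]; [::]; [:: 0 :- 2; 1 :- (-1)]]; [:: [:: 23 :- (-3)];
  [::]; [::]; [::]; [:: 14 :- 3]; [:: 15 :- 3]; [::]; [::]; [:: 10 :- (-3)];
  [:: 11 :- (-3)]; [::]; [::]; [:: 6 :- (-3)]; [:: 7 :- (-3)]; [::]; [::]; [::
  2 :- 3]; [:: 3 :- 3]; [::]; [::]; [::]; [::]; [::]; [::]; [:: 0 :- (-2); 1
  :- 1]; [::]]; [:: [:: 24 :- (-3)]; [::]; [:: 16 :- 3]; [:: 17 :- 3]; [::];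
  [::]; [:: 12 :- (-3)]; [:: 13 :- (-3)]; [::]; [::]; [:: 8 :- (-3)]; [:: 9 :-
  (-3)]; [::]; [::]; [:: 4 :- 3]; [:: 5 :- 3]; [::]; [::]; [::]; [::]; [::];
  [::]; [::]; [:: 0 :- (-2); 1 :- 1]; [::]; [::]]; [:: [:: 25 :- (-3)]; [::];
  [::]; [::]; [:: 16 :- 3]; [:: 17 :- 3]; [:: 10 :- 3]; [:: 11 :- 3]; [::];
  [::]; [::]; [::]; [:: 8 :- (-3)]; [:: 9 :- (-3)]; [:: 2 :- (-3)]; [:: 3 :-
  (-3)]; [::]; [::]; [::]; [::]; [::]; [::]; [:: 0 :- 2; 1 :- (-1)]; [::];
  [::]; [::]]].

(** Gram matrix of the trace form; the leading block comes from the third diagonal entry being minus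
    the sum of the first two. *)
Definition Phi : smat :=
  [:: [:: 0 :- 2; 1 :- 1]; [:: 0 :- 1; 1 :- 2]; [:: 5 :- 1]; [:: 4 :- (-1)];
  [:: 3 :- (-1)]; [:: 2 :- 1]; [:: 9 :- (-1)]; [:: 8 :- 1]; [:: 7 :- 1]; [:: 6
  :- (-1)]; [:: 13 :- 1]; [:: 12 :- (-1)]; [:: 11 :- (-1)]; [:: 10 :- 1]; [::
  17 :- (-1)]; [:: 16 :- 1]; [:: 15 :- 1]; [:: 14 :- (-1)]; [:: 21 :- 1]; [::
  20 :- (-1)]; [:: 19 :- (-1)]; [:: 18 :- 1]; [:: 25 :- (-1)]; [:: 24 :- 1];
  [:: 23 :- 1]; [:: 22 :- (-1)]].

(** A triple (s, t), d produces a new element from element t by the generator s, dividing by d; see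
    [chain]. *)
Definition borel_steps : seq (nat * nat * Z) :=
  [:: (2, 0) :- 2; (3, 1) :- 2; (0, 2) :- 2; (0, 3) :- 4; (1, 3) :- 2; (1, 4)
  :- 2; (3, 4) :- 2; (1, 6) :- 4; (3, 6) :- 2; (2, 7) :- 2; (3, 8) :- 2; (0,
  9) :- 2; (2, 9) :- 2; (0, 11) :- 2; (2, 11) :- 2; (2, 12) :- 2; (0, 14) :-
  4; (2, 14) :- 2; (3, 16) :- 2; (2, 17) :- 2; (3, 17) :- 2; (3, 18) :- 2; (0,
  19) :- 2; (3, 20) :- 2; (2, 21) :- 2; (0, 22) :- 2; (1, 23) :- 2; (0, 24) :-
  2; (2, 24) :- 2; (3, 24) :- 4; (1, 26) :- 2; (1, 28) :- 2; (3, 28) :- 2; (3,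
  29) :- 2; (3, 32) :- 2; (0, 33) :- 4; (2, 33) :- 2; (0, 35) :- 2; (2, 35) :-
  2; (2, 36) :- 2; (1, 38) :- 4; (2, 38) :- 2; (3, 40) :- 2; (2, 41) :- 2; (3,
  42) :- 2; (3, 44) :- 2; (0, 45) :- 2; (0, 46) :- 2; (0, 48) :- 4; (3, 49) :-
  2; (2, 50) :- 2].

(** Combinations of matrix entries that read off twice the coordinates in the basis [Gs]; [span_ok]
    confirms this on the inner derivations. *)
Definition pivots : seq (seq (nat * nat * Z)) :=
  [:: [:: (2, 7) :- (-2)]; [:: (2, 3) :- (-2)]; [:: (2, 9) :- (-2)]; [:: (0,
  5) :- (-2)]; [:: (2, 6) :- (-2)]; [:: (0, 19) :- (-2)]; [:: (1, 15) :- 2];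
  [:: (2, 4) :- 2]; [:: (4, 7) :- 2]; [:: (1, 13) :- 2]; [:: (2, 8) :- 2]; [::
  (6, 7) :- 2]; [:: (0, 22) :- 2]; [:: (1, 17) :- (-2)]; [:: (0, 7) :- 2]; [::
  (4, 9) :- (-2)]; [:: (0, 18) :- (-2)]; [:: (8, 6) :- 2]; [:: (0, 3) :- 2];
  [:: (0, 24) :- 2]; [:: (4, 6) :- (-2)]; [:: (3, 7) :- (-2)]; [:: (0, 9) :-
  2]; [:: (1, 12) :- (-2)]; [:: (2, 2) :- 4; (3, 3) :- (-2); (7, 7) :- (-2)];
  [:: (2, 2) :- (-2); (7, 7) :- 2]; [:: (2, 2) :- (-3); (3, 3) :- 1; (6, 6) :-
  (-1); (7, 7) :- 1]; [:: (2, 2) :- 2]; [:: (0, 6) :- (-2)]; [:: (4, 8) :- 2];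
  [:: (3, 9) :- (-2)]; [:: (1, 11) :- 2]; [:: (0, 23) :- (-2)]; [:: (0, 4) :-
  2]; [:: (6, 8) :- 2]; [:: (0, 21) :- (-2)]; [:: (3, 6) :- (-2)]; [:: (0, 8)
  :- 2]; [:: (1, 14) :- (-2)]; [:: (0, 25) :- 2]; [:: (7, 6) :- 2]; [:: (5, 7)
  :- 2]; [:: (1, 10) :- 2]; [:: (3, 8) :- (-2)]; [:: (4, 2) :- 2]; [:: (1, 16)
  :- (-2)]; [:: (5, 9) :- 2]; [:: (0, 20) :- 2]; [:: (0, 2) :- 2]; [:: (5, 6)
  :- 2]; [:: (3, 2) :- (-2)]; [:: (5, 8) :- (-2)]].

Definition levi_steps : seq (nat * nat * Z) :=
  [:: (2, 1) :- 2; (1, 2) :- 2; (2, 3) :- 2; (2, 5) :- 2; (0, 6) :- 2; (0, 7)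
  :- 2; (1, 7) :- 4; (0, 8) :- 2; (0, 9) :- 2; (0, 10) :- 4; (1, 10) :- 2; (1,
  11) :- 2; (2, 11) :- 2; (0, 13) :- 4; (1, 13) :- 2; (0, 14) :- 4; (1, 14) :-
  2; (1, 15) :- 2; (2, 15) :- 2; (0, 17) :- 4; (2, 17) :- 2; (0, 18) :- 2; (1,
  19) :- 2; (2, 19) :- 2; (1, 21) :- 2; (1, 23) :- 4; (2, 23) :- 2; (2, 25) :-
  2; (0, 26) :- 2; (1, 27) :- 2; (1, 28) :- 4; (2, 28) :- 2; (1, 30) :- 4; (2,
  31) :- 2; (0, 32) :- 2; (0, 33) :- 2; (1, 34) :- 2; (2, 36) :- 2; (0, 37) :-
  2; (0, 39) :- 2; (1, 41) :- 2; (0, 43) :- 2; (0, 45) :- 4; (0, 47) :- 4; (2,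
  48) :- 2; (2, 49) :- 2].

Definition smi (i : nat) : smat := nth [::] Ms i.

(** Exactness of the divisions is not assumed: the steps of a chain are verified after multiplying
    back, in [chain_ok]. *)
Definition sdiv (d : Z) (A : smat) : smat :=
  [seq [seq (e.1, Z.div e.2 d) | e <- r] | r <- A].

Definition sder (i j : nat) : smat :=
  sadd (ssub (smul (smi j) (smi i)) (smul (smi i) (smi j)))
    (sscale 12%bZ (ssub (smul Phi (sdelta j i)) (smul Phi (sdelta i j)))).

Definition sder_div (p : nat * nat * Z) : smat :=
  sdiv p.2 (snorm (sder p.1.1 p.1.2)).

Definition sE : smat := Eval vm_compute in sder_div ((2, 8) :- 18).
Definition sF : smat := Eval vm_compute in sder_div ((5, 7) :- 18).

(** The exponential of s A cut off after the square, for s = 1 or -1. That the results are mutually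
    inverse automorphisms is checked by [auto_ok]. *)
Definition sunip (s : Z) (A : smat) : smat :=
  snorm (sadd sone (sadd (sscale s A) (sdiv 2%bZ (snorm (smul A A))))).

Definition unip_pair (p : nat * nat * Z) : smat * smat :=
  let A := sder_div p in (sunip 1%bZ A, sunip (-1)%bZ A).

Definition ups : seq (smat * smat) := Eval vm_compute in
  map unip_pair [:: (0, 6) :- 9; (0, 11) :- 18; (3, 8) :- 18; (4, 9) :- 18].
Definition downs : seq (smat * smat) := Eval vm_compute in
  map unip_pair [:: (0, 9) :- 9; (0, 12) :- 18; (4, 7) :- 18; (3, 6) :- 18].

Definition levi_ups := [:: nth ([::], [::]) ups 0; nth ([::], [::]) ups 1; nth ([::], [::]) ups 3].

Definition sconj (g : smat * smat) (A : smat) : smat :=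
  smul g.2 (smul A g.1).
Definition sconj2 (g : smat * smat) (A : smat) : smat :=
  ssub (sconj g A) (sconj (g.2, g.1) A).

(** The difference of the conjugates of K by g and by its inverse is a linear combination of
    conjugates, and thus stays in any span stable under g. It is twice the odd part, close to a
    multiple of a bracket, hence the division. *)
Definition chain (gs : seq (smat * smat)) (starts : seq smat) steps :=
  foldl (fun K (p : nat * nat * Z) => rcons K (sdiv p.2
    (snorm (sconj2 (nth ([::], [::]) gs p.1.1) (nth [::] K p.1.2)))))
    starts steps.

Definition Gs : seq smat := Eval vm_compute in chain ups [:: sF] borel_steps.
Definition Ks : seq smat := Eval vm_compute in chain downs [:: sE] borel_steps.
(** Six starting vectors, matching the six summands of dimensions 1, 1, 1, 14, 14, 21 of F4 under
    the subgroup of type C3 that centralises [sE] and [sF]. *)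
Definition levi_starts : seq smat := Eval vm_compute in
  [seq nth [::] Gs l | l <- [:: 0; 1; 10; 29; 51; 25]%N].
Definition Ls : seq smat := Eval vm_compute in chain levi_ups levi_starts levi_steps.

Definition chain_ok gs (K : seq smat) n0 (steps : seq (nat * nat * Z)) : bool :=
  (size K == n0 + size steps)%N &&
  all (fun n => let p := nth ((0, 0) :- 0) steps n in
    [&& (p.1.2 < n0 + n)%N, (p.1.1 < size gs)%N, Z.eqb p.2 2 || Z.eqb p.2 4
      & eq_smat (sscale p.2 (nth [::] K (n0 + n)))
          (sconj2 (nth ([::], [::]) gs p.1.1) (nth [::] K p.1.2))])
    (iota 0 (size steps)).

Definition coords (A : smat) : seq Z :=
  [seq foldr (fun p s => Z.add (Z.mul p.2 (coef (srw A p.1.1) p.1.2)) s) Z0 pv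
     | pv <- pivots].

Definition span_ok : bool :=
  all (fun i => all (fun j => let A := sder i j in
    eq_smat (sscale 2%bZ A) (scomb (coords A) Gs)) (iota 0 26)) (iota 0 26).

Definition same_ok (Ks : seq smat) : bool :=
  all (fun G => has (fun K => eq_smat G K || eq_smat G (sopp K)) Ks) Gs.

Definition auto_ok (g : smat * smat) : bool :=
  [&& eq_smat (smul g.1 g.2) sone, eq_smat (smul g.2 g.1) sone,
    eq_smat (smul g.1 (smul Phi (str g.1))) Phi
  & all (fun i => eq_smat
      (scomb [seq coef (srw g.1 i) l | l <- iota 0 26] Ms)
      (smul g.2 (smul (smi i) g.1))) (iota 0 26)].

Definition MTs : seq smat := Eval vm_compute in map str Ms.
(** Collects column p of all the M_s. As M_s and M_y commute as multiplications, entry (s, y) is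
    also that of M_y at (s, p), which is the form needed for traces against M_y ([mx_sQ]). *)
Definition sQ (p : nat) : smat := [seq srw A p | A <- MTs].

Definition santi A B := snorm (sadd (smul A B) (smul B A)).
Definition sbr A B := snorm (ssub (smul A B) (smul B A)).
Definition sdbr C D B := sadd (sbr C (sbr D B)) (sbr D (sbr C B)).
Definition sS4 A B C D :=
  sadd (sadd (sadd (santi A (sdbr C D B)) (santi (sdbr C D A) B))
             (sadd (santi C (sdbr A B D)) (santi (sdbr A B C) D)))
    (sscale 2%bZ (sadd (santi (sbr A C) (sbr B D)) (santi (sbr A D) (sbr B C)))).
Definition sTL (T : smat) : smat :=
  let ts := [seq (l, strace (smul T (smi l))) | l <- iota 0 26] in
  [seq flatten [seq rowscale t.2 (srw (sQ t.1) x) | t <- ts] | x <- iota 0 26].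
Definition sTLL (a c : smat) : smat :=
  let c := take 26 c in
  [seq flatten [seq rowmul (rowmul (rowmul (srw a p) (take 26 (smi x))) c)
      (take 26 (sQ p)) | p <- iota 0 26] | x <- iota 0 26].
Definition stau A B := strace (smul A B).

(** Evaluates [P4] for all pairs of basis vectors x, y at once, as one matrix ([mx_sP4]). *)
Definition sP4 A B C D : smat :=
  let a := santi A B in let c := santi C D in let ac := santi a c in
  let S := sS4 A B C D in
  let AC := stau A C in let BD := stau B D in
  let AD := stau A D in let BC := stau B C in
  sadd (sadd (sscale (-3)%bZ (sTL ac))
             (sscale (-6)%bZ (sadd (sTLL a c) (sTLL c a))))
    (smul (sadd (sscale 216%bZ ac)
       (sadd (sscale (-108)%bZ S)
       (sadd (sscale (-36)%bZ (sadd (sadd (sscale AC (santi B D)) (sscale AD (santi B C)))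
                                    (sadd (sscale BC (santi A D)) (sscale BD (santi A C)))))
        (sscale (strace a * strace c + 3 * strace S + 4 * (AC * BD + AD * BC))%bZ sone)))) Phi).

Definition sQ4 A B C D : Z :=
  (12 * (strace (smul (smul A B) (smul C D)) + strace (smul (smul A C) (smul B D))
    + strace (smul (smul B A) (smul C D)))
  - (stau A B * stau C D + stau A C * stau B D + stau A D * stau B C))%bZ.


(** * The finite computations, checked by the virtual machine at [Qed] *)

Lemma chain_up_ok : chain_ok ups Gs 1 borel_steps. Proof. by vm_cast_no_check (erefl true). Qed.
Lemma chain_down_ok : chain_ok downs Ks 1 borel_steps. Proof. by vm_cast_no_check (erefl true). Qed.
Lemma chain_levi_ok : chain_ok levi_ups Ls 6 levi_steps. Proof. by vm_cast_no_check (erefl true). Qed.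
Lemma der_span_ok : span_ok. Proof. by vm_cast_no_check (erefl true). Qed.
Lemma Ks_same_ok : same_ok Ks. Proof. by vm_cast_no_check (erefl true). Qed.
Lemma Ls_same_ok : same_ok Ls. Proof. by vm_cast_no_check (erefl true). Qed.
Lemma ups_auto_ok : all auto_ok ups. Proof. by vm_cast_no_check (erefl true). Qed.
Lemma downs_auto_ok : all auto_ok downs. Proof. by vm_cast_no_check (erefl true). Qed.
Lemma ups_fixE_ok : all (fun g => eq_smat (sconj g sE) sE) ups. Proof. by vm_cast_no_check (erefl true). Qed.
Lemma levi_fixF_ok : all (fun g => eq_smat (sconj g sF) sF) levi_ups. Proof. by vm_cast_no_check (erefl true). Qed.
Lemma M_tr_ok : all (fun z => Z.eqb (strace z) 0) Ms. Proof. by vm_cast_no_check (erefl true). Qed.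
Lemma Z3_ok : all (fun z => Z.eqb (strace (smul (smul sE sF) z)) 0) Ms. Proof. by vm_cast_no_check (erefl true). Qed.
Lemma Q4_ok : all (fun C => all (fun D => Z.eqb (sQ4 sE sF C D) 0) Gs) levi_starts. Proof. by vm_cast_no_check (erefl true). Qed.
(** The decisive computation: six choices for C times the 52 elements of [Gs] for D, with A = [sE]
    and B = [sF]. *)
Lemma P4_ok : all (fun C => all (fun D => szero (sP4 sE sF C D)) Gs) levi_starts. Proof. by vm_cast_no_check (erefl true). Qed.
Lemma MC_ok : all (fun i => all (fun j => srw (smi i) j == srw (smi j) i) (iota 0 26)) (iota 0 26). Proof. by vm_cast_no_check (erefl true). Qed.
Lemma MTs_ok : MTs = map str Ms. Proof. by vm_compute. Qed.

Lemma zip_mem2 (S T : eqType) (s : seq S) (t : seq T) p :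
  p \in zip s t -> p.2 \in t.
Proof.
elim: s t => [|x s IH] [|y t]; rewrite /= ?in_nil //.
by rewrite !inE => /orP[/eqP -> /=|/IH ->]; rewrite ?eqxx ?orbT.
Qed.

Section LinearMatrix.
Variables (L : fieldType) (U : lmodType L).

Lemma linear_id : linear (fun x : U => x). Proof. by []. Qed.
Lemma linear_mull m n p (F : U -> 'M[L]_(m, n)) (B : 'M_(n, p)) :
  linear F -> linear (fun x => F x *m B).
Proof. by move=> lF c u v; rewrite lF mulmxDl -scalemxAl. Qed.
Lemma linear_mulr m n p (F : U -> 'M[L]_(n, p)) (B : 'M_(m, n)) :
  linear F -> linear (fun x => B *m F x).
Proof. by move=> lF c u v; rewrite lF mulmxDr -scalemxAr. Qed.
Lemma linear_tr m n (F : U -> 'M[L]_(m, n)) :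
  linear F -> linear (fun x => (F x)^T).
Proof. by move=> lF c u v; rewrite lF linearP. Qed.
Lemma scalar_trace n (F : U -> 'M[L]_n) :
  linear F -> scalar (fun x => \tr (F x)).
Proof. by move=> lF c u v; rewrite lF linearP. Qed.
Lemma scalar_opp (F : U -> L) : scalar F -> scalar (fun x => - F x).
Proof. by move=> lF c u v; rewrite lF opprD mulrN. Qed.
End LinearMatrix.

Ltac lin := repeat first
  [ assumption | exact: linear_id | apply: linear_mull | apply: linear_mulr
  | apply: linear_tr | apply: linear_fun_add | apply: linear_fun_opp
  | apply: linear_fun_scale | apply: scalar_trace | apply: scalar_fun_add
  | apply: scalar_fun_mul | apply: scalar_fun_mulr | apply: scalar_opp
  | apply: linear_fun_scaler ].

Lemma levi_ups_ok : all (fun p => p \in ups) levi_ups.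
Proof. by vm_compute. Qed.

Lemma take6_Ls : take 6 Ls = levi_starts.
Proof. by vm_compute. Qed.

(** * Reduction of invariant multilinear identities to root vectors *)

Section Model.
Variable L : fieldType.
Hypothesis n2 : 2%:R != 0 :> L.

Local Notation M := 'M[L]_26.
Local Notation V := 'rV[L]_26.
Local Notation mx := (mx L).
Local Notation rv := (rv L).
Local Notation zL := (zL L).

Definition mxM (x : V) : M := \sum_l x 0 l *: mx (smi l).
Definition mphi : M := mx Phi.
Definition phi (x y : V) : L := (x *m mphi *m y^T) 0 0.

Lemma mxM_linear : linear mxM.
Proof.
move=> c x y; rewrite /mxM scaler_sumr -big_split /=; apply: eq_bigr => l _.
by rewrite !mxE scalerDl scalerA.
Qed.

Lemma mxM_delta (i : 'I_26) : mxM (delta_mx 0 i) = mx (smi i).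
Proof.
rewrite /mxM (bigD1 i) //= big1 ?addr0 => [|l li].
  by rewrite !mxE !eqxx scale1r.
by rewrite !mxE eqxx (negPf li) scale0r.
Qed.

Lemma phi_linear x : scalar (phi x).
Proof.
by move=> c u v; rewrite /phi linearP mulmxDr -scalemxAr !mxE.
Qed.
Lemma phi_linearl y : scalar (phi^~ y).
Proof.
by move=> c u v; rewrite /phi !mulmxDl -!scalemxAl !mxE.
Qed.

(* 36 D_{a,b}, acting on row vectors *)
Definition dmx (a b : V) : M := mxM b *m mxM a - mxM a *m mxM b
  + 12%:R *: (mphi *m b^T *m a - mphi *m a^T *m b).

Lemma dmx_linearl b : linear (dmx^~ b).
Proof. by have h := mxM_linear; rewrite /dmx; lin. Qed.
Lemma dmx_linearr a : linear (dmx a).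
Proof. by have h := mxM_linear; rewrite /dmx; lin. Qed.

Definition lclosed (Q : M -> Prop) :=
  forall c A B, Q A -> Q B -> Q (c *: A + B).

(** The linear span of the inner derivations, encoded impredicatively so that an induction over the
    span is an application. *)
Definition in_der (A : M) :=
  forall Q, lclosed Q -> (forall a b, Q (dmx a b)) -> Q A.

Lemma lclosed0 Q A : lclosed Q -> Q A -> Q 0.
Proof. by move=> lQ QA; have := lQ (-1) A A QA QA; rewrite scaleN1r addNr. Qed.

Lemma lclosedZ Q c A : lclosed Q -> Q A -> Q (c *: A).
Proof. by move=> lQ QA; rewrite -[_ *: _]addr0; apply: lQ QA (lclosed0 lQ QA). Qed.

Lemma lclosedD Q A B : lclosed Q -> Q A -> Q B -> Q (A + B).
Proof. by move=> lQ QA QB; rewrite -[A]scale1r; apply: lQ. Qed.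

Lemma lclosed_sum (I : Type) (s : seq I) (P : pred I) (F : I -> M) Q :
  lclosed Q -> Q 0 -> (forall i, P i -> Q (F i)) -> Q (\sum_(i <- s | P i) F i).
Proof.
by move=> lQ Q0 QF; elim/big_ind: _ => // A B; apply: lclosedD.
Qed.

Lemma in_der_closed : lclosed in_der.
Proof. by move=> c A B hA hB Q lQ Qd; apply: (lQ c A B (hA Q lQ Qd) (hB Q lQ Qd)). Qed.

Lemma in_der_dmx a b : in_der (dmx a b).
Proof. by move=> Q _ Qd; apply: Qd. Qed.

(** A pair of mutually inverse automorphisms of product and form, acting on row vectors from the
    right. *)
Definition auto (g g' : M) := [/\ g *m g' = 1%:M, g' *m g = 1%:M,
  g *m mphi *m g^T = mphi & forall x, mxM (x *m g) = g' *m mxM x *m g].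

Lemma auto_inv g g' : auto g g' -> auto g' g.
Proof.
move=> [gg' g'g gP gM]; split=> // [|x].
  rewrite -{1}gP !mulmxA g'g mul1mx -mulmxA -trmx_mul g'g trmx1 mulmx1 //.
have := gM (x *m g'); rewrite -mulmxA g'g mulmx1 => ->.
by rewrite !mulmxA gg' mul1mx -mulmxA gg' mulmx1.
Qed.

(** An automorphism carries D_(a,b) to D_(ag,bg). *)
Lemma in_der_conj g g' A : auto g g' -> in_der A -> in_der (g' *m A *m g).
Proof.
move=> [gg' g'g gP gM] hA Q lQ Qd.
apply: (hA (fun A => Q (g' *m A *m g))) => [c X Y QX QY|a b].
  by rewrite mulmxDr mulmxDl -scalemxAr -scalemxAl; apply: lQ.
have -> : g' *m dmx a b *m g = dmx (a *m g) (b *m g); last exact: Qd.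
have gM2 x y : mxM (x *m g) *m mxM (y *m g) = g' *m (mxM x *m mxM y) *m g.
  by rewrite !gM !mulmxA -[_ *m g *m g']mulmxA gg' mulmx1.
have gP' : mphi *m g^T = g' *m mphi.
  by rewrite -[in RHS]gP !mulmxA g'g mul1mx.
rewrite /dmx mulmxDr mulmxDl mulmxBr mulmxBl !gM2; congr (_ + _).
rewrite -scalemxAr -scalemxAl mulmxBr mulmxBl; congr (_ *: (_ - _)).
  by rewrite trmx_mul !mulmxA -gP'.
by rewrite trmx_mul !mulmxA -gP'.
Qed.

Lemma zL2 : zL 2%bZ = 2%:R. Proof. exact: (zLn L 2). Qed.
Lemma zL4 : zL 4%bZ = 4%:R. Proof. exact: (zLn L 4). Qed.

Lemma rv_delta (x : V) : x = \sum_i x 0 i *: delta_mx 0 i.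
Proof. exact: row_sum_delta. Qed.

Lemma smi_iota : Ms = [seq smi l | l <- iota 0 26].
Proof. by []. Qed.

Lemma mxM_rv r : mx (scomb [seq coef r l | l <- iota 0 26] Ms) = mxM (rv r).
Proof.
rewrite smi_iota mx_scomb zip_map big_map -[iota 0 26]/(index_iota 0 26).
by rewrite big_mkord; apply: eq_bigr => l _; rewrite mxE.
Qed.

Lemma eq_linear_delta (F G : V -> M) : linear F -> linear G ->
  (forall i, F (delta_mx 0 i) = G (delta_mx 0 i)) -> F =1 G.
Proof.
move=> lF lG h x.
pose FL := GRing.isLinear.Build L V M _ F lF.
pose GL := GRing.isLinear.Build L V M _ G lG.
pose f : {linear V -> M} := HB.pack F FL.
pose g : {linear V -> M} := HB.pack G GL.
rewrite -[LHS]/(f x) -[RHS]/(g x) (rv_delta x) !linear_sum.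
by apply: eq_bigr => i _; rewrite !linearZ /= h.
Qed.

Lemma auto_okP p : auto_ok p -> auto (mx p.1) (mx p.2).
Proof.
case/and4P => /(eq_smat_mx L) h1 /(eq_smat_mx L) h2 /(eq_smat_mx L) h3 /allP h4.
rewrite !mx_smul mx_str mx_sone in h1 h2 h3; split => //.
  by rewrite -mulmxA.
apply: eq_linear_delta => [||i].
- by have h := mxM_linear; move=> c u v; rewrite mulmxDl -scalemxAl h.
- by have h := mxM_linear; lin.
have /h4/(eq_smat_mx L) : (i : nat) \in iota 0 26 by rewrite mem_iota ltn_ord.
by rewrite mxM_rv !mx_smul -rowE row_mx mxM_delta mulmxA.
Qed.

Lemma ups_auto p : p \in ups -> auto (mx p.1) (mx p.2).
Proof. by move/(allP ups_auto_ok)/auto_okP. Qed.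
Lemma downs_auto p : p \in downs -> auto (mx p.1) (mx p.2).
Proof. by move/(allP downs_auto_ok)/auto_okP. Qed.

(** Each element of the chain is, up to 2 or 4, a difference of two conjugates of an earlier one, so
    a linearly closed property stable under the generators spreads from the starting elements. *)
Lemma chain_sound (Q : M -> Prop) gs K n0 steps : lclosed Q ->
  (forall p, p \in gs -> forall A, Q A ->
     Q (mx p.2 *m A *m mx p.1) /\ Q (mx p.1 *m A *m mx p.2)) ->
  chain_ok gs K n0 steps ->
  (forall n, (n < n0)%N -> Q (mx (nth [::] K n))) ->
  forall A, A \in K -> Q (mx A).
Proof.
move=> lQ Qg /andP[/eqP sK /allP cK] Q0 A /(nthP [::])[n nK <-].
elim/ltn_ind: n nK => n IH nK.
have [/Q0 //|n0n] := ltnP n n0.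
have nS : (n - n0 < size steps)%N by rewrite ltn_subLR // -sK.
have := cK (n - n0)%N; rewrite mem_iota nS => /(_ isT).
case: (nth _ _ _) => -[s t] d /=; rewrite subnKC // => /and4P[tn sgs dd].
move/(eq_smat_mx L); rewrite mx_sscale mx_ssub !mx_smul /= => E.
have [|Q1 Q2] := Qg _ (mem_nth ([::], [::]) sgs) (mx (nth [::] K t)).
  by apply: IH => //; apply: ltn_trans nK.
have d0 : zL d != 0.
  case/orP: dd => /Z.eqb_eq ->; rewrite ?zL2 ?zL4 //.
  by rewrite (natrM _ 2 2) mulf_neq0.
rewrite -[mx (nth [::] K n)]scale1r -(mulVf d0) -scalerA E.
apply: lclosedZ => //; rewrite addrC -scaleN1r !mulmxA.
exact: lQ.
Qed.

Lemma span_Gs (Q : M -> Prop) : lclosed Q -> (forall A, A \in Gs -> Q (mx A)) ->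
  forall A, in_der A -> Q A.
Proof.
move=> lQ QG A; apply=> // a b.
have Q0 : Q 0 by apply: (lclosed0 lQ (QG (nth [::] Gs 0) _)).
have Qcomb cs : Q (mx (scomb cs Gs)).
  rewrite mx_scomb big_seq; apply: lclosed_sum => // p ps.
  apply: lclosedZ => //; apply: QG.
  exact: zip_mem2 ps.
have Qe (i j : 'I_26) : Q (dmx (delta_mx 0 i) (delta_mx 0 j)).
  rewrite -[dmx _ _]scale1r -(mulVf n2) -scalerA; apply: lclosedZ => //.
  have := der_span_ok; rewrite /span_ok => /allP/(_ i).
  rewrite mem_iota ltn_ord => /(_ isT)/allP/(_ j).
  rewrite mem_iota ltn_ord => /(_ isT)/(eq_smat_mx L).
  rewrite mx_sscale zL2 mx_sadd mx_ssub mx_sscale mx_ssub !mx_smul !mx_sdelta.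
  rewrite (zLn L 12) /dmx !mxM_delta -!mulmxA !trmx_delta !mul_delta_mx => ->.
  exact: Qcomb.
rewrite (rv_delta a).
have sl (F : V -> M) (r : 'I_26 -> L) (e : 'I_26 -> V) : linear F ->
    F (\sum_i r i *: e i) = \sum_i r i *: F (e i).
  move=> lF; pose FL := GRing.isLinear.Build L V M _ F lF.
  pose f : {linear V -> M} := HB.pack F FL.
  by rewrite -[LHS]/(f _) linear_sum; apply: eq_bigr => i _; rewrite linearZ.
rewrite (sl (dmx^~ b)); last exact: dmx_linearl.
apply: lclosed_sum => // i _; apply: lclosedZ => //.
rewrite (rv_delta b) (sl (dmx _)); last exact: dmx_linearr.
by apply: lclosed_sum => // j _; apply: lclosedZ.
Qed.

Lemma span_same (Q : M -> Prop) Ks : same_ok Ks -> lclosed Q ->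
  (forall A, A \in Ks -> Q (mx A)) -> forall A, in_der A -> Q A.
Proof.
move=> /allP sK lQ QK; apply: span_Gs => // G /sK/hasP[K KK].
case/orP => /(eq_smat_mx L) ->; first exact: QK.
by rewrite mx_sopp -scaleN1r; apply: lclosedZ => //; apply: QK.
Qed.

(** The generators in [ups] fix [sE], so H holds at [sE] against the span of their translates of
    [sF], which contains all inner derivations. The property of X that H X Y holds for all Y is
    stable under every automorphism, and the translates of [sE] by [downs] span as well. *)
Lemma reduce2 (H : M -> M -> Prop) :
  (forall Y, lclosed (H^~ Y)) -> (forall X, lclosed (H X)) ->
  (forall g g', auto g g' -> forall X Y, H X Y ->
     H (g' *m X *m g) (g' *m Y *m g)) ->
  H (mx sE) (mx sF) -> forall X Y, in_der X -> in_der Y -> H X Y.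
Proof.
move=> Hl Hr Hg HEF.
have HE Y : in_der Y -> H (mx sE) Y.
  apply: span_Gs => //; apply: (chain_sound (Hr _) _ chain_up_ok) => [p pu A QA|].
    have ag := ups_auto pu; have fE := allP ups_fixE_ok p pu.
    have {fE} := eq_smat_mx L fE; rewrite !mx_smul mulmxA => fE.
    split; first by rewrite -[X in H X]fE; apply: Hg.
    have := Hg _ _ (auto_inv ag) _ _ QA; rewrite -[in X in H X _ -> _]fE.
    case: ag => gg' g'g _ _.
    by rewrite !mulmxA gg' mul1mx -mulmxA gg' mulmx1.
  by case.
move=> X Y hX hY; move: X hX Y hY.
suff h X : in_der X -> forall Y, in_der Y -> H X Y by move=> X hX; apply: h.
have lQ : lclosed (fun X => forall Y, in_der Y -> H X Y).
  by move=> c A B hA hB Y hY; apply: Hl; [apply: hA | apply: hB].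
apply: (span_same Ks_same_ok lQ).
apply: (chain_sound lQ _ chain_down_ok) => [p pd A QA|[]//].
have conjQ g g' : auto g g' -> forall Y, in_der Y -> H (g' *m A *m g) Y.
  move=> ag Y hY; have := in_der_conj (auto_inv ag) hY => hY'.
  have := Hg _ _ ag _ _ (QA _ hY'); case: ag => gg' g'g _ _.
  by rewrite !mulmxA g'g mul1mx -[_ *m g' *m g]mulmxA g'g mulmx1.
have ag := downs_auto pd.
by split; apply: conjQ => //; apply: auto_inv.
Qed.

(** As in [reduce2], but only with automorphisms fixing both [sE] and [sF], so that the first two
    arguments stay in place. *)
Lemma reduce_levi (Q : M -> Prop) : lclosed Q ->
  (forall g g', auto g g' -> g' *m mx sE *m g = mx sE ->
     g' *m mx sF *m g = mx sF -> forall X, Q X -> Q (g' *m X *m g)) ->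
  (forall A, A \in levi_starts -> Q (mx A)) -> forall X, in_der X -> Q X.
Proof.
move=> lQ Qg Q0; apply: (span_same Ls_same_ok) => //.
apply: (chain_sound lQ _ chain_levi_ok) => [p pu A QA|n n6].
  have pu' : p \in ups := allP levi_ups_ok p pu.
  have ag := ups_auto pu'.
  have fE := eq_smat_mx L (allP ups_fixE_ok p pu').
  have fF := eq_smat_mx L (allP levi_fixF_ok p pu).
  rewrite !mx_smul !mulmxA in fE fF.
  have inv B : mx p.2 *m B *m mx p.1 = B -> mx p.1 *m B *m mx p.2 = B.
    case: ag => gg' _ _ _ {1}<-.
    by rewrite !mulmxA gg' mul1mx -mulmxA gg' mulmx1.
  split; first exact: (Qg _ _ ag fE fF _ QA).
  by apply: Qg QA; [apply: auto_inv | apply: inv | apply: inv].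
rewrite -(nth_take [::] n6) take6_Ls.
by apply: Q0; apply: mem_nth; exact: n6.
Qed.

Definition antimx (A B : M) := A *m B + B *m A.
Definition brk (A B : M) := A *m B - B *m A.
Definition dbr C D B := brk C (brk D B) + brk D (brk C B).
Definition S4 A B C D :=
  antimx A (dbr C D B) + antimx (dbr C D A) B
  + (antimx C (dbr A B D) + antimx (dbr A B C) D)
  + 2%:R *: (antimx (brk A C) (brk B D) + antimx (brk A D) (brk B C)).
Definition taumx (A B : M) := \tr (A *m B).

(** Left side minus right side of [derP]. Each [mxM] is 6 times a multiplication, so the
    coefficients 108 and 216 of the trace terms appear as 3 and 6. *)
Definition P4 A B C D (x y : V) : L :=
  let a := antimx A B in let c := antimx C D in let ac := antimx a c in
  216%:R * phi (x *m ac) y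
  - 3%:R * \tr (ac *m mxM (x *m mxM y))
  - 6%:R * (\tr (a *m mxM x *m c *m mxM y) + \tr (a *m mxM y *m c *m mxM x))
  + \tr a * \tr c * phi x y
  - 108%:R * phi (x *m S4 A B C D) y + 3%:R * \tr (S4 A B C D) * phi x y
  - 36%:R * (taumx A C * phi (x *m antimx B D) y + taumx A D * phi (x *m antimx B C) y
     + taumx B C * phi (x *m antimx A D) y + taumx B D * phi (x *m antimx A C) y)
  + 4%:R * (taumx A C * taumx B D + taumx A D * taumx B C) * phi x y.

Definition Q4 A B C D : L :=
  12%:R * (\tr (A *m B *m (C *m D)) + \tr (A *m C *m (B *m D))
    + \tr (B *m A *m (C *m D)))
  - (taumx A B * taumx C D + taumx A C * taumx B D + taumx A D * taumx B C).

(** * Invariance and multilinearity of the identities *)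

Section Conj.
Variables g g' : M.
Hypothesis ag : auto g g'.
Let J A := g' *m A *m g.

Let JM A B : J A *m J B = J (A *m B).
Proof.
case: ag => gg' _ _ _.
by rewrite /J !mulmxA -[g' *m A *m g *m g']mulmxA gg' mulmx1.
Qed.
Let JD A B : J A + J B = J (A + B).
Proof. by rewrite /J mulmxDr mulmxDl. Qed.
Let JB A B : J A - J B = J (A - B).
Proof. by rewrite /J mulmxBr mulmxBl. Qed.
Let JZ c A : c *: J A = J (c *: A).
Proof. by rewrite /J -scalemxAr -scalemxAl. Qed.
Let Jtr A : \tr (J A) = \tr A.
Proof.
by case: ag => gg' _ _ _; rewrite /J mxtrace_mulC mulmxA gg' mul1mx.
Qed.
Let Janti A B : antimx (J A) (J B) = J (antimx A B).
Proof. by rewrite /antimx !JM JD. Qed.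
Let Jbrk A B : brk (J A) (J B) = J (brk A B).
Proof. by rewrite /brk !JM JB. Qed.
Let Jdbr A B C : dbr (J A) (J B) (J C) = J (dbr A B C).
Proof. by rewrite /dbr !Jbrk JD. Qed.
Let JS4 A B C D : S4 (J A) (J B) (J C) (J D) = J (S4 A B C D).
Proof. by rewrite /S4 !Jdbr !Jbrk !Janti !JD JZ JD. Qed.
Let Jtau A B : taumx (J A) (J B) = taumx A B.
Proof. by rewrite /taumx JM Jtr. Qed.
Let Jmx (x : V) : mxM (x *m g) = J (mxM x).
Proof. by case: ag. Qed.
Let Jv (x : V) A : x *m g *m J A = x *m A *m g.
Proof.
by case: ag => gg' _ _ _; rewrite /J !mulmxA -[x *m g *m g']mulmxA gg' mulmx1.
Qed.
Let Jphi (x y : V) : phi (x *m g) (y *m g) = phi x y.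
Proof.
case: ag => _ _ gP _.
by rewrite /phi trmx_mul -{2}gP !mulmxA.
Qed.

Lemma Z3_conj A B (z : V) :
  \tr (J A *m J B *m mxM (z *m g)) = \tr (A *m B *m mxM z).
Proof. by rewrite Jmx !JM Jtr. Qed.

Lemma Q4_conj A B C D : Q4 (J A) (J B) (J C) (J D) = Q4 A B C D.
Proof. by rewrite /Q4 !Jtau !JM !Jtr. Qed.

Lemma P4_conj A B C D x y :
  P4 (J A) (J B) (J C) (J D) (x *m g) (y *m g) = P4 A B C D x y.
Proof.
rewrite /P4 !JS4 !Jtau !Janti !Jmx !Jv !Jphi !Jmx !JM !Jtr.
by [].
Qed.

End Conj.


Lemma scalar_phi (U : lmodType L) (F : U -> V) y :
  linear F -> scalar (fun u => phi (F u) y).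
Proof. by move=> lF c u v; rewrite lF phi_linearl. Qed.
Lemma scalar_phir (U : lmodType L) (F : U -> V) y :
  linear F -> scalar (fun u => phi y (F u)).
Proof. by move=> lF c u v; rewrite lF phi_linear. Qed.
Lemma linear_mxM (U : lmodType L) (F : U -> V) :
  linear F -> linear (fun u => mxM (F u)).
Proof. by move=> lF c u v; rewrite lF mxM_linear. Qed.

Section Lin.
Variables (U : lmodType L) (F : U -> M).
Hypothesis lF : linear F.

Lemma linear_antil B : linear (fun u => antimx (F u) B).
Proof.
by apply: linear_fun_add; [apply: linear_mull | apply: linear_mulr].
Qed.
Lemma linear_antir B : linear (fun u => antimx B (F u)).
Proof.
by apply: linear_fun_add; [apply: linear_mulr | apply: linear_mull].
Qed.
Lemma linear_brkl B : linear (fun u => brk (F u) B).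
Proof.
apply: linear_fun_add; first exact: linear_mull.
exact/linear_fun_opp/linear_mulr.
Qed.
Lemma linear_brkr B : linear (fun u => brk B (F u)).
Proof.
apply: linear_fun_add; first exact: linear_mulr.
exact/linear_fun_opp/linear_mull.
Qed.
Lemma scalar_taul B : scalar (fun u => taumx (F u) B).
Proof. exact/scalar_trace/linear_mull. Qed.
Lemma scalar_taur B : scalar (fun u => taumx B (F u)).
Proof. exact/scalar_trace/linear_mulr. Qed.
End Lin.

Section Lin2.
Variables (U : lmodType L) (F : U -> M).
Hypothesis lF : linear F.
Lemma linear_dbr1 B C : linear (fun u => dbr (F u) B C).
Proof.
apply: linear_fun_add; first exact: linear_brkl.
exact/linear_brkr/linear_brkl.
Qed.
Lemma linear_dbr2 B C : linear (fun u => dbr B (F u) C).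
Proof.
apply: linear_fun_add; last exact: linear_brkl.
exact/linear_brkr/linear_brkl.
Qed.
Lemma linear_dbr3 B C : linear (fun u => dbr B C (F u)).
Proof. by apply: linear_fun_add; apply/linear_brkr/linear_brkr. Qed.
End Lin2.

Let lid : linear (fun A : M => A) := @linear_id L M.
Let lidv : linear (fun x : V => x) := @linear_id L V.

(** Here and below the proof term repeats the syntax tree of the expression, one closure lemma per
    node, because each variable occurs at a different place in each summand. *)
Lemma linear_S41 B C D : linear (fun A => S4 A B C D).
Proof.
exact: (linear_fun_add (linear_fun_add (linear_fun_add (linear_antil lid _)
  (linear_antil (linear_dbr3 lid _ _) _)) (linear_fun_add (linear_antir
  (linear_dbr1 lid _ _) _) (linear_antil (linear_dbr1 lid _ _) _)))
  (linear_fun_scale _ (linear_fun_add (linear_antil (linear_brkl lid _) _)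
  (linear_antil (linear_brkl lid _) _)))).
Qed.
Lemma linear_S42 A C D : linear (fun B => S4 A B C D).
Proof.
exact: (linear_fun_add (linear_fun_add (linear_fun_add (linear_antir (linear_dbr3
  lid _ _) _) (linear_antir lid _)) (linear_fun_add (linear_antir
  (linear_dbr2 lid _ _) _) (linear_antil (linear_dbr2 lid _ _) _)))
  (linear_fun_scale _ (linear_fun_add (linear_antir (linear_brkl lid _) _)
  (linear_antir (linear_brkl lid _) _)))).
Qed.
Lemma linear_S43 A B D : linear (fun C => S4 A B C D).
Proof.
exact: (linear_fun_add (linear_fun_add (linear_fun_add (linear_antir (linear_dbr1
  lid _ _) _) (linear_antil (linear_dbr1 lid _ _) _)) (linear_fun_add
  (linear_antil lid _) (linear_antil (linear_dbr3 lid _ _) _)))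
  (linear_fun_scale _ (linear_fun_add (linear_antil (linear_brkr lid _) _)
  (linear_antir (linear_brkr lid _) _)))).
Qed.
Lemma linear_S44 A B C : linear (fun D => S4 A B C D).
Proof.
exact: (linear_fun_add (linear_fun_add (linear_fun_add (linear_antir (linear_dbr2
  lid _ _) _) (linear_antil (linear_dbr2 lid _ _) _)) (linear_fun_add
  (linear_antir (linear_dbr3 lid _ _) _) (linear_antir lid _)))
  (linear_fun_scale _ (linear_fun_add (linear_antir (linear_brkr lid _) _)
  (linear_antil (linear_brkr lid _) _)))).
Qed.
Lemma P4_linA B C D x y : scalar (fun A => P4 A B C D x y).
Proof.
exact: (scalar_fun_add (scalar_fun_add (scalar_fun_add (scalar_fun_add
  (scalar_fun_add (scalar_fun_add (scalar_fun_add (scalar_fun_mul _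
  (scalar_phi _ (linear_mulr _ (linear_antil (linear_antil lid _) _))))
  (scalar_opp (scalar_fun_mul _ (scalar_trace (linear_mull _ (linear_antil
  (linear_antil lid _) _)))))) (scalar_opp (scalar_fun_mul _ (scalar_fun_add
  (scalar_trace (linear_mull _ (linear_mull _ (linear_mull _ (linear_antil
  lid _))))) (scalar_trace (linear_mull _ (linear_mull _ (linear_mull _
  (linear_antil lid _))))))))) (scalar_fun_mulr _ (scalar_fun_mulr _
  (scalar_trace (linear_antil lid _))))) (scalar_opp (scalar_fun_mul _
  (scalar_phi _ (linear_mulr _ (linear_S41 _ _ _)))))) (scalar_fun_mulr _
  (scalar_fun_mul _ (scalar_trace (linear_S41 _ _ _))))) (scalar_opp
  (scalar_fun_mul _ (scalar_fun_add (scalar_fun_add (scalar_fun_add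
  (scalar_fun_mulr _ (scalar_taul lid _)) (scalar_fun_mulr _ (scalar_taul
  lid _))) (scalar_fun_mul _ (scalar_phi _ (linear_mulr _ (linear_antil lid
  _))))) (scalar_fun_mul _ (scalar_phi _ (linear_mulr _ (linear_antil lid
  _)))))))) (scalar_fun_mulr _ (scalar_fun_mul _ (scalar_fun_add
  (scalar_fun_mulr _ (scalar_taul lid _)) (scalar_fun_mulr _ (scalar_taul
  lid _)))))).
Qed.
Lemma P4_linB A C D x y : scalar (fun B => P4 A B C D x y).
Proof.
exact: (scalar_fun_add (scalar_fun_add (scalar_fun_add (scalar_fun_add
  (scalar_fun_add (scalar_fun_add (scalar_fun_add (scalar_fun_mul _
  (scalar_phi _ (linear_mulr _ (linear_antil (linear_antir lid _) _))))
  (scalar_opp (scalar_fun_mul _ (scalar_trace (linear_mull _ (linear_antil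
  (linear_antir lid _) _)))))) (scalar_opp (scalar_fun_mul _ (scalar_fun_add
  (scalar_trace (linear_mull _ (linear_mull _ (linear_mull _ (linear_antir
  lid _))))) (scalar_trace (linear_mull _ (linear_mull _ (linear_mull _
  (linear_antir lid _))))))))) (scalar_fun_mulr _ (scalar_fun_mulr _
  (scalar_trace (linear_antir lid _))))) (scalar_opp (scalar_fun_mul _
  (scalar_phi _ (linear_mulr _ (linear_S42 _ _ _)))))) (scalar_fun_mulr _
  (scalar_fun_mul _ (scalar_trace (linear_S42 _ _ _))))) (scalar_opp
  (scalar_fun_mul _ (scalar_fun_add (scalar_fun_add (scalar_fun_add
  (scalar_fun_mul _ (scalar_phi _ (linear_mulr _ (linear_antil lid _))))
  (scalar_fun_mul _ (scalar_phi _ (linear_mulr _ (linear_antil lid _)))))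
  (scalar_fun_mulr _ (scalar_taul lid _))) (scalar_fun_mulr _ (scalar_taul
  lid _)))))) (scalar_fun_mulr _ (scalar_fun_mul _ (scalar_fun_add
  (scalar_fun_mul _ (scalar_taul lid _)) (scalar_fun_mul _ (scalar_taul lid
  _)))))).
Qed.
Lemma P4_linC A B D x y : scalar (fun C => P4 A B C D x y).
Proof.
exact: (scalar_fun_add (scalar_fun_add (scalar_fun_add (scalar_fun_add
  (scalar_fun_add (scalar_fun_add (scalar_fun_add (scalar_fun_mul _
  (scalar_phi _ (linear_mulr _ (linear_antir (linear_antil lid _) _))))
  (scalar_opp (scalar_fun_mul _ (scalar_trace (linear_mull _ (linear_antir
  (linear_antil lid _) _)))))) (scalar_opp (scalar_fun_mul _ (scalar_fun_add
  (scalar_trace (linear_mull _ (linear_mulr _ (linear_antil lid _))))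
  (scalar_trace (linear_mull _ (linear_mulr _ (linear_antil lid _))))))))
  (scalar_fun_mulr _ (scalar_fun_mul _ (scalar_trace (linear_antil lid
  _))))) (scalar_opp (scalar_fun_mul _ (scalar_phi _ (linear_mulr _
  (linear_S43 _ _ _)))))) (scalar_fun_mulr _ (scalar_fun_mul _ (scalar_trace
  (linear_S43 _ _ _))))) (scalar_opp (scalar_fun_mul _ (scalar_fun_add
  (scalar_fun_add (scalar_fun_add (scalar_fun_mulr _ (scalar_taur lid _))
  (scalar_fun_mul _ (scalar_phi _ (linear_mulr _ (linear_antir lid _)))))
  (scalar_fun_mulr _ (scalar_taur lid _))) (scalar_fun_mul _ (scalar_phi _
  (linear_mulr _ (linear_antir lid _)))))))) (scalar_fun_mulr _
  (scalar_fun_mul _ (scalar_fun_add (scalar_fun_mulr _ (scalar_taur lid _))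
  (scalar_fun_mul _ (scalar_taur lid _)))))).
Qed.
Lemma P4_linD A B C x y : scalar (fun D => P4 A B C D x y).
Proof.
exact: (scalar_fun_add (scalar_fun_add (scalar_fun_add (scalar_fun_add
  (scalar_fun_add (scalar_fun_add (scalar_fun_add (scalar_fun_mul _
  (scalar_phi _ (linear_mulr _ (linear_antir (linear_antir lid _) _))))
  (scalar_opp (scalar_fun_mul _ (scalar_trace (linear_mull _ (linear_antir
  (linear_antir lid _) _)))))) (scalar_opp (scalar_fun_mul _ (scalar_fun_add
  (scalar_trace (linear_mull _ (linear_mulr _ (linear_antir lid _))))
  (scalar_trace (linear_mull _ (linear_mulr _ (linear_antir lid _))))))))
  (scalar_fun_mulr _ (scalar_fun_mul _ (scalar_trace (linear_antir lid
  _))))) (scalar_opp (scalar_fun_mul _ (scalar_phi _ (linear_mulr _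
  (linear_S44 _ _ _)))))) (scalar_fun_mulr _ (scalar_fun_mul _ (scalar_trace
  (linear_S44 _ _ _))))) (scalar_opp (scalar_fun_mul _ (scalar_fun_add
  (scalar_fun_add (scalar_fun_add (scalar_fun_mul _ (scalar_phi _
  (linear_mulr _ (linear_antir lid _)))) (scalar_fun_mulr _ (scalar_taur lid
  _))) (scalar_fun_mul _ (scalar_phi _ (linear_mulr _ (linear_antir lid
  _))))) (scalar_fun_mulr _ (scalar_taur lid _)))))) (scalar_fun_mulr _
  (scalar_fun_mul _ (scalar_fun_add (scalar_fun_mul _ (scalar_taur lid _))
  (scalar_fun_mulr _ (scalar_taur lid _)))))).
Qed.
Lemma P4_linx A B C D y : scalar (fun x => P4 A B C D x y).
Proof.
exact: (scalar_fun_add (scalar_fun_add (scalar_fun_add (scalar_fun_add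
  (scalar_fun_add (scalar_fun_add (scalar_fun_add (scalar_fun_mul _
  (scalar_phi _ (linear_mull _ lidv))) (scalar_opp (scalar_fun_mul _
  (scalar_trace (linear_mulr _ (linear_mxM (linear_mull _ lidv)))))))
  (scalar_opp (scalar_fun_mul _ (scalar_fun_add (scalar_trace (linear_mull _
  (linear_mull _ (linear_mulr _ (linear_mxM lidv))))) (scalar_trace
  (linear_mulr _ (linear_mxM lidv))))))) (scalar_fun_mul _ (scalar_phi _
  lidv))) (scalar_opp (scalar_fun_mul _ (scalar_phi _ (linear_mull _
  lidv))))) (scalar_fun_mul _ (scalar_phi _ lidv))) (scalar_opp
  (scalar_fun_mul _ (scalar_fun_add (scalar_fun_add (scalar_fun_add
  (scalar_fun_mul _ (scalar_phi _ (linear_mull _ lidv))) (scalar_fun_mul _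
  (scalar_phi _ (linear_mull _ lidv)))) (scalar_fun_mul _ (scalar_phi _
  (linear_mull _ lidv)))) (scalar_fun_mul _ (scalar_phi _ (linear_mull _
  lidv))))))) (scalar_fun_mul _ (scalar_phi _ lidv))).
Qed.
Lemma P4_liny A B C D x : scalar (fun y => P4 A B C D x y).
Proof.
exact: (scalar_fun_add (scalar_fun_add (scalar_fun_add (scalar_fun_add
  (scalar_fun_add (scalar_fun_add (scalar_fun_add (scalar_fun_mul _
  (scalar_phir _ lidv)) (scalar_opp (scalar_fun_mul _ (scalar_trace
  (linear_mulr _ (linear_mxM (linear_mulr _ (linear_mxM lidv))))))))
  (scalar_opp (scalar_fun_mul _ (scalar_fun_add (scalar_trace (linear_mulr _
  (linear_mxM lidv))) (scalar_trace (linear_mull _ (linear_mull _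
  (linear_mulr _ (linear_mxM lidv))))))))) (scalar_fun_mul _ (scalar_phir _
  lidv))) (scalar_opp (scalar_fun_mul _ (scalar_phir _ lidv))))
  (scalar_fun_mul _ (scalar_phir _ lidv))) (scalar_opp (scalar_fun_mul _
  (scalar_fun_add (scalar_fun_add (scalar_fun_add (scalar_fun_mul _
  (scalar_phir _ lidv)) (scalar_fun_mul _ (scalar_phir _ lidv)))
  (scalar_fun_mul _ (scalar_phir _ lidv))) (scalar_fun_mul _ (scalar_phir _
  lidv)))))) (scalar_fun_mul _ (scalar_phir _ lidv))).
Qed.
Lemma Q4_linA B C D : scalar (fun A => Q4 A B C D).
Proof.
exact: (scalar_fun_add (scalar_fun_mul _ (scalar_fun_add (scalar_fun_add
  (scalar_trace (linear_mull _ (linear_mull _ lid))) (scalar_trace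
  (linear_mull _ (linear_mull _ lid)))) (scalar_trace (linear_mull _
  (linear_mulr _ lid))))) (scalar_opp (scalar_fun_add (scalar_fun_add
  (scalar_fun_mulr _ (scalar_taul lid _)) (scalar_fun_mulr _ (scalar_taul
  lid _))) (scalar_fun_mulr _ (scalar_taul lid _))))).
Qed.
Lemma Q4_linB A C D : scalar (fun B => Q4 A B C D).
Proof.
exact: (scalar_fun_add (scalar_fun_mul _ (scalar_fun_add (scalar_fun_add
  (scalar_trace (linear_mull _ (linear_mulr _ lid))) (scalar_trace
  (linear_mulr _ (linear_mull _ lid)))) (scalar_trace (linear_mull _
  (linear_mull _ lid))))) (scalar_opp (scalar_fun_add (scalar_fun_add
  (scalar_fun_mulr _ (scalar_taur lid _)) (scalar_fun_mul _ (scalar_taul lid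
  _))) (scalar_fun_mul _ (scalar_taul lid _))))).
Qed.
Lemma Q4_linC A B D : scalar (fun C => Q4 A B C D).
Proof.
exact: (scalar_fun_add (scalar_fun_mul _ (scalar_fun_add (scalar_fun_add
  (scalar_trace (linear_mulr _ (linear_mull _ lid))) (scalar_trace
  (linear_mull _ (linear_mulr _ lid)))) (scalar_trace (linear_mulr _
  (linear_mull _ lid))))) (scalar_opp (scalar_fun_add (scalar_fun_add
  (scalar_fun_mul _ (scalar_taul lid _)) (scalar_fun_mulr _ (scalar_taur lid
  _))) (scalar_fun_mul _ (scalar_taur lid _))))).
Qed.
Lemma Q4_linD A B C : scalar (fun D => Q4 A B C D).
Proof.
exact: (scalar_fun_add (scalar_fun_mul _ (scalar_fun_add (scalar_fun_add
  (scalar_trace (linear_mulr _ (linear_mulr _ lid))) (scalar_trace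
  (linear_mulr _ (linear_mulr _ lid)))) (scalar_trace (linear_mulr _
  (linear_mulr _ lid))))) (scalar_opp (scalar_fun_add (scalar_fun_add
  (scalar_fun_mul _ (scalar_taur lid _)) (scalar_fun_mul _ (scalar_taur lid
  _))) (scalar_fun_mulr _ (scalar_taur lid _))))).
Qed.


(** * Correctness of the computed expressions *)

Lemma mx_santi A B : mx (santi A B) = antimx (mx A) (mx B).
Proof. by rewrite mx_snorm mx_sadd !mx_smul. Qed.
Lemma mx_sbr A B : mx (sbr A B) = brk (mx A) (mx B).
Proof. by rewrite mx_snorm mx_ssub !mx_smul. Qed.
Lemma mx_sdbr A B C : mx (sdbr A B C) = dbr (mx A) (mx B) (mx C).
Proof. by rewrite mx_sadd !mx_sbr. Qed.
Lemma mx_sS4 A B C D : mx (sS4 A B C D) = S4 (mx A) (mx B) (mx C) (mx D).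
Proof.
by rewrite !mx_sadd mx_sscale mx_sadd zL2 !mx_santi !mx_sdbr !mx_sbr.
Qed.
Lemma zL_stau A B : zL (stau A B) = taumx (mx A) (mx B).
Proof. by rewrite strace_mx mx_smul. Qed.

Lemma smi_comm (i j p : 'I_26) : mx (smi i) j p = mx (smi j) i p.
Proof.
have := MC_ok; move=> /allP/(_ i); rewrite mem_iota ltn_ord => /(_ isT)/allP/(_ j).
by rewrite mem_iota ltn_ord => /(_ isT)/eqP E; rewrite !mxE E.
Qed.

Lemma mxMC (x y : V) : x *m mxM y = y *m mxM x.
Proof.
have E (u v : V) : u *m mxM v =
    \sum_i \sum_j (u 0 i * v 0 j) *: row i (mx (smi j)).
  rewrite {1}(rv_delta u) mulmx_suml; apply: eq_bigr => i _.
  rewrite -scalemxAl -rowE /mxM linear_sum scaler_sumr; apply: eq_bigr => j _.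
  by rewrite linearZ scalerA.
rewrite !E exchange_big /=; apply: eq_bigr => i _; apply: eq_bigr => j _.
by rewrite mulrC; congr (_ *: _); apply/rowP => p; rewrite [LHS]mxE [RHS]mxE smi_comm.
Qed.

Lemma mx_sQ (p s y : 'I_26) : mx (sQ p) s y = mx (smi y) s p.
Proof.
have E : srw (sQ p) s = srw (str (smi s)) p.
  rewrite /sQ MTs_ok /srw (nth_map [::]) ?size_map ?(ltn_ord s) //.
  by rewrite (nth_map [::]) // ltn_ord.
have -> : mx (sQ p) s y = mx (str (smi s)) p y by rewrite !mxE E.
by rewrite mx_str mxE smi_comm.
Qed.

Lemma rv_flatten (I : Type) (F : I -> srow) r :
  rv (flatten [seq F i | i <- r]) = \sum_(i <- r) rv (F i).
Proof.
elim: r => [|i r IH] /=; first by rewrite big_nil rv_nil.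
by rewrite rv_cat IH big_cons.
Qed.

Lemma mx_sTLL a c (x y : 'I_26) : mx (sTLL a c) x y =
  \tr (mx a *m mxM (delta_mx 0 x) *m mx c *m mxM (delta_mx 0 y)).
Proof.
rewrite !mxM_delta.
have -> : mx (sTLL a c) x y = rv (srw (sTLL a c) x) 0 y by rewrite !mxE.
rewrite /sTLL srw_iota rv_flatten -[iota 0 26]/(index_iota 0 26) big_mkord.
rewrite summxE /mxtrace; apply: eq_bigr => p _.
rewrite !rv_rowmul_take mxE [RHS]mxE; apply: eq_bigr => s _.
rewrite mx_sQ; congr (_ * _).
by rewrite -row_mx -!row_mul mxE.
Qed.

Lemma mx_sTL T (x y : 'I_26) : mx (sTL T) x y =
  \tr (mx T *m mxM (delta_mx 0 x *m mxM (delta_mx 0 y))).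
Proof.
rewrite mxM_delta -rowE.
have -> : mx (sTL T) x y = rv (srw (sTL T) x) 0 y by rewrite !mxE.
rewrite /sTL srw_iota -map_comp rv_flatten -[iota 0 26]/(index_iota 0 26).
rewrite big_mkord summxE /mxM mulmx_sumr linear_sum; apply: eq_bigr => l _ /=.
rewrite rv_scale -row_mx strace_mx mx_smul -scalemxAr linearZ /=.
by rewrite [LHS]mxE mulrC; congr (_ * _); rewrite [LHS]mxE [RHS]mxE mx_sQ.
Qed.

Lemma phi_delta T (x y : 'I_26) :
  phi (delta_mx 0 x *m T) (delta_mx 0 y) = (T *m mphi) x y.
Proof.
rewrite /phi trmx_delta -[_ *m T *m mphi]mulmxA -rowE -colE.
by rewrite [LHS]mxE [LHS]mxE.
Qed.

Lemma phi_delta1 (x y : 'I_26) : phi (delta_mx 0 x) (delta_mx 0 y) = mphi x y.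
Proof. by rewrite -[delta_mx 0 x]mulmx1 phi_delta mul1mx. Qed.

Local Opaque sS4 santi sTL sTLL stau strace antimx S4 taumx.

Lemma lin_entry c1 c2 c3 c4 c5 t1 t2 t3 t4 z (T1 T2 T3 X S Y1 Y2 Y3 Y4 Ph : M) i j :
  (c1 *: T1 + c2 *: (T2 + T3) + (c3 *: X + (c4 *: S + (c5 *:
    (t1 *: Y1 + t2 *: Y2 + (t3 *: Y3 + t4 *: Y4)) + z *: 1%:M))) *m Ph) i j
  = c1 * T1 i j + c2 * (T2 i j + T3 i j) + c3 * (X *m Ph) i j + c4 * (S *m Ph) i j
  + c5 * (t1 * (Y1 *m Ph) i j + t2 * (Y2 *m Ph) i j + (t3 * (Y3 *m Ph) i j
    + t4 * (Y4 *m Ph) i j)) + z * Ph i j.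
Proof.
have mxD (A B : M) : (A + B) i j = A i j + B i j by rewrite mxE.
have mxZ c (A : M) : (c *: A) i j = c * A i j by rewrite mxE.
rewrite !(mulmxDl, =^~ scalemxAl, mxD, mxZ) mul1mx.
by rewrite !(mulrDr, mulrA, addrA).
Qed.

Lemma zLc (n : nat) c : c = Z.of_nat n -> zL c = n%:R.
Proof. by move=> ->; rewrite zLn. Qed.
Lemma zLnc (n : nat) c : c = Z.opp (Z.of_nat n) -> zL c = - n%:R.
Proof. by move=> ->; rewrite zLN zLn. Qed.

Lemma mx_sP4 A B C D (x y : 'I_26) : mx (sP4 A B C D) x y =
  P4 (mx A) (mx B) (mx C) (mx D) (delta_mx 0 x) (delta_mx 0 y).
Proof.
rewrite /P4 !phi_delta phi_delta1 /sP4.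
rewrite mx_sadd mx_sadd mx_sscale mx_sscale mx_sadd mx_smul.
rewrite mx_sadd mx_sscale mx_sadd mx_sscale mx_sadd mx_sscale.
rewrite mx_sadd mx_sadd mx_sadd !mx_sscale mx_sone !mx_santi mx_sS4.
rewrite !zL_stau zLD zLD zLM zLM zLM zLD zLM zLM !zL_stau.
rewrite strace_mx strace_mx strace_mx mx_sS4 !mx_santi.
rewrite (zLnc (n := 3)) // (zLnc (n := 6)) // (zLc (n := 216)) //.
rewrite (zLnc (n := 108)) // (zLnc (n := 36)) // (zLc (n := 3)) //.
rewrite (zLc (n := 4)) // lin_entry mx_sTL !mx_sTLL !mx_santi.
have -> : \tr (antimx (mx C) (mx D) *m mxM (delta_mx 0 x) *m antimx (mx A) (mx B)
     *m mxM (delta_mx 0 y)) = \tr (antimx (mx A) (mx B) *m mxM (delta_mx 0 y) *m antimx (mx C) (mx D)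
     *m mxM (delta_mx 0 x)).
  by rewrite -mulmxA mxtrace_mulC mulmxA.
set a := antimx (mx A) (mx B); set c := antimx (mx C) (mx D).
rewrite -/mphi; ring.
Qed.

Lemma zL_sQ4 A B C D : zL (sQ4 A B C D) = Q4 (mx A) (mx B) (mx C) (mx D).
Proof.
rewrite /sQ4 /Q4.
rewrite zLD zLM zLD zLD strace_mx strace_mx strace_mx !mx_smul (zLc (n := 12)) //.
by rewrite zLN zLD zLD zLM zLM zLM !zL_stau.
Qed.

Lemma sl_delta (F : V -> L) : scalar F ->
  forall x, F x = \sum_i x 0 i * F (delta_mx 0 i).
Proof.
move=> lF x; pose FL := GRing.isLinear.Build L V _ _ F lF.
pose f : {scalar V} := HB.pack F FL.
rewrite -[LHS]/(f x) (rv_delta x) linear_sum; apply: eq_bigr => i _.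
by rewrite linearZ -(rv_delta x).
Qed.

Lemma scalar_closed (I : Type) (F : M -> I -> L) (P : I -> Prop) :
  (forall i, scalar (F^~ i)) -> lclosed (fun A => forall i, P i -> F A i = 0).
Proof.
by move=> lF c A B hA hB i Pi; rewrite lF hA // hB // mulr0 addr0.
Qed.

(** A and B are reduced by [reduce2], C by [reduce_levi], D by [span_Gs], and x, y to basis vectors;
    [P4_ok] covers what is left. *)
Theorem P4_der A B C D x y : in_der A -> in_der B -> in_der C -> in_der D ->
  P4 A B C D x y = 0.
Proof.
move=> hA hB hC hD; move: A B hA hB C D hC hD x y.
pose H A B := forall C D, in_der C -> in_der D -> forall x y, P4 A B C D x y = 0.
apply: (reduce2 (H := H)).
- by move=> Y c A B hA hB C D hC hD x y; rewrite P4_linA hA // hB // mulr0 addr0.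
- by move=> X c A B hA hB C D hC hD x y; rewrite P4_linB hA // hB // mulr0 addr0.
- move=> g g' ag X Y hXY C D hC hD x y.
  have gg' : g *m g' = 1%:M by case: ag.
  have g'g : g' *m g = 1%:M by case: ag.
  (* Writing the other arguments as conjugates lets [P4_conj] move the automorphism onto all
     arguments at once. *)
  have cc Z : Z = g' *m (g *m Z *m g') *m g.
    by rewrite !mulmxA g'g mul1mx -mulmxA g'g mulmx1.
  have xx (z : V) : z = z *m g' *m g by rewrite -mulmxA g'g mulmx1.
  rewrite (cc C) (cc D) (xx x) (xx y) P4_conj //.
  by apply: hXY; apply: in_der_conj => //; apply: auto_inv.
move=> C D hC; move: C hC D.
suff h : forall C, in_der C -> forall D, in_der D ->
    forall x y, P4 (mx sE) (mx sF) C D x y = 0 by move=> C hC D; apply: h.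
apply: (reduce_levi (Q := fun C => forall D, in_der D -> forall x y,
  P4 (mx sE) (mx sF) C D x y = 0)) => [c A B hA hB D hD x y|g g' ag fE fF X hX D hD x y|C CL].
- by rewrite P4_linC hA // hB // mulr0 addr0.
- have gg' : g *m g' = 1%:M by case: ag.
  have g'g : g' *m g = 1%:M by case: ag.
  have cc Z : Z = g' *m (g *m Z *m g') *m g.
    by rewrite !mulmxA g'g mul1mx -mulmxA g'g mulmx1.
  have xx (z : V) : z = z *m g' *m g by rewrite -mulmxA g'g mulmx1.
  rewrite (cc D) (xx x) (xx y) -fE -fF P4_conj //.
  by apply: hX; apply: in_der_conj => //; apply: auto_inv.
apply: (span_Gs (Q := fun D => forall x y, P4 (mx sE) (mx sF) (mx C) D x y = 0)) => [c A B hA hB x y|D DG x y].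
  by rewrite P4_linD hA // hB // mulr0 addr0.
have h0 (i j : 'I_26) : P4 (mx sE) (mx sF) (mx C) (mx D) (delta_mx 0 i) (delta_mx 0 j) = 0.
  rewrite -mx_sP4 (szero_mx L (allP (allP P4_ok C CL) D DG)).
  by rewrite mxE.
rewrite (sl_delta (P4_linx _ _ _ _ y)) big1 // => i _.
rewrite (sl_delta (P4_liny _ _ _ _ (delta_mx 0 i))) big1 ?mulr0 // => j _.
by rewrite h0 mulr0.
Qed.

Theorem Q4_der A B C D : in_der A -> in_der B -> in_der C -> in_der D ->
  Q4 A B C D = 0.
Proof.
move=> hA hB hC hD; move: A B hA hB C D hC hD.
pose H A B := forall C D, in_der C -> in_der D -> Q4 A B C D = 0.
apply: (reduce2 (H := H)).
- by move=> Y c A B hA hB C D hC hD; rewrite Q4_linA hA // hB // mulr0 addr0.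
- by move=> X c A B hA hB C D hC hD; rewrite Q4_linB hA // hB // mulr0 addr0.
- move=> g g' ag X Y hXY C D hC hD.
  have g'g : g' *m g = 1%:M by case: ag.
  have cc Z : Z = g' *m (g *m Z *m g') *m g.
    by rewrite !mulmxA g'g mul1mx -mulmxA g'g mulmx1.
  rewrite (cc C) (cc D) Q4_conj //.
  by apply: hXY; apply: in_der_conj => //; apply: auto_inv.
move=> C D hC; move: C hC D.
suff h : forall C, in_der C -> forall D, in_der D ->
    Q4 (mx sE) (mx sF) C D = 0 by move=> C hC D; apply: h.
apply: (reduce_levi (Q := fun C => forall D, in_der D ->
  Q4 (mx sE) (mx sF) C D = 0)) => [c A B hA hB D hD|g g' ag fE fF X hX D hD|C CL].
- by rewrite Q4_linC hA // hB // mulr0 addr0.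
- have g'g : g' *m g = 1%:M by case: ag.
  have cc Z : Z = g' *m (g *m Z *m g') *m g.
    by rewrite !mulmxA g'g mul1mx -mulmxA g'g mulmx1.
  rewrite (cc D) -fE -fF Q4_conj //.
  by apply: hX; apply: in_der_conj => //; apply: auto_inv.
apply: (span_Gs (Q := fun D => Q4 (mx sE) (mx sF) (mx C) D = 0)) => [c A B hA hB|D DG].
  by rewrite Q4_linD hA // hB // mulr0 addr0.
by rewrite -zL_sQ4; have /Z.eqb_eq -> := allP (allP Q4_ok C CL) D DG.
Qed.

Theorem Z3_der A B z : in_der A -> in_der B -> \tr (A *m B *m mxM z) = 0.
Proof.
move=> hA hB; move: A B hA hB z.
pose H (A B : M) := forall z : V, \tr (A *m B *m mxM z) = 0.
have ztr0 z : \tr (mx sE *m mx sF *m mxM z) = 0.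
  rewrite (sl_delta (F := fun z => \tr (mx sE *m mx sF *m mxM z))); last first.
    exact: (scalar_trace (linear_mulr _ mxM_linear)).
  rewrite big1 // => i _; rewrite mxM_delta -!mx_smul -strace_mx.
  have mi : smi i \in Ms by apply: mem_nth; apply: ltn_ord.
  by have /Z.eqb_eq -> := allP Z3_ok _ mi; rewrite mulr0.
apply: (reduce2 (H := H)) => //.
- move=> Y c A B hA hB z.
  by rewrite !mulmxDl -!scalemxAl linearP /= hA hB mulr0 addr0.
- move=> X c A B hA hB z.
  by rewrite mulmxDr -scalemxAr mulmxDl -scalemxAl linearP /= hA hB mulr0 addr0.
move=> g g' ag X Y hXY z.
have g'g : g' *m g = 1%:M by case: ag.
have -> : z = z *m g' *m g by rewrite -mulmxA g'g mulmx1.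
by rewrite Z3_conj.
Qed.

End Model.

(** * Symmetry, associativity and the cubic identity in the split model *)

Lemma Phi_sym_ok : eq_smat (str Phi) Phi. Proof. by vm_cast_no_check (erefl true). Qed.
Lemma assoc_ok : all (fun A => eq_smat (smul A Phi) (smul Phi (str A))) Ms.
Proof. by vm_cast_no_check (erefl true). Qed.

Definition scubic i j : bool := eq_smat
  (sadd (sadd (smul (smi j) (smi i)) (smul (smi i) (smi j)))
    (scomb [seq coef (srw (smi i) j) l | l <- iota 0 26] Ms))
  (sscale 6%bZ (sadd (sadd (smul Phi (sdelta i j)) (smul Phi (sdelta j i)))
     (sscale (coef (srw Phi i) j) sone))).
Lemma cubic_ok : all (fun i => all (scubic i) (iota 0 26)) (iota 0 26).
Proof. by vm_cast_no_check (erefl true). Qed.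
(** Three times the inverse of [Phi]: the 2 x 2 block is inverted by hand and the rest of [Phi] is
    its own inverse. *)
Definition Psi : smat :=
  [:: [:: (0%N, 2%bZ); (1%N, (-1)%bZ)], [:: (0%N, (-1)%bZ); (1%N, 2%bZ)]
    & sscale 3%bZ (drop 2 Phi)].
Lemma Phi_inv_ok : eq_smat (smul Phi Psi) (sscale 3%bZ sone).
Proof. by vm_cast_no_check (erefl true). Qed.

Section ModelIdentities.
Variable L : fieldType.
Local Notation V := 'rV[L]_26.
Local Notation mx := (mx L).

Lemma mphi_sym : (mphi L)^T = mphi L.
Proof. by rewrite /mphi -mx_str; apply: eq_smat_mx Phi_sym_ok. Qed.

Lemma mphi_free (x : V) : 3%:R != 0 :> L -> (forall y, phi x y = 0) -> x = 0.
Proof.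
move=> n3 h; have /eqP := eq_smat_mx L Phi_inv_ok.
rewrite mx_smul mx_sscale mx_sone (zLc L (n := 3)) // -/(mphi L) => /eqP E.
have x0 : x *m mphi L = 0.
  apply/rowP => i; rewrite [RHS]mxE -(h (delta_mx 0 i)) /phi trmx_delta [RHS]mxE.
  rewrite (bigD1 i) //= big1 => [|l li]; last first.
    by rewrite [delta_mx _ _ _ _]mxE (negPf li) mulr0.
  by rewrite [delta_mx _ _ _ _]mxE !eqxx mulr1 addr0.
have := congr1 (fun A => x *m A) E; rewrite mulmxA x0 mul0mx -scalemxAr mulmx1.
by move/esym/eqP; rewrite scaler_eq0 (negPf n3) /= => /eqP.
Qed.

Lemma mxM_tr (x : V) : \tr (mxM x) = 0.
Proof.
rewrite /mxM linear_sum big1 // => l _; rewrite linearZ /= -strace_mx.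
have mi : smi l \in Ms by apply: mem_nth; apply: ltn_ord.
by have /Z.eqb_eq -> := allP M_tr_ok _ mi; rewrite mulr0.
Qed.

Lemma mxM_adj (x : V) : mxM x *m mphi L = mphi L *m (mxM x)^T.
Proof.
rewrite /mxM mulmx_suml linear_sum mulmx_sumr; apply: eq_bigr => l _.
rewrite linearZ /= -scalemxAl -scalemxAr; congr (_ *: _).
have mi : smi l \in Ms by apply: mem_nth; apply: ltn_ord.
by have := eq_smat_mx L (allP assoc_ok _ mi); rewrite !mx_smul mx_str.
Qed.

Lemma phi_assoc (x y z : V) : phi (x *m mxM y) z = phi x (y *m mxM z).
Proof.
by rewrite /phi [y *m _]mxMC trmx_mul !mulmxA -(mulmxA x (mxM y)) mxM_adj !mulmxA.
Qed.

Lemma mxM_cubic (a c : V) : mxM c *m mxM a + mxM a *m mxM c + mxM (c *m mxM a)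
  = 6%:R *: (mphi L *m a^T *m c + mphi L *m c^T *m a + (phi a c)%:M).
Proof.
have hM := @mxM_linear L.
move: a; apply: (eq_linear_delta (F := fun a => _) (G := fun a => _)).
- lin; move=> t u v; by rewrite hM mulmxDr -scalemxAr hM.
- lin; move=> t u v; by rewrite phi_linearl raddfD /= scale_scalar_mx.
move=> i; move: c; apply: (eq_linear_delta (F := fun a => _) (G := fun a => _)).
- lin; move=> t u v; by rewrite mulmxDl -scalemxAl hM.
- lin; move=> t u v; by rewrite phi_linear raddfD /= scale_scalar_mx.
move=> j; have iI : (i : nat) \in iota 0 26 by rewrite mem_iota ltn_ord.
have jI : (j : nat) \in iota 0 26 by rewrite mem_iota ltn_ord.
have := eq_smat_mx L (allP (allP cubic_ok _ iI) _ jI).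
rewrite !(mx_sadd, mx_smul, mx_sscale) mx_sone !mx_sdelta mxM_rv.
rewrite (zLc L (n := 6)) // -row_mx !mxM_delta -rowE phi_delta1 => ->.
rewrite -!mulmxA !trmx_delta !mul_delta_mx.
by rewrite scalemx1 [mphi L i j]mxE.
Qed.
End ModelIdentities.

(** * The integer model is the traceless part of the split Albert algebra *)

Section Oct.
Variable L : fieldType.
Hypothesis n2 : 2%:R != 0 :> L.
Hypothesis n3 : 3%:R != 0 :> L.

Definition m2 (a b c d : L) : 'M[L]_2 := \matrix_(i, j)
  if (i : nat) == 0%N then if (j : nat) == 0%N then a else b
  else if (j : nat) == 0%N then c else d.

Definition o8 a b c d a' b' c' d' : oct L := (m2 a b c d, m2 a' b' c' d').

Lemma m2P (A B : 'M[L]_2) : A 0 0 = B 0 0 -> A 0 1 = B 0 1 ->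
  A 1 0 = B 1 0 -> A 1 1 = B 1 1 -> A = B.
Proof.
move=> h00 h01 h10 h11; apply/matrixP => i j.
have ord2 (l : 'I_2) : l = 0 \/ l = 1.
  by case: l => [[|[|//]] h]; [left|right]; apply: val_inj.
by case: (ord2 i) => ->; case: (ord2 j) => ->.
Qed.

Lemma m2E (A : 'M[L]_2) : A = m2 (A 0 0) (A 0 1) (A 1 0) (A 1 1).
Proof. by apply: m2P; rewrite mxE. Qed.

Lemma m2M a b c d a' b' c' d' : m2 a b c d *m m2 a' b' c' d' =
  m2 (a * a' + b * c') (a * b' + b * d') (c * a' + d * c') (c * b' + d * d').
Proof. by apply: m2P; rewrite !mxE !big_ord_recl big_ord0 !mxE /= addr0. Qed.

Lemma m2D a b c d a' b' c' d' : m2 a b c d + m2 a' b' c' d' =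
  m2 (a + a') (b + b') (c + c') (d + d').
Proof. by apply: m2P; rewrite !mxE. Qed.

Lemma m2N a b c d : - m2 a b c d = m2 (- a) (- b) (- c) (- d).
Proof. by apply: m2P; rewrite !mxE. Qed.

Lemma m2Z t a b c d : t *: m2 a b c d = m2 (t * a) (t * b) (t * c) (t * d).
Proof. by apply: m2P; rewrite !mxE. Qed.

Lemma m2_adj a b c d : \adj (m2 a b c d) = m2 d (- b) (- c) a.
Proof.
by apply: m2P; rewrite !mxE /cofactor det_mx11 !mxE /=
  ?(expr0, expr1, expr2, mul1r, mulN1r, mulrN1, opprK).
Qed.

Lemma o8M a b c d a' b' c' d' x y z t x' y' z' t' :
  oct_mul (o8 a b c d a' b' c' d') (o8 x y z t x' y' z' t') =
  o8 (a * x + b * z + (t' * a' + - y' * c')) (a * y + b * t + (t' * b' + - y' * d'))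
     (c * x + d * z + (- z' * a' + x' * c')) (c * y + d * t + (- z' * b' + x' * d'))
     (x' * a + y' * c + (a' * t + b' * - z)) (x' * b + y' * d + (a' * - y + b' * x))
     (z' * a + t' * c + (c' * t + d' * - z)) (z' * b + t' * d + (c' * - y + d' * x)).
Proof. by rewrite /oct_mul /= !m2_adj !m2M !m2D. Qed.

Lemma o8D a b c d a' b' c' d' x y z t x' y' z' t' :
  o8 a b c d a' b' c' d' + o8 x y z t x' y' z' t' =
  o8 (a + x) (b + y) (c + z) (d + t) (a' + x') (b' + y') (c' + z') (d' + t').
Proof. by rewrite /o8 -[LHS]/(_ + _, _ + _) !m2D. Qed.

Lemma o8Z u a b c d a' b' c' d' : u *: o8 a b c d a' b' c' d' =
  o8 (u * a) (u * b) (u * c) (u * d) (u * a') (u * b') (u * c') (u * d').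
Proof. by rewrite /o8 -[LHS]/(_ *: _, _ *: _) !m2Z. Qed.

Lemma o8_conj a b c d a' b' c' d' : oct_conj (o8 a b c d a' b' c' d') =
  o8 d (- b) (- c) a (- a') (- b') (- c') (- d').
Proof. by rewrite /oct_conj /= m2_adj m2N. Qed.

Lemma o8_one u : u *: oct_one L = o8 u 0 0 u 0 0 0 0.
Proof.
rewrite /oct_one -[LHS]/(_ *: _, _ *: _) scaler0; congr (_, _).
  by apply: m2P; rewrite !mxE /= ?mulr1 ?mulr0.
by apply: m2P; rewrite !mxE.
Qed.

Definition hmx (u v w : L) (a b c : oct L) : oct_mx3 L :=
  [ffun p => match val p.1, val p.2 with
   | 0%N, 0%N => u *: oct_one L | 0%N, 1%N => a | 0%N, _ => b
   | 1%N, 0%N => oct_conj a | 1%N, 1%N => v *: oct_one L | 1%N, _ => c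
   | _, 0%N => oct_conj b | _, 1%N => oct_conj c | _, _ => w *: oct_one L
   end].

Definition oct_at (X : nat -> L) (n : nat) : oct L :=
  o8 (X n) (X n.+1) (X n.+2) (X n.+3)
     (X n.+4) (X n.+4.+1) (X n.+4.+2) (X n.+4.+3).

Definition herm_fun (X : nat -> L) : oct_mx3 L :=
  hmx (X 0%N) (X 1%N) (- X 0%N - X 1%N) (oct_at X 2) (oct_at X 10) (oct_at X 18).

Definition herm_of (x : 'rV[L]_26) : oct_mx3 L := herm_fun (fun n => x 0 (inord n)).

Definition mx3_one : oct_mx3 L := hmx 1 1 1 0 0 0.

(** Symbolic bilinear form giving coordinate l of [x *m mxM y], so that products can be expanded
    into polynomials. *)
Definition terms (l : nat) : seq (nat * nat * Z) :=
  flatten [seq flatten [seq [seq (q, i, e.2) | e <- srw (smi i) q & e.1 == l]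
    | q <- iota 0 26] | i <- iota 0 26].

Definition eval_terms (x y : nat -> L) (s : seq (nat * nat * Z)) : L :=
  foldr (fun t r => zL L t.2 * (x t.1.1 * y t.1.2) + r) 0 s.

Lemma eval_terms_cat x y s t :
  eval_terms x y (s ++ t) = eval_terms x y s + eval_terms x y t.
Proof. by elim: s => [|u s IH] /=; rewrite ?add0r // IH addrA. Qed.

Lemma eval_terms_flatten x y (F : nat -> seq (nat * nat * Z)) n :
  eval_terms x y (flatten [seq F i | i <- iota 0 n]) =
  \sum_(i < n) eval_terms x y (F i).
Proof.
rewrite -(big_mkord xpredT (fun i => eval_terms x y (F i))) /index_iota subn0.
elim: (iota 0 n) => [|i s IH] /=; first by rewrite big_nil.
by rewrite eval_terms_cat IH big_cons.
Qed.

Lemma mulM_coord (x y : 'rV[L]_26) (l : 'I_26) : (x *m mxM y) 0 l =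
  eval_terms (fun n => x 0 (inord n)) (fun n => y 0 (inord n)) (terms l).
Proof.
rewrite /terms eval_terms_flatten mxE.
under [RHS]eq_bigr => i _ do rewrite eval_terms_flatten.
rewrite exchange_big /=; apply: eq_bigr => q _.
rewrite /mxM summxE mulr_sumr; apply: eq_bigr => i _.
rewrite !mxE mulrA mulrC.
elim: (srw (smi i) q) => [|e s IH] /=; first by rewrite zL0 mul0r.
by case: eqP => // _ /=; rewrite zLD mulrDl IH !inord_val.
Qed.

Definition pterms : seq (nat * nat * Z) :=
  flatten [seq [seq (i, e.1, e.2) | e <- srw Phi i] | i <- iota 0 26].

Lemma phi_coord (x y : 'rV[L]_26) : phi x y =
  eval_terms (fun n => x 0 (inord n)) (fun n => y 0 (inord n)) pterms.
Proof.
rewrite /pterms eval_terms_flatten /phi -mulmxA mxE; apply: eq_bigr => i _.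
rewrite mxE mulr_sumr.
have hb : all (fun e : nat * Z => (e.1 < 26)%N) (srw Phi i).
  have : all (fun r => all (fun e : nat * Z => (e.1 < 26)%N) r) Phi by [].
  by move/allP; apply; apply: mem_nth; apply: ltn_ord.
under eq_bigr => j _ do rewrite !mxE.
elim: (srw Phi i) hb => [|e s IH] /=.
  by move=> _; rewrite big1 // => j _; rewrite zL0 mul0r mulr0.
case/andP => he hs; rewrite -IH // -[e.1]/(val (Ordinal he)).
rewrite (bigD1 (Ordinal he)) //= eqxx zLD.
rewrite [in RHS](bigD1 (Ordinal he)) //= addrA; congr (_ + _).
  by rewrite -[e.1]/(val (Ordinal he)) !inord_val; ring.
apply: eq_bigr => j; rewrite -val_eqE /= => /negPf h.
by rewrite eq_sym h.
Qed.

Lemma o8_eq a b c d a' b' c' d' x y z t x' y' z' t' :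
  a = x -> b = y -> c = z -> d = t -> a' = x' -> b' = y' -> c' = z' -> d' = t' ->
  o8 a b c d a' b' c' d' = o8 x y z t x' y' z' t'.
Proof. by move=> -> -> -> -> -> -> -> ->. Qed.

Lemma inord_coord (x y : 'rV[L]_26) n : (n < 26)%N -> (x *m mxM y) 0 (inord n) =
  eval_terms (fun n => x 0 (inord n)) (fun n => y 0 (inord n)) (terms n).
Proof. by move=> h; rewrite mulM_coord inordK. Qed.

Lemma o8_0 : 0 = o8 0 0 0 0 0 0 0 0.
Proof. by rewrite -(scale0r (oct_one L)) o8_one. Qed.

Lemma sum3 (F : 'I_3 -> oct L) :
  \sum_l F l = F (inord 0) + F (inord 1) + F (inord 2).
Proof.
rewrite !big_ord_recr big_ord0 /= add0r.
by congr (F _ + F _ + F _); apply: val_inj; rewrite /= inordK.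
Qed.

Lemma mx3P (u v : oct_mx3 L) :
  (forall i j, (i < 3)%N -> (j < 3)%N -> u (inord i, inord j) = v (inord i, inord j)) -> u = v.
Proof. by move=> h; apply/ffunP => -[i j]; rewrite -[i]inord_val -[j]inord_val h. Qed.

Lemma hmxE u v w a b c i j : (i < 3)%N -> (j < 3)%N ->
  hmx u v w a b c (inord i, inord j) = match i, j with
   | 0%N, 0%N => u *: oct_one L | 0%N, 1%N => a | 0%N, _ => b
   | 1%N, 0%N => oct_conj a | 1%N, 1%N => v *: oct_one L | 1%N, _ => c
   | _, 0%N => oct_conj b | _, 1%N => oct_conj c | _, _ => w *: oct_one L
   end.
Proof. by move=> hi hj; rewrite ffunE /= !inordK. Qed.

Definition zc := (zLc L (n := 1) (c := 1%bZ) erefl, zLc L (n := 2) (c := 2%bZ) erefl,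
  zLc L (n := 3) (c := 3%bZ) erefl, zLc L (n := 4) (c := 4%bZ) erefl,
  zLnc L (n := 1) (c := (-1)%bZ) erefl, zLnc L (n := 2) (c := (-2)%bZ) erefl,
  zLnc L (n := 3) (c := (-3)%bZ) erefl, zLnc L (n := 4) (c := (-4)%bZ) erefl).

Lemma mx3_jordanE (u v : oct_mx3 L) i j : mx3_jordan u v (i, j) =
  2%:R^-1 *: (oct_mul (u (i, inord 0)) (v (inord 0, j))
    + oct_mul (u (i, inord 1)) (v (inord 1, j))
    + oct_mul (u (i, inord 2)) (v (inord 2, j))
    + (oct_mul (v (i, inord 0)) (u (inord 0, j))
    + oct_mul (v (i, inord 1)) (u (inord 1, j))
    + oct_mul (v (i, inord 2)) (u (inord 2, j)))).
Proof. by rewrite !ffunE !sum3. Qed.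

Lemma mx3_linE (u v : oct_mx3 L) t p : (u + t *: v) p = u p + t *: v p.
Proof. by rewrite 2!ffunE. Qed.

Lemma scale_coord c (v : 'rV[L]_26) j : (c *: v) 0 j = c * v 0 j.
Proof. exact: mxE. Qed.

Ltac eval_coords :=
  repeat match goal with
  | |- context [terms ?n] => let t := eval vm_compute in (terms n) in
      change (terms n) with t
  | |- context [pterms] => let t := eval vm_compute in pterms in
      change pterms with t
  end;
  rewrite /eval_terms /= ?zc.

(** Ties [Ms] and [Phi] to octonions: x.y = x*y + <x,y>e/3, where [Ms] holds 6 times the product.
    The nine entries with eight coordinates each are polynomial identities. *)
Lemma jordan_herm_fun X Y : mx3_jordan (herm_fun X) (herm_fun Y) =
  herm_fun (fun n => 6%:R^-1 * eval_terms X Y (terms n))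
  + (3%:R^-1 * eval_terms X Y pterms) *: mx3_one.
Proof.
have n6 : 6%:R != 0 :> L by rewrite (natrM _ 2 3) mulf_neq0.
apply: mx3P => i j hi hj.
rewrite mx3_jordanE mx3_linE /herm_fun /mx3_one !hmxE //.
case: i hi => [|[|[|//]]] _; case: j hj => [|[|[|//]]] _; rewrite /oct_at.
all: rewrite ?o8_conj ?o8_one !o8M !o8D ?o8_0 ?o8_conj ?o8_one !o8Z !o8D.
all: apply: o8_eq.
all: eval_coords.
all: field; rewrite ?n2 ?n3 ?n6.
all: by [].
Qed.
End Oct.

Section Oct2.
Variable L : fieldType.
Hypothesis n2 : 2%:R != 0 :> L.
Hypothesis n3 : 3%:R != 0 :> L.

Lemma eq_herm_fun X Y : (forall n, (n < 26)%N -> X n = Y n) ->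
  herm_fun (L := L) X = herm_fun Y.
Proof. by move=> h; rewrite /herm_fun /oct_at !h. Qed.

Lemma jordan_herm x y : mx3_jordan (herm_of x) (herm_of y) =
  herm_of (6%:R^-1 *: (x *m mxM y)) + (3%:R^-1 * phi x y) *: mx3_one L.
Proof.
rewrite /herm_of jordan_herm_fun // phi_coord; congr (_ + _).
by apply: eq_herm_fun => n hn; rewrite scale_coord inord_coord.
Qed.

Lemma mx3_mulC_conj (u v : oct_mx3 L) : mx3_jordan u v = mx3_jordan v u.
Proof. by rewrite /mx3_jordan addrC. Qed.

Lemma o8E (a : oct L) : a = o8 (a.1 0 0) (a.1 0 1) (a.1 1 0) (a.1 1 1)
  (a.2 0 0) (a.2 0 1) (a.2 1 0) (a.2 1 1).
Proof. by case: a => A B; rewrite /o8 /= -!m2E. Qed.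

Lemma oct_conjE (a : oct L) : oct_conj a = o8 (a.1 1 1) (- a.1 0 1) (- a.1 1 0) (a.1 0 0)
  (- a.2 0 0) (- a.2 0 1) (- a.2 1 0) (- a.2 1 1).
Proof. by rewrite {1}(o8E a) o8_conj. Qed.

Lemma oct_conjD (a b : oct L) : oct_conj (a + b) = oct_conj a + oct_conj b.
Proof.
rewrite !oct_conjE o8D; apply: o8_eq; rewrite ?mxE ?opprD //.
Qed.
Lemma oct_conjZ c (a : oct L) : oct_conj (c *: a) = c *: oct_conj a.
Proof.
by rewrite !oct_conjE o8Z; apply: o8_eq; rewrite ?mxE ?mulrN.
Qed.
Lemma oct_conjK (a : oct L) : oct_conj (oct_conj a) = a.
Proof. by rewrite (o8E a) !o8_conj !opprK. Qed.
Lemma oct_conj_one c : oct_conj (c *: oct_one L) = c *: oct_one L.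
Proof. by rewrite o8_one o8_conj !oppr0. Qed.

Lemma hmx_linear t u v w a b c u' v' w' a' b' c' :
  hmx (t * u + u') (t * v + v') (t * w + w') (t *: a + a') (t *: b + b') (t *: c + c')
  = t *: hmx u v w a b c + hmx u' v' w' a' b' c' :> oct_mx3 L.
Proof.
apply/ffunP => -[i j]; rewrite [RHS]ffunE [X in _ = X + _]ffunE !ffunE /=.
by case: (val i) => [|[|?]]; case: (val j) => [|[|?]];
  rewrite ?oct_conjD ?oct_conjZ ?scalerDl ?scalerA.
Qed.

Lemma oct_at_linear t X Y n : oct_at (fun i => t * X i + Y i) n =
  t *: oct_at X n + oct_at Y n :> oct L.
Proof. by rewrite /oct_at o8Z o8D. Qed.

Lemma herm_of_linear : linear (@herm_of L).
Proof.
move=> t x y; rewrite /herm_of /herm_fun -hmx_linear -!oct_at_linear.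
congr hmx; rewrite ?mxE //; first by ring.
all: by rewrite /oct_at; apply: o8_eq; rewrite !mxE.
Qed.

Lemma hmx_herm u v w a b c : mx3_herm (hmx u v w a b c : oct_mx3 L).
Proof.
move=> i j; rewrite -[i]inord_val -[j]inord_val !hmxE //.
by case: i => [[|[|[|//]]] ?]; case: j => [[|[|[|//]]] ?] /=;
  rewrite ?oct_conj_one ?oct_conjK.
Qed.

Lemma mx3_tr_hmx u v w a b c :
  mx3_tr (hmx u v w a b c) = (u + v + w) *: oct_one L.
Proof. by rewrite /mx3_tr sum3 !hmxE // !scalerDl. Qed.

Lemma mx3_tr_linear : linear (@mx3_tr L).
Proof.
move=> t u v; rewrite /mx3_tr scaler_sumr -big_split; apply: eq_bigr => i _.
by rewrite !ffunE.
Qed.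

Lemma mx3_tr_herm_of x : mx3_tr (herm_of x) = 0 :> oct L.
Proof.
rewrite mx3_tr_hmx; set s := _ + _; have -> : s = 0 by rewrite /s; ring.
by rewrite scale0r.
Qed.

Lemma mx3_tr_one : mx3_tr (mx3_one L) = 3%:R *: oct_one L.
Proof. by rewrite mx3_tr_hmx; congr (_ *: _); ring. Qed.

Lemma oct_one_neq0 : oct_one L != 0.
Proof.
apply/negP => /eqP/(congr1 (fun a : oct L => a.1 0 0))/eqP.
by rewrite !mxE /= oner_eq0.
Qed.

Lemma conj_fix (a : oct L) : a = oct_conj a -> a = a.1 0 0 *: oct_one L.
Proof.
have eqN (z : L) : z = - z -> z = 0.
  move=> h; apply: (mulfI n2); rewrite mulr0 mulr_natl mulr2n {2}h addrN //.
rewrite {1}(o8E a) oct_conjE => -[]/matrixP h1 /matrixP h2.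
have h00 := h1 0 0; have h01 := h1 0 1; have h10 := h1 1 0.
have g00 := h2 0 0; have g01 := h2 0 1; have g10 := h2 1 0; have g11 := h2 1 1.
rewrite !mxE /= in h00 h01 h10 g00 g01 g10 g11.
rewrite o8_one {1}(o8E a) h00.
rewrite (eqN _ h01) (eqN _ h10) (eqN _ g00) (eqN _ g01) (eqN _ g10) (eqN _ g11).
by [].
Qed.

Lemma herm_decomp (u : oct_mx3 L) : mx3_herm u ->
  exists x t, u = herm_of x + t *: mx3_one L.
Proof.
move=> hu.
pose d n := (u (inord n, inord n)).1 0 0.
(* A third of the trace; diagonal entries are scalars by [conj_fix], since they are their own
   conjugates. *)
pose t := 3%:R^-1 * (d 0%N + d 1%N + d 2%N).
pose oc (a : oct L) n := match n with 0%N => a.1 0 0 | 1%N => a.1 0 1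
  | 2%N => a.1 1 0 | 3%N => a.1 1 1 | 4%N => a.2 0 0 | 5%N => a.2 0 1
  | 6%N => a.2 1 0 | _ => a.2 1 1 end.
pose X n := match n with 0%N => d 0%N - t | 1%N => d 1%N - t | _ =>
  if (n < 10)%N then oc (u (inord 0, inord 1)) (n - 2)%N
  else if (n < 18)%N then oc (u (inord 0, inord 2)) (n - 10)%N
  else oc (u (inord 1, inord 2)) (n - 18)%N end.
exists (\row_i X i), t.
have -> : herm_of (\row_i X i) = herm_fun X.
  by apply: eq_herm_fun => n hn; rewrite mxE inordK.
have dE n : u (inord n, inord n) = d n *: oct_one L by apply: conj_fix.
apply: mx3P => i j hi hj; rewrite mx3_linE /herm_fun !hmxE //.
have cE i' j' a : u (inord i', inord j') = a -> u (inord j', inord i') = oct_conj a.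
  by move=> <-.
have a01 : u (inord 0, inord 1) = oct_at X 2 by rewrite [LHS]o8E.
have a02 : u (inord 0, inord 2) = oct_at X 10 by rewrite [LHS]o8E.
have a12 : u (inord 1, inord 2) = oct_at X 18 by rewrite [LHS]o8E.
have c0 : oct_conj (0 : oct L) = 0.
  by rewrite -(scale0r (oct_one L)) oct_conj_one.
case: i hi => [|[|[|//]]] _; case: j hj => [|[|[|//]]] _;
  rewrite ?dE ?c0 ?scaler0 ?addr0 ?(cE _ _ _ a01) ?(cE _ _ _ a02) ?(cE _ _ _ a12) //.
- by rewrite scalerA -scalerDl mulr1 subrK.
- by rewrite scalerA -scalerDl mulr1 subrK.
rewrite scalerA -scalerDl mulr1 /X /t; congr (_ *: _); field; exact: n3.
Qed.

Lemma herm_of_inj0 x : herm_of x = 0 :> oct_mx3 L -> x = 0.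
Proof.
move=> h; apply/rowP => i; rewrite !mxE.
have hc p q : herm_of x (inord p, inord q) = 0 by rewrite h ffunE.
have h00 := hc 0%N 0%N; have h11 := hc 1%N 1%N; have h01 := hc 0%N 1%N.
have h02 := hc 0%N 2%N; have h12 := hc 1%N 2%N.
rewrite !hmxE // in h00 h11 h01 h02 h12.
have o8_inj0 a b c d a' b' c' d' : o8 a b c d a' b' c' d' = 0 :> oct L ->
    [/\ a = 0, b = 0, c = 0 & d = 0] /\ [/\ a' = 0, b' = 0, c' = 0 & d' = 0].
  move=> [/matrixP g1 /matrixP g2].
  have := (g1 0 0, g1 0 1, g1 1 0, g1 1 1, (g2 0 0, g2 0 1, g2 1 0, g2 1 1)).
  by rewrite !mxE /= => -[[[[-> ->] ->] ->] [[[-> ->] ->] ->]].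
have one0 c : c *: oct_one L = 0 -> c = 0.
  by move/eqP; rewrite scaler_eq0 (negPf oct_one_neq0) orbF => /eqP.
have {h00} h00 := one0 _ h00; have {h11} h11 := one0 _ h11.
have [[? ? ? ?] [? ? ? ?]] := o8_inj0 _ _ _ _ _ _ _ _ h01.
have [[? ? ? ?] [? ? ? ?]] := o8_inj0 _ _ _ _ _ _ _ _ h02.
have [[? ? ? ?] [? ? ? ?]] := o8_inj0 _ _ _ _ _ _ _ _ h12.
rewrite -[i]inord_val; case: i => n hn /=.
by do 26?[case: n hn => [|n] hn //].
Qed.

Lemma mx3_jordan_one u : mx3_herm u -> mx3_jordan u (mx3_one L) = u.
Proof.
move=> hu; rewrite /mx3_jordan.
have o1 (a : oct L) : oct_mul a (oct_one L) = a.
  rewrite -[oct_one L]scale1r o8_one (o8E a) o8M.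
  by apply: o8_eq; ring.
have o2 (a : oct L) : oct_mul (oct_one L) a = a.
  rewrite -[oct_one L]scale1r o8_one (o8E a) o8M.
  by apply: o8_eq; ring.
have o3 (a : oct L) : oct_mul a 0 = 0.
  rewrite o8_0 (o8E a) o8M.
  by apply: o8_eq; ring.
have o4 (a : oct L) : oct_mul 0 a = 0.
  rewrite o8_0 (o8E a) o8M.
  by apply: o8_eq; ring.
have c0 : oct_conj (0 : oct L) = 0.
  by rewrite -(scale0r (oct_one L)) oct_conj_one.
apply: mx3P => i j hi hj; rewrite -[LHS]/(mx3_jordan u (mx3_one L) _).
rewrite mx3_jordanE /mx3_one !hmxE // c0 !scale1r.
case: i hi => [|[|[|//]]] _; case: j hj => [|[|[|//]]] _;
  rewrite ?o1 ?o2 ?o3 ?o4 ?addr0 ?add0r -mulr2n -scaler_nat scalerA mulVf ?scale1r //.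
Qed.

End Oct2.

(** * From an isomorphism over the closure to coordinates on W *)

Section Split.
Variables (k : fieldType) (J : vectType k).
Variables (mul : {bilinear J -> J -> J}) (form : {biscalar J}) (e : J).
Hypothesis n2 : 2%:R != 0 :> k.
Hypothesis n3 : 3%:R != 0 :> k.
Hypothesis he : forall x : J, mul e x = x /\ mul x e = x.
Variables (L : fieldType) (iota : {rmorphism k -> L}).
Variable f : {linear 'rV[L]_(\dim {:J}) -> oct_mx3 L}.
Hypothesis f_inj : injective f.
Hypothesis f_herm : forall x, mx3_herm x <-> exists u, x = f u.
Hypothesis f_mul : forall u v, f (ext_mul mul iota u v) = mx3_jordan (f u) (f v).
Hypothesis f_form : forall u v, mx3_tr (mx3_jordan (f u) (f v))
                    = ext_form form iota u v *: oct_one L.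

Let m2 : 2%:R != 0 :> L.
Proof. by rewrite -(rmorph_nat iota) fmorph_eq0. Qed.
Let m3 : 3%:R != 0 :> L.
Proof. by rewrite -(rmorph_nat iota) fmorph_eq0. Qed.

Definition sJ (x : J) : 'rV[L]_(\dim {:J}) := \row_i iota (bcoord i x).

Lemma sJ_lin c x y : sJ (c *: x + y) = iota c *: sJ x + sJ y.
Proof.
by apply/rowP => i; rewrite !mxE /bcoord linearP /= rmorphD rmorphM.
Qed.

Lemma sJ_inj : injective sJ.
Proof.
move=> x y h; rewrite (bvec_sum x) (bvec_sum y); apply: eq_bigr => i _.
have /rowP/(_ i) := h; rewrite !mxE => /(fmorph_inj iota) -> //.
Qed.

Lemma sJ_bvec i : sJ (bvec i) = delta_mx 0 i.
Proof.
by apply/rowP => j; rewrite !mxE bcoord_bvec eq_sym; case: eqP => _;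
  rewrite ?rmorph1 ?rmorph0 ?eqxx.
Qed.

Lemma sJ_mul x y : ext_mul mul iota (sJ x) (sJ y) = sJ (mul x y).
Proof.
apply/rowP => l; rewrite !mxE.
rewrite [in RHS](bvec_sum x) linear_sumlz /bcoord linear_sum rmorph_sum.
apply: eq_bigr => i _; rewrite [in RHS](bvec_sum y) linearZl_LR linearZ /=.
rewrite linear_sumr linear_sum rmorphM rmorph_sum mulr_sumr.
apply: eq_bigr => j _.
by rewrite linearZr_LR linearZ /= rmorphM !mxE mulrA.
Qed.

Lemma sJ_form x y : ext_form form iota (sJ x) (sJ y) = iota (form x y).
Proof.
rewrite /ext_form [in RHS](bvec_sum x) linear_sumlz rmorph_sum.
apply: eq_bigr => i _; rewrite [in RHS](bvec_sum y) linearZl_LR /= rmorphM.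
rewrite linear_sumr rmorph_sum mulr_sumr; apply: eq_bigr => j _.
by rewrite linearZr_LR /= rmorphM !mxE mulrA.
Qed.

Definition fJ (x : J) := f (sJ x).

Lemma fJ_lin c x y : fJ (c *: x + y) = iota c *: fJ x + fJ y.
Proof. by rewrite /fJ sJ_lin linearP. Qed.
Lemma fJ_inj : injective fJ.
Proof. by move=> x y /f_inj/sJ_inj. Qed.
Lemma fJ_mul x y : fJ (mul x y) = mx3_jordan (fJ x) (fJ y).
Proof. by rewrite /fJ -f_mul sJ_mul. Qed.
Lemma fJ_form x y : mx3_tr (mx3_jordan (fJ x) (fJ y)) = iota (form x y) *: oct_one L.
Proof. by rewrite /fJ f_form sJ_form. Qed.
Lemma fJ_herm x : mx3_herm (fJ x).
Proof. by apply/f_herm; exists (sJ x). Qed.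

Lemma oct_scale_inj c d : c *: oct_one L = d *: oct_one L -> c = d.
Proof.
move/eqP; rewrite -subr_eq0 -scalerBl scaler_eq0 (negPf (oct_one_neq0 L)).
by rewrite orbF subr_eq0 => /eqP.
Qed.

Lemma mx3_tr_herm_one x t :
  mx3_tr (herm_of x + t *: mx3_one L) = (3%:R * t) *: oct_one L.
Proof.
rewrite addrC /herm_of /herm_fun /mx3_one -hmx_linear mx3_tr_hmx.
by congr (_ *: _); ring.
Qed.

Lemma albert_mulC x y : mul x y = mul y x.
Proof. by apply: fJ_inj; rewrite !fJ_mul mx3_mulC_conj. Qed.

Lemma albert_formC x y : form x y = form y x.
Proof.
apply: (fmorph_inj iota); apply: oct_scale_inj.
by rewrite -!fJ_form mx3_mulC_conj.
Qed.

Lemma row_sJ (u : 'rV[L]_(\dim {:J})) : u = \sum_i u 0 i *: sJ (bvec i).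
Proof. by rewrite [LHS]row_sum_delta; apply: eq_bigr => i _; rewrite sJ_bvec. Qed.

(** The unit matrix is the image of some u because it is hermitian, and e acts on u as the identity
    in the scalar extension. *)
Lemma fJ_unit : fJ e = mx3_one L.
Proof.
have [u uE] : exists u, mx3_one L = f u by apply/f_herm; apply: hmx_herm.
have ext1 v : ext_mul mul iota (sJ e) v = v.
  have ext_lin : linear (ext_mul mul iota (sJ e)).
    move=> c x y; apply/rowP => l; rewrite !mxE mulr_sumr -big_split /=.
    apply: eq_bigr => i _; rewrite mulr_sumr -big_split /=.
    by apply: eq_bigr => j _; rewrite !mxE; ring.
  pose gL := GRing.isLinear.Build L _ _ _ (ext_mul mul iota (sJ e)) ext_lin.
  pose g : {linear 'rV[L]_(\dim {:J}) -> 'rV[L]_(\dim {:J})} :=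
    HB.pack (ext_mul mul iota (sJ e)) gL.
  rewrite -[LHS]/(g v) (row_sJ v) linear_sum; apply: eq_bigr => i _.
  by rewrite linearZ /= sJ_mul (proj1 (he _)).
rewrite -[RHS](_ : f (ext_mul mul iota (sJ e) u) = _); last by rewrite ext1.
by rewrite f_mul -uE mx3_jordan_one //; apply: fJ_herm.
Qed.

Lemma fJ_tr x : mx3_tr (fJ x) = iota (form x e) *: oct_one L.
Proof.
by rewrite -fJ_form fJ_unit mx3_jordan_one //; apply: fJ_herm.
Qed.

Lemma form_ee : form e e = 3%:R.
Proof.
apply: (fmorph_inj iota); apply: oct_scale_inj.
by rewrite -fJ_tr fJ_unit mx3_tr_one rmorph_nat.
Qed.

Local Notation W := (subvs_of (traceless form e)).

Lemma wformE (w : W) : form (vsval w) e = 0.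
Proof. by apply/eqP; rewrite -mem_traceless subvsP. Qed.

Lemma wprojE x : vsval (wproj form e x) = x - (3%:R^-1 * form x e) *: e.
Proof.
rewrite /wproj vsprojK // mem_traceless linearBl /= linearZl_LR /=.
by rewrite form_ee mulrAC mulVf // mul1r subrr.
Qed.

Lemma form_mul_e x y : form (mul x y) e = form x y.
Proof.
by apply: (fmorph_inj iota); apply: oct_scale_inj; rewrite -fJ_tr fJ_mul fJ_form.
Qed.

Lemma herm_of0 : herm_of 0 = 0 :> oct_mx3 L.
Proof.
by have := @herm_of_linear L (-1) 0 0; rewrite scaler0 addr0 scaleN1r addNr.
Qed.

Lemma herm_ofD x y : herm_of (x + y) = herm_of x + herm_of y :> oct_mx3 L.
Proof. by have := @herm_of_linear L 1 x y; rewrite !scale1r. Qed.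

Lemma herm_ofZ c x : herm_of (c *: x) = c *: herm_of x :> oct_mx3 L.
Proof. by have := @herm_of_linear L c x 0; rewrite herm_of0 !addr0. Qed.

Lemma ex_sg (w : W) : exists x, herm_of x == fJ (vsval w).
Proof.
have [x [t E]] := herm_decomp m2 m3 (fJ_herm (vsval w)).
exists x; rewrite E; have := fJ_tr (vsval w); rewrite wformE rmorph0 scale0r E.
rewrite mx3_tr_herm_one => /eqP.
rewrite scaler_eq0 (negPf (oct_one_neq0 L)) orbF mulf_eq0 (negPf m3).
by move/eqP ->; rewrite scale0r addr0.
Qed.

(** The model coordinates of an element of W, chosen as the unique traceless vector with the same
    hermitian matrix. *)
Definition sg (w : W) : 'rV[L]_26 := xchoose (ex_sg w).

Lemma sgE w : herm_of (sg w) = fJ (vsval w).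
Proof. exact/eqP/(xchooseP (ex_sg w)). Qed.

Lemma herm_of_inj : injective (@herm_of L).
Proof.
move=> x y h; apply/eqP; rewrite -subr_eq0; apply/eqP/herm_of_inj0.
rewrite addrC -scaleN1r herm_of_linear h scaleN1r addNr //.
Qed.

Lemma sg_lin c x y : sg (c *: x + y) = iota c *: sg x + sg y.
Proof. by apply: herm_of_inj; rewrite herm_of_linear !sgE linearP fJ_lin. Qed.

Lemma phi_sg a b : iota (wform a b) = phi (sg a) (sg b).
Proof.
apply: oct_scale_inj; rewrite -fJ_form -!sgE jordan_herm // mx3_tr_herm_one.
by rewrite mulrA mulfV // mul1r.
Qed.

Lemma sg_mul a b : sg (wmul mul a b) = 6%:R^-1 *: (sg a *m mxM (sg b)).
Proof.
apply: herm_of_inj; rewrite sgE wprojE addrC -scaleNr fJ_lin fJ_mul fJ_unit.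
rewrite -!sgE jordan_herm // rmorphN rmorphM /= fmorphV rmorph_nat.
rewrite form_mul_e -/(wform a b) phi_sg.
by rewrite addrCA -scalerDl addNr scale0r addr0.
Qed.

Definition smx : 'M[L]_(\dim {:W}, 26) := \matrix_i sg (bvec i).

Lemma sg_smx w : sg w = (\row_i iota (bcoord i w)) *m smx.
Proof.
have sg0 : sg 0 = 0.
  by have := sg_lin (-1) 0 0; rewrite scaler0 addr0 rmorphN1 scaleN1r addNr.
have sgD x y : sg (x + y) = sg x + sg y.
  by have := sg_lin 1 x y; rewrite rmorph1 !scale1r.
have sgZ c x : sg (c *: x) = iota c *: sg x.
  by have := sg_lin c x 0; rewrite sg0 !addr0.
rewrite [in LHS](bvec_sum w) (big_morph sg sgD sg0) mulmx_sum_row.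
by apply: eq_bigr => i _; rewrite sgZ mxE rowK.
Qed.

(** Independence of a basis of W inside J persists after extension of scalars, and f is
    injective. *)
Lemma smx_free : row_free smx.
Proof.
rewrite -kermx_eq0; apply/rowV0P => v /sub_kermxP vS.
pose R0 := \matrix_(i < \dim {:W}) (\row_l bcoord l (vsval (bvec i : W))) : 'M[k]_(_, \dim {:J}).
have R0_free : row_free R0.
  rewrite -kermx_eq0; apply/rowV0P => w /sub_kermxP wR.
  have w0 : \sum_i w 0 i *: (bvec i : W) = 0.
    apply: (can_inj (vsvalK (U := traceless form e))).
    rewrite linear_sum linear0 (bvec_sum (\sum_i _)) big1 // => l _.
    rewrite (_ : bcoord l _ = 0) ?scale0r //.
    move/rowP/(_ l): wR; rewrite !mxE => wR; rewrite -[RHS]wR.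
    rewrite /bcoord linear_sum; apply: eq_bigr => i _.
    by rewrite !linearZ !mxE.
  apply/rowP => j; have := congr1 (bcoord j) w0; rewrite mxE /bcoord.
  rewrite linear0 linear_sum (bigD1 j) //= big1 ?addr0 => [|i ij].
    by rewrite linearZ /= -/(bcoord j _) bcoord_bvec eqxx mulr1.
  by rewrite linearZ /= -/(bcoord j _) bcoord_bvec (negPf ij) mulr0.
have R1_free : row_free (map_mx iota R0) by rewrite row_free_map.
apply: (row_free_inj R1_free); rewrite mul0mx; apply: f_inj.
rewrite linear0 -[RHS](_ : herm_of (v *m smx) = 0); last first.
  by rewrite vS herm_of0.
rewrite !mulmx_sum_row (big_morph (@herm_of L) herm_ofD herm_of0) linear_sum.
apply: eq_bigr => i _; rewrite linearZ herm_ofZ /smx rowK sgE; congr (_ *: f _).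
by apply/rowP => l; rewrite !mxE.
Qed.

(** A traceless hermitian matrix is an L-combination of images of elements of J; projecting these to
    W changes it by a multiple of the unit, which is zero by comparing traces. With [smx_free] this
    gives dim W = 26. *)
Lemma smx_full : row_full smx.
Proof.
rewrite -sub1mx; apply/row_subP => i; rewrite rowE mulmx1.
set y := delta_mx 0 i.
have [u uE] : exists u, herm_of y = f u by apply/f_herm; apply: hmx_herm.
pose z := \sum_j u 0 j *: sg (wproj form e (bvec j)).
pose t := \sum_j u 0 j * iota (3%:R^-1 * form (bvec j) e).
have E : herm_of y = herm_of z + t *: mx3_one L.
  rewrite uE (row_sJ u) linear_sum /z (big_morph (@herm_of L) herm_ofD herm_of0) /t.
  rewrite scaler_suml -big_split; apply: eq_bigr => j _ /=.
  rewrite linearZ herm_ofZ sgE wprojE -[X in _ + X]scalerA -scalerDr -/(fJ _); congr (_ *: _).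
  rewrite [bvec j - _]addrC -scaleNr fJ_lin fJ_unit rmorphN addrAC -scalerDl.
  by rewrite addNr scale0r add0r.
have t0 : t = 0.
  have := congr1 (@mx3_tr L) E; rewrite mx3_tr_herm_one mx3_tr_herm_of => /esym/eqP.
  rewrite scaler_eq0 (negPf (oct_one_neq0 L)) orbF mulf_eq0 (negPf m3).
  by move/eqP.
have -> : y = z by apply: herm_of_inj; rewrite E t0 scale0r addr0.
apply: summx_sub => j _; apply: scalemx_sub; rewrite sg_smx; exact: submxMl.
Qed.

End Split.

Section Package.
Variables (k : fieldType) (J : vectType k).
Variables (mul : {bilinear J -> J -> J}) (form : {biscalar J}) (e : J).
Hypothesis n2 : 2%:R != 0 :> k.
Hypothesis n3 : 3%:R != 0 :> k.
Hypothesis hJ : is_albert mul form.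
Hypothesis he : forall x : J, mul e x = x /\ mul x e = x.
Local Notation W := (subvs_of (traceless form e)).

(** All that is needed from the hypothesis on J: symmetry, the values of the form at e, and an
    L-basis change S carrying product and form of W to the model. *)
Lemma albert_split :
  [/\ forall x y, mul x y = mul y x, forall x y, form x y = form y x,
     form e e = 3%:R /\ (forall x y, form (mul x y) e = form x y) &
   exists (L : fieldType) (iota : {rmorphism k -> L}) (sg : W -> 'rV[L]_26)
     (S : 'M[L]_(\dim {:W}, 26)) (S' : 'M[L]_(26, \dim {:W})),
   [/\ S *m S' = 1%:M, S' *m S = 1%:M,
     forall w, sg w = (\row_i iota (bcoord i w)) *m S,
     forall a b, sg (wmul mul a b) = 6%:R^-1 *: (sg a *m mxM (sg b))
   & forall a b, iota (wform a b) = phi (sg a) (sg b)]].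
Proof.
have [L [iota [_ [f [f_inj f_herm f_mul f_form]]]]] := hJ.
split.
- exact: (albert_mulC f_inj f_mul).
- exact: (albert_formC f_form).
- split; first exact: (form_ee n2 he f_herm f_mul f_form).
  exact: (form_mul_e n2 he f_herm f_mul f_form).
pose s := sg n2 n3 he f_herm f_mul f_form.
pose S := smx n2 n3 he f_herm f_mul f_form.
have [S' SS'] := row_freeP (smx_free n2 n3 he f_inj f_herm f_mul f_form).
have [S'' S''S] := row_fullP (smx_full n2 n3 he f_herm f_mul f_form).
have E : S'' = S' by rewrite -[S'']mulmx1 -SS' mulmxA S''S mul1mx.
exists L, iota, s, S, S'; split => //; first by rewrite -E.
- exact: sg_smx.
- exact: sg_mul.
- exact: phi_sg.
Qed.

End Package.

(** * Transfer of the identities from the split model to W over k *)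

Section Transfer.
Variables (k : fieldType) (W : vectType k).
Variables (m : W -> W -> W) (f : W -> W -> k).
Variables (L : fieldType) (iota : {rmorphism k -> L}) (sg : W -> 'rV[L]_26).
Variables (S : 'M[L]_(\dim {:W}, 26)) (S' : 'M[L]_(26, \dim {:W})).
Hypothesis nz : forall n, (0 < n)%N -> all (fun p => p <= 13)%N (primes n) ->
  n%:R != 0 :> k.
Hypothesis SS' : S *m S' = 1%:M.
Hypothesis S'S : S' *m S = 1%:M.
Hypothesis sgE : forall w, sg w = (\row_i iota (bcoord i w)) *m S.
Hypothesis sg_m : forall a b, sg (m a b) = 6%:R^-1 *: (sg a *m mxM (sg b)).
Hypothesis phi_sg : forall a b, iota (f a b) = phi (sg a) (sg b).

Lemma sgP c u v : sg (c *: u + v) = iota c *: sg u + sg v.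
Proof.
rewrite !sgE scalemxAl -mulmxDl; congr (_ *m _); apply/rowP => i.
by rewrite !mxE /bcoord linearP rmorphD rmorphM.
Qed.

Lemma sg_inj : injective sg.
Proof.
move=> u v; rewrite !sgE => /(congr1 (fun x => x *m S')).
rewrite -!mulmxA SS' !mulmx1 => /rowP h.
rewrite (bvec_sum u) (bvec_sum v); apply: eq_bigr => i _.
by have := h i; rewrite !mxE => /fmorph_inj ->.
Qed.

Lemma sg0 : sg 0 = 0.
Proof. by have := sgP (-1) 0 0; rewrite scaler0 addr0 rmorphN1 scaleN1r addNr. Qed.
Lemma sgD u v : sg (u + v) = sg u + sg v.
Proof. by have := sgP 1 u v; rewrite rmorph1 !scale1r. Qed.
Lemma sgZ c u : sg (c *: u) = iota c *: sg u.
Proof. by have := sgP c u 0; rewrite sg0 !addr0. Qed.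
Lemma sgN u : sg (- u) = - sg u.
Proof. by rewrite -scaleN1r sgZ rmorphN1 scaleN1r. Qed.

Let iotan n : iota n%:R = n%:R. Proof. exact: rmorph_nat. Qed.
Let iotaV n : iota (n%:R^-1) = n%:R^-1. Proof. by rewrite fmorphV iotan. Qed.

Lemma nzL n : (0 < n)%N -> all (fun p => p <= 13)%N (primes n) -> n%:R != 0 :> L.
Proof. by move=> n0 h; rewrite -iotan fmorph_eq0 nz. Qed.

Lemma tr_mC a b : m a b = m b a.
Proof. by apply: sg_inj; rewrite !sg_m mxMC. Qed.

Lemma tr_m_lin b : linear (m b).
Proof.
move=> c u v; apply: sg_inj.
by rewrite sg_m sgP mxM_linear mulmxDr -scalemxAr scalerDr sgP !sg_m !scalerA mulrC.
Qed.

Lemma phiC (x y : 'rV[L]_26) : phi x y = phi y x.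
Proof.
rewrite /phi -[in LHS](trmxK (x *m _ *m _)) mxE !trmx_mul trmxK mphi_sym.
by rewrite mulmxA.
Qed.

Lemma tr_fC a b : f a b = f b a.
Proof. by apply: (fmorph_inj iota); rewrite !phi_sg phiC. Qed.

Lemma tr_f_lin b : scalar (f b).
Proof.
move=> c u v; apply: (fmorph_inj iota).
by rewrite phi_sg sgP phi_linear rmorphD rmorphM !phi_sg.
Qed.

Lemma tr_fA a b c : f (m a b) c = f a (m b c).
Proof.
apply: (fmorph_inj iota); rewrite !phi_sg !sg_m -[_ *: _]addr0 phi_linearl.
have phi0r x : phi x 0 = 0 :> L.
  by have := phi_linear x (-1) 0 0; rewrite scaler0 addr0 mulN1r addNr.
rewrite [phi 0 _]phiC phi0r addr0 -[X in _ = phi _ X]addr0 phi_linear.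
by rewrite phi0r addr0 phi_assoc.
Qed.

Lemma sg_onto (x : 'rV[L]_26) : x = \sum_i (x *m S') 0 i *: sg (bvec i).
Proof.
rewrite -[LHS]mulmx1 -S'S mulmxA mulmx_sum_row; apply: eq_bigr => i _.
congr (_ *: _); rewrite sgE rowE; congr (_ *m _).
apply/rowP => j; rewrite !mxE bcoord_bvec eqxx eq_sym /=.
by case: eqP; rewrite ?rmorph1 ?rmorph0.
Qed.

Lemma tr_f_nondeg x : (forall y, f x y = 0) -> x = 0.
Proof.
move=> h; apply: sg_inj; rewrite sg0; apply: mphi_free; first exact: nzL.
move=> y; rewrite (sg_onto y).
rewrite (big_morph (phi (sg x)) (id1 := 0) (op1 := +%R)).
- rewrite big1 // => i _.
  have := phi_linear (sg x) ((y *m S') 0 i) (sg (bvec i)) 0.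
  have phi0r : phi (sg x) 0 = 0 :> L.
    by have := phi_linear (sg x) (-1) 0 0; rewrite scaler0 addr0 mulN1r addNr.
  by rewrite !addr0 phi0r addr0 -phi_sg h rmorph0 mulr0.
- by move=> u v; have := phi_linear (sg x) 1 u v; rewrite scale1r mul1r.
- by have := phi_linear (sg x) (-1) 0 0; rewrite scaler0 addr0 mulN1r addNr.
Qed.

Lemma phi_scalar (x a : 'rV[L]_26) : x *m (mphi L *m a^T) = (phi x a)%:M.
Proof. by rewrite mulmxA /phi [LHS]mx11_scalar. Qed.

Lemma tr_cubic a b c : m a (m b c) + m b (m c a) + m c (m a b) =
  6%:R^-1 *: (f a b *: c + f b c *: a + f c a *: b).
Proof.
have n6 : 6%:R != 0 :> L by apply: nzL.
apply: sg_inj; rewrite !(sgD, sgZ) iotaV !phi_sg [m a _]tr_mC [m b (m c a)]tr_mC.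
rewrite [m c (m a b)]tr_mC [m a b]tr_mC [m c a]tr_mC.
apply: (scalerI (mulf_neq0 n6 n6)); rewrite scalerA mulfK //.
have := congr1 (mulmx (sg b)) (mxM_cubic (sg a) (sg c)).
rewrite !mulmxDr -!scalemxAr !mulmxDr [sg b *m mxM _]mxMC !mulmxA.
rewrite -!(mulmxA (sg b) (mphi L)) !phi_scalar !mul_scalar_mx mul_mx_scalar.
rewrite (phiC (sg b) (sg a)) (phiC (sg c) (sg a)) => E.
rewrite !sg_m -!scalemxAl !scalerA -!scalerDr scalerA.
rewrite -[6%:R^-1 * 6%:R^-1]invfM mulfV ?mulf_neq0 // scale1r.
rewrite (mxMC (sg a) (sg c)) -E -!addrA.
by congr (_ + _); rewrite addrC.
Qed.

(** Matrix of the scalar extension of F in model coordinates. It acts on row vectors, so composition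
    is reversed ([ext_comp]). *)
Definition ext (F : W -> W) : 'M[L]_26 :=
  S' *m (\matrix_(i, j) iota (bcoord j (F (bvec i)))) *m S.

Lemma sg_ext F w : linear F -> sg w *m ext F = sg (F w).
Proof.
move=> lF; pose Fl : {linear W -> W} := HB.pack F (GRing.isLinear.Build k W W _ F lF).
rewrite /ext !sgE !mulmxA -(mulmxA (_ : 'rV_(\dim {:W})) S S') SS' mulmx1; congr (_ *m _).
apply/rowP => j; rewrite !mxE -[F w]/(Fl w) [in RHS](bvec_sum w) linear_sum.
rewrite /bcoord linear_sum rmorph_sum; apply: eq_bigr => i _.
by rewrite !mxE linearZ /= linearZ /= rmorphM.
Qed.

Lemma ext_uniq (A B : 'M[L]_26) : (forall w, sg w *m A = sg w *m B) -> A = B.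
Proof.
move=> h; apply/row_matrixP => i; rewrite !rowE (sg_onto (delta_mx 0 i)).
by rewrite !mulmx_suml; apply: eq_bigr => j _; rewrite -!scalemxAl h.
Qed.

Lemma ext_tr F : linear F -> \tr (ext F) = iota (trf f F).
Proof.
move=> lF; rewrite /ext -mulmxA mxtrace_mulC -mulmxA SS' mulmx1 /mxtrace rmorph_sum.
apply: eq_bigr => i _; rewrite mxE tr_fC f_dvec //.
- exact: tr_fC.
- exact: tr_f_lin.
- exact: tr_f_nondeg.
Qed.

Lemma ext_comp F G : linear F -> linear G -> ext (fun w => F (G w)) = ext G *m ext F.
Proof.
move=> lF lG; apply: ext_uniq => w; rewrite mulmxA !sg_ext //.
by move=> c u v; rewrite lG lF.
Qed.

Lemma ext_m a : ext (m a) = 6%:R^-1 *: mxM (sg a).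
Proof.
apply: ext_uniq => w; rewrite sg_ext; last exact: tr_m_lin.
by rewrite tr_mC sg_m -scalemxAr.
Qed.

Lemma tr_trL a : trf f (m a) = 0.
Proof.
apply: (fmorph_inj iota); rewrite -ext_tr; last exact: tr_m_lin.
by rewrite ext_m linearZ /= mxM_tr mulr0 rmorph0.
Qed.

Lemma ext_id : ext id = 1%:M.
Proof. by apply: ext_uniq => w; rewrite sg_ext // mulmx1. Qed.

Lemma tr_tr1 : trf f id = 26%:R.
Proof. by apply: (fmorph_inj iota); rewrite -ext_tr // ext_id mxtrace1 iotan. Qed.

Lemma ext_lin c F G : linear F -> linear G ->
  ext (fun w => c *: F w + G w) = iota c *: ext F + ext G.
Proof.
move=> lF lG; apply: ext_uniq => w; rewrite mulmxDr -scalemxAr !sg_ext //.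
  by rewrite sgP.
by move=> t u v; rewrite lF lG; apply: sg_inj; rewrite !(sgD, sgZ) !scalerDr !scalerA mulrC addrACA.
Qed.

Lemma ext_dop a b : ext (dop m f a b) = 36%:R^-1 *: dmx (sg a) (sg b).
Proof.
have n3 : 3%:R != 0 :> L by apply: nzL.
have n6 : 6%:R != 0 :> L by apply: nzL.
apply: ext_uniq => w; rewrite sg_ext; last by move=> c u v; rewrite linearP.
rewrite (dopE tr_m_lin tr_fC tr_f_lin tr_f_nondeg) /dfun.
rewrite !(sgD, sgN, sgZ) iotaV !phi_sg [m a (m b w)]tr_mC [m b w]tr_mC.
rewrite [m b (m a w)]tr_mC [m a w]tr_mC !sg_m -scalemxAr /dmx mulmxDr -scalemxAr.
rewrite !mulmxBr !mulmxA -!(mulmxA (sg w) (mphi L)) !phi_scalar !mul_scalar_mx.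
rewrite !(phiC _ (sg w)) -!scalemxAl -2!scalerBr [RHS]scalerDr !scalerA -invfM -natrM.
congr (_ *: _ + _ *: _); rewrite (natrM _ 12 3) invfM mulrAC mulVf ?mul1r //.
exact: nzL.
Qed.

(** By [deriv_dop_sum] each derivation of W is inner, and inner derivations extend to multiples of
    [dmx]. *)
Lemma in_der_ext (X : 'End(W)) : deriv m X -> in_der (ext X).
Proof.
move=> dX; have n3 : 3%:R != 0 :> k by apply: nz.
have E : X = 3%:R^-1 *: \sum_i dop m f (X (bvec i)) (dvec f i).
  rewrite (deriv_dop_sum nz tr_mC tr_m_lin tr_fC tr_f_lin tr_f_nondeg tr_fA
    tr_cubic tr_trL tr_tr1 dX) scalerA mulVf // scale1r //.
have lX (T : 'End(W)) : linear T by move=> c u v; rewrite linearP.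
have -> : ext X = 3%:R^-1 *: \sum_i ext (dop m f (X (bvec i)) (dvec f i)).
  apply: ext_uniq => w; rewrite -scalemxAr mulmx_sumr sg_ext // {1}E.
  rewrite scale_lfunE sum_lfunE sgZ iotaV (big_morph sg sgD sg0).
  by congr (_ *: _); apply: eq_bigr => i _; rewrite sg_ext.
have hd := in_der_dmx; have dc := @in_der_closed L.
apply: (lclosedZ _ dc); apply: (@lclosed_sum L _ _ _ _ (@in_der L) dc) => [|i _].
  exact: (lclosed0 dc (hd L 0 0)).
by rewrite ext_dop; apply: (lclosedZ _ dc); apply: hd.
Qed.

Let lX (T : 'End(W)) : linear T. Proof. by move=> c u v; rewrite linearP. Qed.
Local Hint Resolve lX : core.
Let n2 : 2%:R != 0 :> L. Proof. exact: nzL. Qed.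
Local Notation trf := (trf f).
Local Notation deriv := (deriv m).

Lemma ext_fcomp (A : 'End(W)) G : linear G ->
  ext (fun w => A (G w)) = ext G *m ext A.
Proof. exact: ext_comp. Qed.

Lemma ext_mcomp a G : linear G ->
  ext (fun w => m a (G w)) = 6%:R^-1 *: (ext G *m mxM (sg a)).
Proof. by move=> lG; rewrite ext_comp ?ext_m -?scalemxAr //; apply: tr_m_lin. Qed.

Lemma lin_fcomp (A : 'End(W)) (G : W -> W) : linear G -> linear (fun w => A (G w)).
Proof. by move=> lG c u v; rewrite lG linearP. Qed.
Lemma lin_mcomp a (G : W -> W) : linear G -> linear (fun w => m a (G w)).
Proof. by move=> lG c u v; rewrite lG tr_m_lin. Qed.

Lemma tr_derZ (A B : 'End(W)) z : deriv A -> deriv B ->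
  trf (fun w => A (B (m z w))) = 0.
Proof.
move=> /in_der_ext dA /in_der_ext dB; have lm := tr_m_lin.
apply: (fmorph_inj iota); rewrite rmorph0 -ext_tr; last by do 2 apply: lin_fcomp.
rewrite (ext_fcomp A (lin_fcomp B (lm z))) (ext_fcomp B (lm z)) ext_m.
by rewrite -!scalemxAl linearZ /= -mulmxA mxtrace_mulC Z3_der // mulr0.
Qed.

Lemma ext_comp4 (A B C D : 'End(W)) : iota (trf (fun w => A (B (C (D w))))) =
  \tr (ext D *m ext C *m (ext B *m ext A)).
Proof.
have l1 := lin_fcomp C (lX D); have l2 := lin_fcomp B l1.
have l0 := lin_fcomp A l2.
by rewrite -(ext_tr l0) (ext_fcomp A l2) (ext_fcomp B l1) (ext_fcomp C (lX D)) mulmxA.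
Qed.

Lemma ext_tau (A B : 'End(W)) : iota (tau f A B) = taumx (ext A) (ext B).
Proof.
rewrite -(ext_tr (lin_fcomp A (lX B))) (ext_fcomp A (lX B)).
exact: mxtrace_mulC.
Qed.

Lemma tr_derQ (A B C D : 'End(W)) : deriv A -> deriv B -> deriv C -> deriv D ->
  trf (fun w => A (B (C (D w)))) + trf (fun w => A (C (B (D w))))
  + trf (fun w => A (B (D (C w))))
  = 12%:R^-1 * (tau f A B * tau f C D + tau f A C * tau f B D + tau f A D * tau f B C).
Proof.
move=> /in_der_ext dA /in_der_ext dB /in_der_ext dC /in_der_ext dD.
have n12 : 12%:R != 0 :> L by apply: nzL.
(* Arguments in reverse order, because [ext] reverses compositions. *)
have := Q4_der n2 dD dC dB dA; rewrite /Q4 => /eqP; rewrite subr_eq0 => /eqP E.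
apply: (fmorph_inj iota); rewrite !rmorphD rmorphM !rmorphD !rmorphM iotaV.
rewrite !ext_comp4 !ext_tau; apply: (mulfI n12); rewrite E mulrA mulfV // mul1r.
rewrite /taumx !(mxtrace_mulC (ext D)) !(mxtrace_mulC (ext C)) !(mxtrace_mulC (ext B)).
rewrite [\tr (ext C *m ext B)]mxtrace_mulC.
ring.
Qed.

Lemma ext_anti (A B : 'End(W)) : antimx (ext A) (ext B) = ext (anti A B).
Proof.
apply: ext_uniq => w; rewrite mulmxDr 2!(mulmxA (sg w) (ext _)) !sg_ext //.
by rewrite antiE sgD addrC.
Qed.

(** The sign comes from the reversal of composition; it disappears in [ext_ldbr] and [ext_six],
    where brackets occur in pairs. *)
Lemma ext_lbr (A B : 'End(W)) : brk (ext A) (ext B) = - ext (lbr A B).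
Proof.
apply: ext_uniq => w; rewrite mulmxN mulmxBr 2!(mulmxA (sg w) (ext _)) !sg_ext //.
by rewrite lbrE sgD sgN opprB.
Qed.

Lemma ext_D (A B : 'End(W)) : ext (A + B) = ext A + ext B.
Proof.
by apply: ext_uniq => w; rewrite mulmxDr !sg_ext // add_lfunE sgD.
Qed.

Lemma ext_Z c (A : 'End(W)) : ext (c *: A) = iota c *: ext A.
Proof. by apply: ext_uniq => w; rewrite -scalemxAr !sg_ext // scale_lfunE sgZ. Qed.

Lemma brkN A B : brk A (- B) = - brk A B :> 'M[L]_26.
Proof. by rewrite /brk mulmxN mulNmx opprB opprK addrC. Qed.

Lemma antimxN A B : antimx (- A) (- B) = antimx A B :> 'M[L]_26.
Proof. by rewrite /antimx !mulmxN !mulNmx !opprK. Qed.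

Lemma ext_ldbr (C D B : 'End(W)) : dbr (ext C) (ext D) (ext B) = ext (ldbr C D B).
Proof. by rewrite /dbr !ext_lbr !brkN !ext_lbr !opprK -ext_D. Qed.

Lemma ext_six (A B C D : 'End(W)) : S4 (ext A) (ext B) (ext C) (ext D) = ext (six A B C D).
Proof.
rewrite /S4 !ext_ldbr !ext_lbr !antimxN !ext_anti -!ext_D -(iotan 2) -ext_Z -ext_D.
by rewrite /six !addrA.
Qed.

Lemma phi_ext (T : 'End(W)) x y : phi (sg x *m ext T) (sg y) = iota (f (T x) y).
Proof. by rewrite sg_ext // phi_sg. Qed.

Lemma ext_ml (T : 'End(W)) z : \tr (ext T *m mxM (sg z)) =
  6%:R * iota (trf (fun w => T (m z w))).
Proof.
have n6 : 6%:R != 0 :> L by apply: nzL.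
have lm := tr_m_lin.
rewrite -ext_tr; last exact: lin_fcomp.
by rewrite (ext_fcomp T (lm z)) ext_m -scalemxAl linearZ /= mulrA mulfV // mul1r mxtrace_mulC.
Qed.

Lemma ext_mm (T U : 'End(W)) x y :
  \tr (ext T *m mxM (sg x) *m ext U *m mxM (sg y)) =
  36%:R * iota (trf (fun w => T (m y (U (m x w))))).
Proof.
have n6 : 6%:R != 0 :> L by apply: nzL.
have lm := tr_m_lin; have l1 := lin_fcomp U (lm x); have l2 := lin_mcomp y l1.
rewrite -ext_tr; last exact: lin_fcomp.
rewrite (ext_fcomp T l2) (ext_mcomp y l1) (ext_fcomp U (lm x)) ext_m.
rewrite -!scalemxAl !linearZ /= (natrM _ 6 6) mulrA.
rewrite mulfK // mulrA mulfV // mul1r.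
by rewrite -(mulmxA (ext T)) -(mulmxA (ext T)) mxtrace_mulC.
Qed.

Lemma tr_derP (A B C D : 'End(W)) x y :
  deriv A -> deriv B -> deriv C -> deriv D ->
  216%:R * f (anti (anti A B) (anti C D) x) y
  - 108%:R * trf (fun w => anti (anti A B) (anti C D) (m (m x y) w))
  - 216%:R * (trf (fun w => anti A B (m x (anti C D (m y w))))
              + trf (fun w => anti A B (m y (anti C D (m x w)))))
  + trf (anti A B) * trf (anti C D) * f x y
  = 108%:R * f (six A B C D x) y - 3%:R * trf (six A B C D) * f x y
  + 36%:R * (tau f A C * f (anti B D x) y + tau f A D * f (anti B C x) y
             + tau f B C * f (anti A D x) y + tau f B D * f (anti A C x) y)
  - 4%:R * (tau f A C * tau f B D + tau f A D * tau f B C) * f x y.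
Proof.
move=> /in_der_ext dA /in_der_ext dB /in_der_ext dC /in_der_ext dD.
have n6 : 6%:R != 0 :> L by apply: nzL.
have := P4_der n2 (sg x) (sg y) dA dB dC dD; rewrite /P4.
rewrite !ext_anti ext_six !phi_ext -!ext_tau !ext_tr // -!phi_sg.
(* Two factors of 6 arise here, one from the product and one from [mxM], which turns 3 into the 108
   of [derP]. *)
rewrite (_ : sg x *m mxM (sg y) = 6%:R *: sg (m x y)); last first.
  by rewrite sg_m scalerA mulfV // scale1r.
rewrite (_ : mxM (6%:R *: _) = 6%:R *: mxM (sg (m x y))); last first.
  have mxM0 : mxM 0 = 0 :> 'M[L]_26.
    by have := mxM_linear (-1) (0 : 'rV[L]_26) 0; rewrite scaler0 addr0 scaleN1r addNr.
  by have := mxM_linear 6%:R (sg (m x y)) 0; rewrite mxM0 !addr0.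
rewrite -scalemxAr linearZ /= ext_ml !ext_mm => E.
apply: (fmorph_inj iota); apply/eqP; rewrite -subr_eq0; apply/eqP; rewrite -[RHS]E.
rewrite !(rmorphD iota, rmorphN iota, rmorphM iota, rmorph_nat iota).
ring.
Qed.
End Transfer.

(** * Der(J) acts faithfully on W as the derivations of W *)

Section Restriction.
Variables (k : fieldType) (J : vectType k).
Variables (mul : {bilinear J -> J -> J}) (form : {biscalar J}) (e : J).
Hypothesis nz : forall n, (0 < n)%N -> all (fun p => p <= 13)%N (primes n) ->
  n%:R != 0 :> k.
Hypothesis he : forall x : J, mul e x = x /\ mul x e = x.
Hypothesis formee : form e e = 3%:R.
Hypothesis formmul : forall x y, form (mul x y) e = form x y.
Local Notation W := (subvs_of (traceless form e)).
Local Notation m := (wmul mul (form := form) (e := e)).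
Local Notation f := (wform (form := form) (e := e)).
Hypothesis mC : forall a b, m a b = m b a.
Hypothesis m_lin : forall b, linear (m b).
Hypothesis fC : forall a b, f a b = f b a.
Hypothesis f_lin : forall b, scalar (f b).
Hypothesis f_nondeg : forall x, (forall y, f x y = 0) -> x = 0.
Hypothesis fA : forall a b c, f (m a b) c = f a (m b c).
Hypothesis cubic : forall a b c, m a (m b c) + m b (m c a) + m c (m a b) =
  6%:R^-1 *: (f a b *: c + f b c *: a + f c a *: b).
Hypothesis trL : forall a, trf f (m a) = 0.
Hypothesis tr1 : trf f id = 26%:R.
Local Notation g := (subvs_of (der mul)).

Let n3 : 3%:R != 0 :> k. Proof. exact: nz. Qed.

Lemma wproj_val x : vsval (wproj form e x) = x - (3%:R^-1 * form x e) *: e.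
Proof.
rewrite /wproj vsprojK // mem_traceless linearBl /= linearZl_LR /=.
by rewrite formee mulrAC mulVf // mul1r subrr.
Qed.

Lemma val_e (w : W) : form (vsval w) e = 0.
Proof. by apply/eqP; rewrite -mem_traceless subvsP. Qed.

Lemma wproj_lin : linear (wproj form e).
Proof.
move=> c x y; apply: val_inj; rewrite /= !wproj_val linearPl /=.
by rewrite mulrDr mulrCA scalerDl opprD addrACA scalerBr scalerA.
Qed.
HB.instance Definition _ := GRing.isLinear.Build k J W _ (wproj form e) wproj_lin.

Lemma wprojK (w : W) : wproj form e (vsval w) = w.
Proof. by apply: val_inj; rewrite /= wproj_val val_e mulr0 scale0r subr0. Qed.

Lemma wproj_e : wproj form e e = 0.
Proof.
by apply: val_inj; rewrite /= wproj_val formee mulVf // scale1r subrr.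
Qed.

Lemma wproj_decomp x : x = vsval (wproj form e x) + (3%:R^-1 * form x e) *: e.
Proof. by rewrite wproj_val subrK. Qed.

Lemma mul_val (a b : W) :
  mul (vsval a) (vsval b) = vsval (m a b) + (3%:R^-1 * f a b) *: e.
Proof. by rewrite [LHS]wproj_decomp formmul. Qed.

Lemma der_e (X : g) : vsval X e = 0.
Proof.
have /mem_der dX := subvsP X; have := dX e e.
rewrite (proj1 (he e)) (proj1 (he _)) (proj2 (he _)) => /eqP.
by rewrite -subr_eq0 opprD addNKr oppr_eq0 => /eqP.
Qed.

Definition rho (X : g) : 'End(W) :=
  linfun (fun w : W => wproj form e (vsval X (vsval w))).

Lemma rhoE (X : g) (w : W) : rho X w = wproj form e (vsval X (vsval w)).
Proof. by rewrite linfunP // => c u v; rewrite !linearP. Qed.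

Definition lam (X : g) (w : W) : k := 3%:R^-1 * form (vsval X (vsval w)) e.

Lemma der_val (X : g) (w : W) : vsval X (vsval w) = vsval (rho X w) + lam X w *: e.
Proof. by rewrite rhoE -wproj_decomp. Qed.

Lemma rho_m X a b :
  rho X (m a b) = m (rho X a) b + m a (rho X b) + lam X a *: b + lam X b *: a.
Proof.
have /mem_der dX := subvsP X.
have := congr1 (wproj form e) (dX (vsval a) (vsval b)).
rewrite mul_val linearD linearZ /= der_e scaler0 addr0 -rhoE !der_val.
rewrite linearDl linearDr /= linearZl_LR linearZr_LR /= (proj1 (he _)) (proj2 (he _)).
rewrite !mul_val !(linearD, linearZ) /= !wprojK !wproj_e !scaler0 !addr0 => ->.
by rewrite addrACA addrA.
Qed.

(** Derivations of J preserve W. By [rho_m] the commutator of X with L_a is L_(Xa) plus lam(a) id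
    plus a rank-one map of trace lam(a), so its vanishing trace reads (26 + 1) lam(a) = 0. *)
Lemma lam0 X a : lam X a = 0.
Proof.
have lamD (u v : W) : lam X (u + v) = lam X u + lam X v.
  by rewrite /lam !linearD /= linearDl /= mulrDr.
have lamZ c (u : W) : lam X (c *: u) = c * lam X u.
  by rewrite /lam !linearZ /= linearZl_LR /= mulrCA.
have lam00 : lam X 0 = 0 by rewrite -(scale0r 0) lamZ mul0r.
have E : trf f (fun w => rho X (m a w)) = trf f (fun w => m a (rho X w)).
  by rewrite trfC // => c u v; rewrite linearP.
move: E; rewrite (eq_trf f (rho_m X a)) !trfD // trfZ //.
rewrite [trf f (fun w => m _ w)]trL add0r -[trf f (fun w => w)]/(trf f id) tr1.
have -> : trf f (fun w => lam X w *: a) = lam X a.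
  rewrite [in RHS](dvec_sum (f := f) fC f_lin f_nondeg a) (big_morph _ lamD lam00).
  by apply: eq_bigr => i _; rewrite lamZ [LHS]fC (fZr f_lin) mulrC fC.
rewrite -addrA => /eqP; rewrite -subr_eq0 addrAC subrr add0r => /eqP E.
have n27 : 27%:R != 0 :> k by apply: nz.
by apply: (mulIf n27); rewrite mul0r -[RHS]E (natrD _ 26 1) mulrDr mulr1.
Qed.

Lemma rho_deriv X : deriv m (rho X).
Proof. by move=> a b; rewrite rho_m !lam0 !scale0r !addr0. Qed.

Lemma der_rho (X : g) x : vsval X x = vsval (rho X (wproj form e x)).
Proof.
by rewrite [in LHS](wproj_decomp x) linearD linearZ /= der_e scaler0 addr0 der_val
  lam0 scale0r addr0.
Qed.

Lemma rho_linear : linear rho.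
Proof.
by move=> c X Y; apply/lfunP => w; rewrite lfun_linE !rhoE /= lfun_linE linearP.
Qed.

Lemma rho_injective : injective rho.
Proof.
by move=> X Y E; apply: val_inj => /=; apply/lfunP => x; rewrite !der_rho E.
Qed.

Lemma rho_der_br X Y w :
  rho (der_br mul X Y) w = rho X (rho Y w) - rho Y (rho X w).
Proof.
rewrite [LHS]rhoE der_br_apply linearB /=.
by rewrite 2!der_val !lam0 !scale0r !addr0 -!rhoE.
Qed.

Definition der_lift (U : 'End(W)) : 'End(J) :=
  linfun (fun x => vsval (U (wproj form e x))).

Lemma der_liftE U x : der_lift U x = vsval (U (wproj form e x)).
Proof. by rewrite linfunP // => c u v; rewrite !linearP. Qed.

(** Extended by zero on e. The W-component of the Leibniz rule is that of U, and the e-component is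
    the skewness of U. *)
Lemma der_lift_der U : deriv m U -> der_lift U \in der mul.
Proof.
move=> dU.
have sU := deriv_skew nz mC m_lin fC f_lin f_nondeg cubic trL tr1 dU.
have wpK (a : W) s : wproj form e (vsval a + s *: e) = a.
  by rewrite linearD linearZ /= wprojK wproj_e scaler0 addr0.
have H (a b : W) s t : der_lift U (mul (vsval a + s *: e) (vsval b + t *: e)) =
    mul (der_lift U (vsval a + s *: e)) (vsval b + t *: e)
    + mul (vsval a + s *: e) (der_lift U (vsval b + t *: e)).
  rewrite !der_liftE !wpK !(linearDl, linearDr) /= !(linearZl_LR, linearZr_LR) /=.
  rewrite !(proj1 (he _)) !(proj2 (he _)) !mul_val !linearD !linearZ /= !wprojK.
  rewrite wproj_e !linear0 !addr0 dU linearD /= sU mulrN scaleNr.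
  have H4 (A B E T S : J) : A + B + T + S = A - E + T + (B + E + S).
    rewrite [A - E + T]addrAC [B + E + S]addrAC [RHS]addrACA addNr addr0.
    by rewrite addrACA addrA.
  exact: H4.
by apply/mem_der => x y; rewrite (wproj_decomp x) (wproj_decomp y) H.
Qed.

Definition delta (a b : W) : g := vsproj (der mul) (der_lift (dop m f a b)).

Lemma rho_delta a b : rho (delta a b) = dop m f a b.
Proof.
apply/lfunP => w; rewrite rhoE vsprojK; last first.
  exact/der_lift_der/(dfun_deriv nz mC m_lin fC f_lin f_nondeg fA cubic).
by rewrite der_liftE wprojK wprojK.
Qed.

End Restriction.

(** * Assembly *)

Theorem theorem5p16 (k : fieldType) (J : vectType k)
    (mul : {bilinear J -> J -> J}) (form : {biscalar J}) (e : J)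
    (hk : [pchar k] =i pred0 \/ exists2 p : nat, p \in [pchar k] & (13 < p)%N)
    (hJ : is_albert mul form)
    (he : forall x : J, mul e x = x /\ mul x e = x) :
  (forall u v : sym2 (subvs_of (traceless form e)),
     u \in sym2_alg mul form e -> v \in sym2_alg mul form e ->
     star mul u v \in sym2_alg mul form e) /\
  exists dia : {bilinear subvs_of (cg_alg (der_br mul) 9%:R)
                         -> subvs_of (cg_alg (der_br mul) 9%:R)
                         -> subvs_of (cg_alg (der_br mul) 9%:R)},
    [/\ is_diamond dia,
        forall x y, dia x y = dia y x
      & exists phi : {linear subvs_of (cg_alg (der_br mul) 9%:R)
                             -> subvs_of (sym2_alg mul form e)},
          bijective phi /\
          forall x y,
            vsval (phi (dia x y)) = star mul (vsval (phi x)) (vsval (phi y))].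
Proof.
have nz n : (0 < n)%N -> all (fun p => p <= 13)%N (primes n) -> n%:R != 0 :> k.
  exact: smooth_neq0.
have n2 : 2%:R != 0 :> k by apply: nz.
have n3 : 3%:R != 0 :> k by apply: nz.
have [mulC formC [formee formmul]] := albert_split n2 n3 hJ he.
case=> L [iota [sg [S [S' [SS' S'S sgE sg_m phi_sg]]]]].
have mC := tr_mC SS' sgE sg_m; have m_lin := tr_m_lin SS' sgE sg_m.
have fC' := tr_fC phi_sg; have f_lin := tr_f_lin sgE phi_sg.
have f_nondeg := tr_f_nondeg nz SS' S'S sgE phi_sg.
have fA := tr_fA sg_m phi_sg.
have cubic := tr_cubic nz SS' sgE sg_m phi_sg.
have trL := tr_trL nz SS' S'S sgE sg_m phi_sg.
have tr1 := tr_tr1 nz SS' S'S sgE phi_sg.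
have derZ := tr_derZ nz SS' S'S sgE sg_m phi_sg.
have derQ := tr_derQ nz SS' S'S sgE sg_m phi_sg.
have derP := tr_derP nz SS' S'S sgE sg_m phi_sg.
have opE := @sym2_op_sprod k J form e.
(* The identity is a symmetric operator, so by [sym2_ofK] it lies in the image of [sym2_op] and the
   generalised inverse defining [sym2_id] is a true preimage. *)
have op_id x : sym2_op form e (sym2_id form e) x = x.
  have sT : forall x y, wform (\1%VF x : subvs_of (traceless form e)) y = wform x (\1%VF y).
    by move=> a b; rewrite !id_lfunE.
  have E := sym2_ofK nz fC' f_lin f_nondeg opE sT.
  rewrite /sym2_id limg_lfunVK ?id_lfunE //; rewrite -[X in X \in _]E.
  by rewrite memv_img ?memvf.
have star_l (v : sym2 (subvs_of (traceless form e))) : linear (fun u => star mul u v).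
  by move=> c x y; rewrite /star linearP.
have star_r u : linear (@star k J mul form e u).
  move=> c x y; rewrite /star -sym2_lift_funP; apply: eq_sym2_lift => a b.
  by rewrite sym2_lift_is_linear.
have rl := rho_linear nz formee.
have ri := rho_injective nz he formee formmul m_lin fC' f_lin f_nondeg trL tr1.
have rb := rho_der_br nz he formee formmul m_lin fC' f_lin f_nondeg trL tr1.
have rd := rho_deriv nz he formee formmul m_lin fC' f_lin f_nondeg trL tr1.
have rD := rho_delta nz he formee formmul mC m_lin fC' f_lin f_nondeg fA cubic trL tr1.
exact: (chayet_garibaldi_albert nz mC m_lin fC' f_lin f_nondeg fA cubic trL tr1
  opE (sym2_mulE mulC) (@sym2_mul_linear k J mul form e)
  (@sym2_mul_linearr k J mul form e) op_id (star_sprod mul formC)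
  star_l star_r (rl mul) ri rb rd rD derZ derQ derP).
Qed.
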